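(* Let $\mu\in\mathscr{E}_d$ and $\nu\in\mathscr{E}_{d'}$ be Gibbs capacities, $D=d+d'$, and let $\xi=\mu\times\nu$ be the product capacity on $[0,1]^D$. Then $\xi$ satisfies the strong multifractal formalism (SMF) and $\tau_\xi=\tau_\mu+\tau_\nu$.
   Context: **Gibbs capacities.** For a $\mathbb{Z}^m$-periodic Hölder continuous $\varphi:\mathbb{R}^m\to\mathbb{R}$, the Gibbs measure $\eta_\varphi$ is the weak limit as $n\to\infty$ of the measures with density $\exp(S_n\varphi(x))/\int_{[0,1]^m}\exp(S_n\varphi(t))\,dt$ with respect to Lebesgue measure, $S_n\varphi(x)=\sum_{k=0}^{n-1}\varphi(2^kx)$; it is $\mathbb{Z}^m$-periodic and identified with its restriction to $[0,1]^m$. $\mathscr{E}_m=\{\eta^s:\eta\text{ a Gibbs measure on }\mathbb{R}^m,\ s>0\}$, where $\eta^s(E)=\eta(E)^s$. **Product.** $\xi=\mu\times\nu$ is the (monotone) set function with $\xi(A\times B)=\mu(A)\,\nu(B)$ for Borel $A\subset[0,1]^d$, $B\subset[0,1]^{d'}$; only its values on products, in particular on dyadic cubes and sup-norm balls, matter. **Multifractal quantities.** $\Lambda^m_j$ is the set of dyadic cubes $\prod_i[k_i2^{-j},(k_i+1)2^{-j})$, $k\in\{0,\dots,2^j-1\}^m$. For a set function $\kappa$ on $[0,1]^m$: $\tau_\kappa(t)=\liminf_{j\to\infty}\frac{1}{-j}\log_2\sum_{\lambda\in\Lambda^m_j}\kappa(\lambda)^t$ for $t\in\mathbb{R}$ (with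 $0^t=0$); $\tau_\kappa^*(h)=\inf_{t\in\mathbb{R}}(ht-\tau_\kappa(t))$; $\underline h_\kappa(x)$ and $\overline h_\kappa(x)$ are the liminf and limsup as $\rho\to0^+$ of $\log\kappa(B(x,\rho))/\log\rho$, $x\in\operatorname{supp}\kappa$; $\sigma_\kappa(h)=\dim_H\{x:\underline h_\kappa(x)=h\}$; $E_\kappa(h)=\{x:\underline h_\kappa(x)=\overline h_\kappa(x)=h\}$; $\dim_H\emptyset=-\infty$. $\kappa$ satisfies the SMF if for every $h\ge0$, $\sigma_\kappa(h)=\tau_\kappa^*(h)=\dim_HE_\kappa(h)$. *)

(* Defs.v *)
From HB Require Import structures.
From mathcomp Require Import all_boot all_order all_algebra.
From mathcomp Require Import all_classical all_reals all_analysis.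
From mathcomp Require Import measurable_realfun.

Set Implicit Arguments.
Unset Strict Implicit.
Unset Printing Implicit Defensive.

Import Order.TTheory GRing.Theory Num.Theory.
Import numFieldNormedType.Exports.

Local Open Scope classical_set_scope.
Local Open Scope ring_scope.

(* R^m is 'rV[R]_m, whose norm and balls are those of the sup norm; borel_rV is
   the same type with its Borel sigma-algebra. *)
Definition borel_rV (R : realType) (m : nat) :=
  g_sigma_algebraType (@open 'rV[R]_m).

Definition cons_rV (R : realType) (m : nat)
    (p : measurableTypeR R * borel_rV R m) : borel_rV R m.+1 :=
  row_mx (p.1%:M : 'rV[R]_1) (p.2 : 'rV[R]_m).

Definition uncons_rV (R : realType) (m : nat)
    (v : borel_rV R m.+1) : measurableTypeR R * borel_rV R m :=
  ((v : 'rV[R]_m.+1) ord0 ord0, rsubmx (v : 'rV[R]_(1 + m))).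

Section cons_rV_measurable.
Variables (R : realType) (m : nat).

Lemma cons_rVK : cancel (@cons_rV R m) (@uncons_rV R m).
Proof.
case=> x v; rewrite /cons_rV /uncons_rV /= row_mxKr; congr pair.
have := row_mxEl (x%:M : 'rV[R]_1) (v : 'rV[R]_m) ord0 ord0.
rewrite [X in _ = X]mxE eqxx mulr1n; apply: etrans.
by have -> : ord0 = lshift m (ord0 : 'I_1) :> 'I_m.+1 by exact: val_inj.
Qed.

Lemma measurable_cons_rV : measurable_fun setT (@cons_rV R m).
Proof.
apply: (@measurability _ _ _ (borel_rV R m.+1) setT (@cons_rV R m)
  (@open 'rV[R]_m.+1) erefl).
move=> _ [U oU <-]; rewrite setTI.
pose B (i : rat * 'rV[rat]_m * nat) : set (measurableTypeR R * borel_rV R m) :=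
  (ball (ratr i.1.1 : R) (i.2.+1%:R^-1 : R)) `*`
  (ball (map_mx ratr i.1.2 : 'rV[R]_m) (i.2.+1%:R^-1 : R)).
have -> : @cons_rV R m @^-1` U =
    \bigcup_(i in [set i | B i `<=` @cons_rV R m @^-1` U]) B i.
  apply/seteqP; split => [[x v] /= Uxv|p [i Bi] /Bi//].
  have /nbhs_ballP[e /= e0 eU] := open_nbhs_nbhs (conj oU Uxv).
  have [k ke] : exists k, (k.+1%:R^-1 : R) < e / 2.
    have /cvgrPdist_lt /(_ (e / 2)) := @cvg_harmonic R.
    rewrite divr_gt0// => /(_ isT)[k _ /(_ k)/=]; rewrite sub0r normrN.
    by rewrite ger0_norm// => /(_ (leqnn _)) ?; exists k.
  pose d : R := k.+1%:R^-1.
  have d0 : 0 < d by rewrite invr_gt0.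
  have near (y : R) : {q : rat | `|ratr q - y| < d}.
    have /cid[q] : exists q : rat, ratr q \in `](y - d), (y + d)[.
      by apply: rat_in_itvoo; rewrite ltrD2l gtrN.
    by rewrite in_itv/= => /andP[q1 q2]; exists q; rewrite ltr_distl q1 q2.
  have [q qx] := near x.
  pose w : 'rV[rat]_m := \row_j projT1 (near ((v : 'rV[R]_m) ord0 j)).
  have wv j : `|ratr (w ord0 j) - (v : 'rV[R]_m) ord0 j| < d.
    by rewrite mxE; case: (near _).
  exists ((q, w), k) => /=; last first.
    by split => //=; split => // i j; rewrite ord1 mxE; exact: wv.
  move=> [y u] [/= yq [_ uw]]; apply: eU; split => // i j.
  rewrite ord1.
  have tri (a b c : R) : `|a - b| < d -> `|a - c| < d -> `|b - c| < e.
    move=> ab ac; rewrite [ltRHS]splitr.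
    have -> : b - c = (a - c) - (a - b) by rewrite opprB [RHS]addrC subrKA.
    rewrite (le_lt_trans (ler_normB _ _))// ltrD// (lt_trans _ ke)//.
  change (`|row_mx (x%:M : 'rV[R]_1) (v : 'rV[R]_m) ord0 (j : 'I_(1 + m)) -
            row_mx (y%:M : 'rV[R]_1) (u : 'rV[R]_m) ord0 j| < e).
  case: (split_ordP (j : 'I_(1 + m))) => l ->.
    by rewrite !row_mxEl !mxE !ord1 eqxx !mulr1n; exact: tri qx yq.
  rewrite !row_mxEr; apply: tri (wv l) _.
  by have := uw ord0 l; rewrite mxE.
rewrite bigcup_mkcond; apply: countable_bigcupT_measurable => [|i].
  exact: countableP.
case: ifP => // _; apply: measurableX.
  by apply: open_measurable; exact: ball_open.
by apply: sub_sigma_algebra; exact: ball_open.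
Qed.

Lemma measurable_uncons_rV : measurable_fun setT (@uncons_rV R m).
Proof.
apply: measurable_fun_pair.
  apply: (measurability _ (RGenOpens.measurableE R)).
  move=> _ [U [a [b ->]] <-]; rewrite setTI; apply: sub_sigma_algebra.
  apply: open_comp; last exact: interval_open.
  by move=> v _; exact: coord_continuous.
apply: (@measurability _ _ _ (borel_rV R m) setT _ (@open 'rV[R]_m) erefl).
move=> _ [U oU <-]; rewrite setTI; apply: sub_sigma_algebra.
apply: (@open_comp _ _ (rsubmx : 'rV[R]_(1 + m) -> 'rV[R]_m)) => //.
move=> v _ A /nbhs_ballP[e /= e0 eA]; apply/nbhs_ballP; exists e => //= w vw.
by apply: eA; split => // i j; rewrite !mxE; case: vw => _; exact.
Qed.

End cons_rV_measurable.

Section lebesgue_cons.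
Variables (R : realType) (m : nat).
Variable mu : {sigma_finite_measure set (borel_rV R m) -> \bar R}.
Local Open Scope ereal_scope.

Definition lebesgue_cons : set (borel_rV R m.+1) -> \bar R :=
  pushforward (@lebesgue_measure R \x mu) (@cons_rV R m).

Let measurable_preimage_cons (A : set (borel_rV R m.+1)) :
  measurable A -> measurable (@cons_rV R m @^-1` A).
Proof.
by move=> mA; rewrite -[X in measurable X]setTI; exact: measurable_cons_rV.
Qed.

Let lebesgue_cons0 : lebesgue_cons set0 = 0.
Proof. by rewrite /lebesgue_cons /pushforward preimage_set0 measure0. Qed.

Let lebesgue_cons_ge0 A : 0 <= lebesgue_cons A.
Proof. by rewrite /lebesgue_cons /pushforward measure_ge0. Qed.

Let lebesgue_cons_sigma_additive : semi_sigma_additive lebesgue_cons.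
Proof.
move=> F mF tF mUF; rewrite /lebesgue_cons /pushforward preimage_bigcup.
apply: measure_semi_sigma_additive => [n||].
- exact: measurable_preimage_cons.
- apply/trivIsetP => /= i j _ _ ij; rewrite -preimage_setI.
  by move/trivIsetP : tF => /(_ _ _ _ _ ij) ->//; rewrite preimage_set0.
- by rewrite -preimage_bigcup; exact: measurable_preimage_cons.
Qed.

HB.instance Definition _ := isMeasure.Build _ _ _ lebesgue_cons
  lebesgue_cons0 lebesgue_cons_ge0 lebesgue_cons_sigma_additive.

Let lebesgue_cons_sigma_finite : sigma_finite setT lebesgue_cons.
Proof.
have /sigma_finiteP[F [TF ndF Foo]] := sigma_finiteT (@lebesgue_measure R).
have /sigma_finiteP[G [TG ndG Goo]] := sigma_finiteT mu.
exists (fun n => @uncons_rV R m @^-1` (F n `*` G n)).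
  rewrite -preimage_bigcup (_ : \bigcup_n _ = setT) ?preimage_setT//.
  rewrite -setXTT TF TG predeqE => -[x y]; split; last first.
    by move=> [/= [n _ Fnx] [k _ Gky]]; exists (maxn n k) => //; split;
      [move: x Fnx; exact/subsetPset/ndF/leq_maxl|
       move: y Gky; exact/subsetPset/ndG/leq_maxr].
  by move=> [n _ []/= ? ?]; split; exists n.
move=> k; have [? ?] := Foo k; have [? ?] := Goo k.
have mFG : measurable (F k `*` G k) by exact: measurableX.
split; first by rewrite -[X in measurable X]setTI; exact: measurable_uncons_rV.
rewrite /lebesgue_cons /pushforward -comp_preimage.
rewrite (_ : _ \o _ = id); last by apply/funext => p; exact: cons_rVK.
by rewrite preimage_id product_measure1E// lte_mul_pinfty// ge0_fin_numE.
Qed.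

HB.instance Definition _ := Measure_isSigmaFinite.Build _ _ _
  lebesgue_cons lebesgue_cons_sigma_finite.

End lebesgue_cons.

(* Lebesgue measure on R^m, built as an iterated product measure. *)
Fixpoint lebesgue_rV (R : realType) (m : nat) :
    {sigma_finite_measure set (borel_rV R m) -> \bar R} :=
  match m with
  | 0 => @dirac _ (borel_rV R 0) (0 : 'rV[R]_0) R
  | m'.+1 => lebesgue_cons (lebesgue_rV R m')
  end.

Definition cube (R : realType) (m : nat) : set 'rV[R]_m :=
  [set x : 'rV[R]_m | forall i, 0 <= x ord0 i <= 1].

Section gibbs.
Variables (R : realType) (m : nat).
Implicit Type phi : 'rV[R]_m -> R.

Definition Zperiodic phi :=
  forall (k : 'rV[int]_m) x, phi (x + map_mx intr k) = phi x.

Definition hoelder_continuous phi := exists alpha C : R,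
  [/\ 0 < alpha, alpha <= 1 &
      forall x y, `|phi x - phi y| <= C * `|x - y| `^ alpha].

Definition birkhoff_sum phi (n : nat) (x : 'rV[R]_m) : R :=
  \sum_(k < n) phi (2 ^+ k *: x).

Definition gibbs_density phi n (x : 'rV[R]_m) : R :=
  expR (birkhoff_sum phi n x) /
  \int[lebesgue_rV R m]_(t in @cube R m) expR (birkhoff_sum phi n t).

(* The measures at hand are periodic, hence infinite, so the weak limit is
   taken against continuous functions with compact support. *)
Definition gibbs_measure (eta : {measure set (borel_rV R m) -> \bar R}) :=
  exists phi, [/\ Zperiodic phi, hoelder_continuous phi &
    forall f : 'rV[R]_m -> R, continuous f ->
      (exists2 K : set 'rV[R]_m, compact K & forall x, ~ K x -> f x = 0) ->
      (\int[lebesgue_rV R m]_x (f x * gibbs_density phi n x)%:E)%E @[n --> \oo]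
        --> (\int[eta]_x (f x)%:E)%E].

Definition borel_cube (E : set 'rV[R]_m) :=
  (measurable : set (set (borel_rV R m))) E /\ E `<=` @cube R m.

(* A set function on [0,1]^m is a function on all sets, of which only the values
   on the Borel subsets of the cube matter. *)
Definition gibbs_capacity (kappa : set 'rV[R]_m -> R) :=
  exists (eta : {measure set (borel_rV R m) -> \bar R}) (s : R),
    [/\ gibbs_measure eta, 0 < s &
        forall E, borel_cube E -> kappa E = fine (eta E) `^ s].

End gibbs.

Definition setX_rV (R : realType) (d d' : nat) (A : set 'rV[R]_d)
    (B : set 'rV[R]_d') : set 'rV[R]_(d + d') :=
  [set x | A (lsubmx x) /\ B (rsubmx x)].

Definition product_capacity (R : realType) (d d' : nat)
    (mu : set 'rV[R]_d -> R) (nu : set 'rV[R]_d' -> R)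
    (xi : set 'rV[R]_(d + d') -> R) :=
  (forall E F, borel_cube E -> borel_cube F -> E `<=` F -> xi E <= xi F) /\
  (forall A B, borel_cube A -> borel_cube B -> xi (setX_rV A B) = mu A * nu B).

Section hausdorff.
Variables (R : realType) (V : normedModType R).
Implicit Type A : set V.
Local Open Scope ereal_scope.

Definition diam A : \bar R :=
  ereal_sup [set `|x.1 - x.2|%:E | x in A `*` A].

(* diam(U)^s, with 0^0 = 1 for a singleton but the value 0 for U empty *)
Definition diam_pow (s : R) (U : set V) : \bar R :=
  if U == set0 then 0 else poweR (diam U) s.

Definition hausdorff_premeasure (delta s : R) A : \bar R :=
  ereal_inf [set \sum_(i <oo) diam_pow s (U i) | U in
    [set U : (set V)^nat |
      A `<=` \bigcup_i U i /\ forall i, diam (U i) <= delta%:E]].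

Definition hausdorff_measure (s : R) A : \bar R :=
  ereal_sup [set hausdorff_premeasure delta s A |
              delta in [set delta : R | (0 < delta)%R]].

Definition hausdorff_dim A : \bar R :=
  if A == set0 then -oo
  else ereal_inf [set s%:E |
                   s in [set s : R | (0 <= s)%R /\ hausdorff_measure s A = 0]].

End hausdorff.

Section multifractal.
Variables (R : realType) (m : nat) (kappa : set 'rV[R]_m -> R).

Definition dyadic_cube (j : nat) (k : 'rV['I_(2 ^ j)]_m) : set 'rV[R]_m :=
  [set x : 'rV[R]_m | forall i,
    (k ord0 i)%:R / 2 ^+ j <= x ord0 i < (k ord0 i).+1%:R / 2 ^+ j].

(* a^t with the convention 0^t = 0 for all t, including t = 0 *)
Definition powR00 (a t : R) : R := if a == 0 then 0 else a `^ t.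

Definition tau (t : R) : \bar R :=
  limn_einf (fun j : nat =>
    (- (j%:R * ln 2)^-1)%:E *
    lne (\sum_(k : 'rV['I_(2 ^ j)]_m) powR00 (kappa (dyadic_cube k)) t)%:E)%E.

Definition legendre (f : R -> \bar R) (h : R) : \bar R :=
  ereal_inf [set ((h * t)%:E - f t)%E | t in [set: R]].

Definition ball_cap (x : 'rV[R]_m) (rho : R) : R :=
  kappa (ball x rho `&` @cube R m).

Definition cap_supp : set 'rV[R]_m :=
  [set x | @cube R m x /\ forall rho, 0 < rho -> 0 < ball_cap x rho].

Definition lower_dim (x : 'rV[R]_m) : \bar R :=
  limf_einf (fun rho : R => (ln (ball_cap x rho) / ln rho)%:E) 0^'+.

Definition upper_dim (x : 'rV[R]_m) : \bar R :=
  limf_esup (fun rho : R => (ln (ball_cap x rho) / ln rho)%:E) 0^'+.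

Definition lower_level (h : R) : set 'rV[R]_m :=
  [set x | cap_supp x /\ lower_dim x = h%:E].

Definition level (h : R) : set 'rV[R]_m :=
  [set x | [/\ cap_supp x, lower_dim x = h%:E & upper_dim x = h%:E]].

Definition spectrum (h : R) : \bar R := hausdorff_dim (lower_level h).

Definition SMF := forall h : R, 0 <= h ->
  spectrum h = legendre tau h /\ legendre tau h = hausdorff_dim (level h).

End multifractal.

(* Main.v *)
(* Write [S_j psi] for the Birkhoff sums of the doubling map.  By translation invariance of
   Lebesgue measure, all dyadic cells of level j carry, up to a bounded factor, the mass
   [exp(S_j phi) * c(j, n)] with the same constant [c(j, n)]; testing the weak limit against
   bump functions turns this into the Gibbs property
   [eta(ball of radius 2^-j at x) ~ exp(S_j phi(x) - j P)].  Hence the product capacity satisfies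
   [xi ~ exp(- S_j psi)] on cubes and balls, with psi a sum of two Hoelder potentials of separate
   variables; the sums over dyadic cubes factor, so the pressures, and thus tau, add up.

   The pressure exists because the logarithms of these sums are quasi-additive.  The bound of the
   spectrum by the Legendre transform of tau is a covering argument.  For the converse inequality
   no differentiability of the pressure is needed: at the minimum t0 of the exponential sum
   [t |-> sum_w exp(t Z(w))] over words of a fixed length, the linear term of its expansion
   vanishes, so by Chernoff's bound the tilted weights concentrate on typical concatenations of
   words, which makes these numerous.  They are the blocks of a Moran set inside [E_xi(h)]; its
   coding by mixed-radix digits of [0, 1) is expanding, which bounds its Hausdorff measure from
   below by Lebesgue measure. *)
From mathcomp Require Import all_boot all_order all_algebra.
From mathcomp Require Import all_classical all_reals all_analysis.
From mathcomp Require Import measurable_realfun.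
From mathcomp Require Import zify ring lra.
Require Import Defs.

Set Implicit Arguments.
Unset Strict Implicit.
Unset Printing Implicit Defensive.

Import Order.TTheory GRing.Theory Num.Theory.
Import numFieldNormedType.Exports.

Local Open Scope classical_set_scope.
Local Open Scope ring_scope.

(** * Lebesgue measure on row vectors *)

(** A product of powers of Gibbs measures with different exponents is in general not a power of one
    Gibbs measure. The proof therefore keeps of each factor only the two-sided estimate
    [gibbs_like], which passes to products, and establishes the formalism for that class. Masses are
    then known up to constant factors only. Each concatenation of words costs a bounded error, and
    long words make this error small against their length.

    The lower bound starts from one family of inequalities, [q <= P(t) + t H] for all real t, where
    q = tau*(h) ln 2, H = h ln 2 and P(t) is the pressure of [- t psi]. If h is an end point of the
    spectrum, the infimum over t may be approached only at infinity, and no minimum t0 would exist;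
    attaching to each word a sign with a bounded offset restores one. A fixed block length controls
    the Birkhoff averages only up to a tolerance; the Moran set uses tolerances tending to 0, so
    that a single set serves all exponents below tau*(h). *)

Section lebesgue_rV_theory.
Variable R : realType.

Lemma measurable_shiftR (a : R) :
  measurable_fun setT ((fun x => x + a) : measurableTypeR R -> measurableTypeR R).
Proof. exact: measurable_funD. Qed.

Lemma lebesgue_measure_shift (a : R) (A : set (measurableTypeR R)) :
  measurable A ->
  @lebesgue_measure R ((fun x => x + a) @^-1` A) = @lebesgue_measure R A.
Proof.
move=> mA; apply/esym.
pose p := pushforward (@lebesgue_measure R)
  ((fun x => x + a) : measurableTypeR R -> measurableTypeR R).
have mf := measurable_shiftR a.
apply: (@lebesgue_measure_unique _ p) => //= _ [[b c]] _ <-.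
rewrite /p /pushforward.
have -> : (fun x : R => x + a) @^-1` `]b, c]%classic = `](b - a), (c - a)]%classic.
  by apply/seteqP; split => x /=; rewrite !in_itv/= ltrBlDr lerBrDr.
by rewrite !lebesgue_measure_itv/= !lte_fin ltrD2r; case: ifP => // _;
  rewrite -!EFinD; congr EFin; ring.
Qed.

Lemma open_measurable_rV m (U : set 'rV[R]_m) :
  open U -> (measurable : set (set (borel_rV R m))) U.
Proof. by move=> oU; exact: sub_sigma_algebra. Qed.

Lemma continuous_measurable_rV m n (f : 'rV[R]_m -> 'rV[R]_n) :
  continuous f -> measurable_fun setT (f : borel_rV R m -> borel_rV R n).
Proof.
move=> cf; pose g : borel_rV R m -> borel_rV R n := f.
apply: (@measurability _ _ _ (borel_rV R n) setT g (@open 'rV[R]_n) erefl).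
by move=> _ [U oU <-]; rewrite setTI; apply: open_measurable_rV; apply: open_comp => // x _; exact: cf.
Qed.

Lemma continuous_measurable_real m (f : 'rV[R]_m -> R) :
  continuous f -> measurable_fun setT (f : borel_rV R m -> R).
Proof.
move=> cf; apply: (measurability _ (RGenOpens.measurableE R)).
move=> _ [U [a [b ->]] <-]; rewrite setTI; apply: open_measurable_rV.
by apply: open_comp; [move=> v _; exact: cf|exact: interval_open].
Qed.

Lemma measurable_coord m (i : 'I_m) :
  measurable_fun setT ((fun x => x ord0 i) : borel_rV R m -> R).
Proof. by apply: continuous_measurable_real => x; exact: coord_continuous. Qed.

Lemma measurable_shift m (a : 'rV[R]_m) :
  measurable_fun setT ((fun x => x + a) : borel_rV R m -> borel_rV R m).
Proof.
apply: (@continuous_measurable_rV m m (fun x => x + a)) => x.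
apply: (@continuousD _ 'rV[R]_m 'rV[R]_m id (cst a) x).
  exact: cvg_id.
exact: cst_continuous.
Qed.

(** Induction on the dimension: the translated product measure agrees with the product measure on
    rectangles, and [product_measure_unique] extends this to Borel sets. *)
Lemma lebesgue_rV_shift m (a : 'rV[R]_m) (A : set (borel_rV R m)) :
  measurable A ->
  lebesgue_rV R m ((fun x => x + a) @^-1` A) = lebesgue_rV R m A.
Proof.
elim: m a A => [|m IH] a A mA.
  by congr (lebesgue_rV R 0 _); apply/seteqP; split => x /=;
    rewrite [x + a]thinmx0 [x]thinmx0.
pose a0 : R := (a : 'rV[R]_(1 + m)) ord0 ord0.
pose a' : 'rV[R]_m := rsubmx (a : 'rV[R]_(1 + m)).
pose t (p : measurableTypeR R * borel_rV R m) :
    measurableTypeR R * borel_rV R m :=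
  (p.1 + a0, (p.2 : 'rV[R]_m) + a').
have mt : measurable_fun setT t.
  apply: measurable_fun_pair.
    by apply: measurable_funD => //; exact: measurable_fst.
  exact: measurableT_comp (measurable_shift a') measurable_snd.
pose m' := pushforward (@lebesgue_measure R \x lebesgue_rV R m)%E t.
have mcA : measurable (@cons_rV R m @^-1` A).
  by rewrite -[X in measurable X]setTI; exact: measurable_cons_rV.
rewrite /= /lebesgue_cons /pushforward.
transitivity (m' (@cons_rV R m @^-1` A)).
  have catE (x : R) (v : 'rV[R]_m) : row_mx (x%:M : 'rV_1) v + a =
      row_mx ((x + a0)%:M : 'rV[R]_1) (v + a').
    rewrite -[a in LHS](@hsubmxK _ 1 1 m) add_row_mx; congr row_mx.
    apply/rowP => i; rewrite !ord1 !mxE eqxx !mulr1n /a0; congr (_ + a _ _).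
    exact: val_inj.
  rewrite /m' /pushforward; congr (_ _).
  by apply/seteqP; split => -[x v] /=; rewrite /cons_rV /= catE.
apply/esym/product_measure_unique => //.
move=> B C mB mC.
transitivity ((@lebesgue_measure R \x lebesgue_rV R m)%E
  (((fun x => x + a0) @^-1` B) `*` ((fun v : 'rV[R]_m => v + a') @^-1` C))).
  by [].
rewrite product_measure1E; last 2 first.
- by rewrite -[X in measurable X]setTI; apply: measurable_shiftR.
- by rewrite -[X in measurable X]setTI; apply: measurable_shift.
by congr (_ * _)%E; [exact: lebesgue_measure_shift|exact: IH].
Qed.

Lemma measurable_cube m : (measurable : set (set (borel_rV R m))) (@cube R m).
Proof.
have -> : @cube R m = \bigcap_(i in [set: 'I_m])
    ((fun x : 'rV[R]_m => x ord0 i) @^-1` `[0, 1]%classic).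
  apply/seteqP; split => [x xQ i _|x xQ i]; first by rewrite /= in_itv/=; exact: xQ.
  by have := xQ i I; rewrite /= in_itv.
apply: fin_bigcap_measurable => // i _.
by rewrite -[X in measurable X]setTI; exact: measurable_coord.
Qed.

Lemma lebesgue_rV_cube m : lebesgue_rV R m (@cube R m) = 1%E.
Proof.
elim: m => [|m IH].
  by rewrite /= diracE mem_set//= => -[].
rewrite /= /lebesgue_cons /pushforward.
have -> : @cons_rV R m @^-1` (@cube R m.+1) = `[0, 1]%classic `*` @cube R m.
  apply/seteqP; split => [[x v] /= H|[x v] /= [x01 vQ] i].
    split; first have := H ord0.
      rewrite in_itv/=; have -> : ord0 = lshift m (ord0 : 'I_1) :> 'I_m.+1 by exact: val_inj.
      by rewrite /cons_rV (row_mxEl x%:M) mxE eqxx mulr1n.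
    move=> i; have := H (rshift 1 i).
    by rewrite /cons_rV (row_mxEr x%:M).
  rewrite /cons_rV /=; case: (split_ordP (i : 'I_(1 + m))) => l ->.
    by rewrite (ord1 l) (row_mxEl x%:M) mxE eqxx mulr1n; rewrite in_itv in x01.
  by rewrite (row_mxEr x%:M).
rewrite product_measure1E//; last exact: measurable_cube.
rewrite IH mule1; apply: etrans (lebesgue_measure_itv `[0, 1]) _.
by rewrite /= lte_fin ltr01 -EFinD subr0.
Qed.

End lebesgue_rV_theory.

(** * Birkhoff sums and pressure *)

Section row_norm.
Variable R : realType.

Lemma rV_norm_leP m (x : 'rV[R]_m) (e : R) :
  0 <= e -> reflect (forall i, `|x ord0 i| <= e) (`|x| <= e).
Proof.
move=> e0; rewrite [`|x|]mx_normrE; apply: (iffP idP).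
  by move=> /bigmax_leP[_ h] i; exact: (h (ord0, i)).
by move=> h; apply/bigmax_leP; split => // -[i j] _; rewrite (ord1 i); exact: h.
Qed.

Lemma coord_le_norm m (x : 'rV[R]_m) i : `|x ord0 i| <= `|x|.
Proof. by move: i; exact/rV_norm_leP. Qed.

Lemma norm_lsubmx d d' (x : 'rV[R]_(d + d')) : `|lsubmx x| <= `|x|.
Proof. by apply/rV_norm_leP => // i; rewrite mxE; exact: coord_le_norm. Qed.

Lemma norm_rsubmx d d' (x : 'rV[R]_(d + d')) : `|rsubmx x| <= `|x|.
Proof. by apply/rV_norm_leP => // i; rewrite mxE; exact: coord_le_norm. Qed.

Lemma rV_ballP m (x y : 'rV[R]_m) (e : R) :
  0 < e -> ball x e y <-> (forall i, `|x ord0 i - y ord0 i| < e).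
Proof.
move=> e0; split => [[_ h] i|h]; first exact: (h ord0 i).
by split => // i j; rewrite (ord1 i); exact: h.
Qed.

End row_norm.

Section birkhoff_theory.
Variables (R : realType) (m : nat).
Implicit Type phi : 'rV[R]_m -> R.

Lemma birkhoff_sumD phi i j x :
  birkhoff_sum phi (i + j) x =
  birkhoff_sum phi i x + birkhoff_sum phi j (2 ^+ i *: x).
Proof.
rewrite /birkhoff_sum big_split_ord/=; congr (_ + _).
by apply: eq_bigr => k _; rewrite scalerA -exprD addnC.
Qed.

Lemma birkhoff_sumS phi j x :
  birkhoff_sum phi j.+1 x = birkhoff_sum phi j x + phi (2 ^+ j *: x).
Proof. by rewrite /birkhoff_sum big_ord_recr. Qed.

Lemma birkhoff_periodic phi n : Zperiodic phi -> Zperiodic (birkhoff_sum phi n).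
Proof.
move=> per z x; apply: eq_bigr => k _; rewrite scalerDr.
have -> : 2 ^+ k *: map_mx intr z = map_mx intr (2 ^+ k *: z) :> 'rV[R]_m.
  by apply/rowP => i; rewrite !mxE rmorphM rmorphXn.
exact: per.
Qed.

(* The scale [8 / 2 ^ j] accommodates all dyadic cells that meet a ball of radius
   [2 / 2 ^ j], not only the cell of its center. *)
Definition tame phi (K : R) := Zperiodic phi /\
  forall j x y, `|x - y| <= 8 / 2 ^+ j ->
    `|birkhoff_sum phi j x - birkhoff_sum phi j y| <= K.

Lemma tame_ge0 phi K : tame phi K -> 0 <= K.
Proof.
move=> [_ /(_ 0%N 0 0)]; rewrite subrr normr0 => h.
by apply: le_trans (normr_ge0 _) (h _).
Qed.

(** At time k the two orbits are at distance at most 8 * 2^(k - j), so the Hoelder bounds of the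
    terms form a geometric series of ratio [r] = 2^-alpha. *)
Lemma hoelder_tame phi :
  Zperiodic phi -> hoelder_continuous phi -> exists K, tame phi K.
Proof.
move=> per [al [C [al0 al1 hC]]].
have C0 x y : `|phi x - phi y| <= `|C| * `|x - y| `^ al.
  by rewrite (le_trans (hC _ _))// ler_wpM2r ?powR_ge0 ?ler_norm.
pose r : R := 2^-1 `^ al.
have r0 : 0 <= r by exact: powR_ge0.
have r1 : r < 1.
  rewrite /r /powR gt_eqF ?invr_gt0// expR_lt1 pmulr_rlt0//.
  by rewrite ln_lt0// invr_gt0 ltr0n/= invf_lt1// ltr1n.
(* [A] solves the equation [(A + |C|) r = A], which closes the induction below. *)
pose A := `|C| * r / (1 - r).
have A0 : 0 <= A by rewrite divr_ge0 ?mulr_ge0// subr_ge0 ltW.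
have AC : (A + `|C|) * r = A.
  rewrite /A; field; rewrite subr_eq0 gt_eqF//.
(* The constant [c] is generalized because passing from level j + 1 to level j halves it. *)
have key j : forall c x y, 0 <= c -> `|x - y| <= c / 2 ^+ j ->
    `|birkhoff_sum phi j x - birkhoff_sum phi j y| <= A * c `^ al.
  elim: j => [|j IH] c x y c0 xy.
    by rewrite /birkhoff_sum !big_ord0 subrr normr0 mulr_ge0 ?powR_ge0.
  have c2 : 0 <= c * 2^-1 by rewrite mulr_ge0// invr_ge0.
  have xy' : `|x - y| <= c * 2^-1 / 2 ^+ j.
    by rewrite -mulrA -invfM -exprS.
  rewrite !birkhoff_sumS opprD addrACA (le_trans (ler_normD _ _))//.
  have h1 := IH _ _ _ c2 xy'.
  have h2 : `|phi (2 ^+ j *: x) - phi (2 ^+ j *: y)| <= `|C| * (c * 2^-1) `^ al.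
    rewrite (le_trans (C0 _ _))// ler_wpM2l// ge0_ler_powR ?nnegrE//.
      exact: ltW.
    by rewrite -scalerBr normrZ ger0_norm// mulrC -ler_pdivlMr// exprn_gt0.
  apply: le_trans (lerD h1 h2) _.
  by rewrite -mulrDl powRM ?invr_ge0// -/r (mulrC (c `^ al)) mulrA AC.
exists (A * 8 `^ al); split => // j x y xy; exact: key.
Qed.

Lemma int_part (x : 'rV[R]_m) : exists z : 'rV[int]_m,
  forall i, 0 <= (x - map_mx intr z) ord0 i < 1.
Proof.
exists (\row_i Num.floor (x ord0 i)) => i; rewrite !mxE.
by rewrite subr_ge0 ltrBlDr addrC -intrD1 floor_le floorD1_gt.
Qed.

Lemma tame_bounded phi K : tame phi K -> exists2 M, 0 <= M & forall x, `|phi x| <= M.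
Proof.
move=> [per dis]; exists (`|phi 0| + K).
  by rewrite addr_ge0// (tame_ge0 (conj per dis)).
move=> x; have [z zP] := int_part x.
rewrite -[x](subrK (map_mx intr z)) per; set y := x - _ in zP *.
rewrite -lerBlDl (le_trans (lerB_dist _ _))//.
(* At level 1 the admissible distance is 4, which exceeds the side of the unit cube, so [y] can be
   compared with the origin. *)
have := dis 1%N y 0; rewrite /birkhoff_sum !big_ord1 expr0 !scale1r subr0.
apply; apply/rV_norm_leP => [|i]; first by lra.
by have /andP[h1 h2] := zP i; rewrite ger0_norm//; lra.
Qed.

Lemma birkhoff_affine phi a c j x :
  birkhoff_sum (fun x => a * phi x + c) j x = a * birkhoff_sum phi j x + j%:R * c.
Proof.
rewrite /birkhoff_sum big_split/= -mulr_sumr; congr (_ + _).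
by rewrite big_const_ord iter_addr_0 mulr_natl.
Qed.

Lemma tame_affine phi K a c : tame phi K -> tame (fun x => a * phi x + c) (`|a| * K).
Proof.
move=> [per dis]; split=> [z x|j x y xy]; first by rewrite per.
rewrite !birkhoff_affine [X in `|X|](_ : _ = a * (birkhoff_sum phi j x - birkhoff_sum phi j y)); last by ring.
rewrite normrM ler_wpM2l//.
exact: dis.
Qed.

Lemma birkhoff_bounded phi M j x : (forall x, `|phi x| <= M) ->
  `|birkhoff_sum phi j x| <= j%:R * M.
Proof.
move=> h; rewrite (le_trans (ler_norm_sum _ _ _))//.
rewrite (le_trans (ler_sum _ (fun i _ => h _)))//.
by rewrite big_const_ord iter_addr_0 mulr_natl.
Qed.

Definition corner j (k : 'rV['I_(2 ^ j)]_m) : 'rV[R]_m :=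
  \row_i ((k ord0 i)%:R / 2 ^+ j).

Lemma corner_itv j (k : 'rV['I_(2 ^ j)]_m) i : 0 <= corner k ord0 i < 1.
Proof.
rewrite mxE divr_ge0//= ltr_pdivrMr ?exprn_gt0// mul1r -natrX ltr_nat.
exact: ltn_ord.
Qed.

Definition partition_sum phi j := \sum_k expR (birkhoff_sum phi j (@corner j k)).

Fact catw_lt i j (u : 'I_(2 ^ i)) (v : 'I_(2 ^ j)) : (u * 2 ^ j + v < 2 ^ (i + j))%N.
Proof.
rewrite expnD; have /leq_trans : (u * 2 ^ j + v < u.+1 * 2 ^ j)%N.
  by rewrite mulSn addnC ltn_add2r.
by apply; rewrite leq_mul2r ltn_ord orbT.
Qed.

(** Binary expansions are concatenated in each coordinate: the cell of [catw u v] is the copy of the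
    cell of [v] inside the cell of [u]. *)
Definition catw i j (u : 'rV['I_(2 ^ i)]_m) (v : 'rV['I_(2 ^ j)]_m) :
  'rV['I_(2 ^ (i + j))]_m := \row_l Ordinal (catw_lt (u ord0 l) (v ord0 l)).

Lemma catw_bij i j :
  bijective (fun p : 'rV['I_(2 ^ i)]_m * 'rV['I_(2 ^ j)]_m => catw p.1 p.2).
Proof.
apply: inj_card_bij => [[u v] [u' v']/= uv|]; last first.
  by rewrite card_prod !card_mx !card_ord !mul1n expnD expnMn.
have h l : (u ord0 l = u' ord0 l) * (v ord0 l = v' ord0 l).
  have /(congr1 val)/= := congr1 (fun w : 'rV_m => w ord0 l) uv.
  rewrite !mxE/= => e.
  split; apply: val_inj => /=.
    have := congr1 (divn^~ (2 ^ j)%N) e.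
    by rewrite !divnMDl ?expn_gt0// !divn_small ?addn0.
  have := congr1 (modn^~ (2 ^ j)%N) e.
  by rewrite !modnMDl !modn_small.
by congr pair; apply/rowP => l; rewrite h.
Qed.

Lemma corner_catw i j (u : 'rV['I_(2 ^ i)]_m) (v : 'rV['I_(2 ^ j)]_m) :
  corner (catw u v) = corner u + (2 ^+ i)^-1 *: corner v.
Proof.
apply/rowP => l; rewrite !mxE/= natrD natrM natrX exprD.
field; by rewrite !expf_neq0.
Qed.

Lemma scale_corner i (u : 'rV['I_(2 ^ i)]_m) :
  2 ^+ i *: corner u = map_mx intr (\row_l (u ord0 l)%:Z).
Proof. by apply/rowP => l; rewrite !mxE mulrC divfK// expf_neq0. Qed.

(** Multiplication by 2^i sends the corner of [catw u v] to the corner of [v] plus a period, so the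
    last j terms agree exactly and the whole error comes from the first i terms. *)
Lemma birkhoff_cat phi K i j (u : 'rV['I_(2 ^ i)]_m) (v : 'rV['I_(2 ^ j)]_m) :
  tame phi K ->
  `|birkhoff_sum phi (i + j) (corner (catw u v)) -
    (birkhoff_sum phi i (corner u) + birkhoff_sum phi j (corner v))| <= K.
Proof.
move=> [per dis]; rewrite birkhoff_sumD corner_catw scalerDr scale_corner.
rewrite scalerA mulfV ?expf_neq0// scale1r (addrC (map_mx _ _)).
rewrite (birkhoff_periodic _ per) opprD addrACA subrr addr0; apply: dis.
rewrite addrAC subrr add0r; apply/rV_norm_leP => [|l].
  by rewrite divr_ge0// exprn_ge0.
rewrite mxE normrM ger0_norm ?invr_ge0 ?exprn_ge0// mulrC ler_wpM2r ?invr_ge0//.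
have /andP[h1 h2] := corner_itv v l; rewrite ger0_norm//; lra.
Qed.

Lemma partition_sum_gt0 phi j : 0 < partition_sum phi j.
Proof.
have lt0 : (0 < 2 ^ j)%N by rewrite expn_gt0.
rewrite /partition_sum (bigD1 (const_mx (Ordinal lt0)))//=.
by rewrite ltr_pwDl ?expR_gt0// sumr_ge0// => k _; exact: expR_ge0.
Qed.

Lemma partition_sum_cat phi K i j : tame phi K ->
  expR (- K) * (partition_sum phi i * partition_sum phi j) <= partition_sum phi (i + j) <=
  expR K * (partition_sum phi i * partition_sum phi j).
Proof.
move=> tphi.
have -> : partition_sum phi i * partition_sum phi j =
    \sum_u \sum_v expR (birkhoff_sum phi i (@corner i u)) *
                   expR (birkhoff_sum phi j (@corner j v)).
  by rewrite {1}/partition_sum big_distrl/=; apply: eq_bigr => u _; rewrite mulr_sumr.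
rewrite /partition_sum (reindex _ (onW_bij _ (catw_bij i j)))/=.
have -> F : \sum_(p : 'rV['I_(2 ^ i)]_m * 'rV['I_(2 ^ j)]_m) F p = \sum_u \sum_v F (u, v) :> R.
  by rewrite pair_bigA; apply: eq_bigr => -[].
rewrite !mulr_sumr; apply/andP; split; apply: ler_sum => u _;
  rewrite !mulr_sumr; apply: ler_sum => v _; rewrite -!expRD ler_expR;
  by have := birkhoff_cat u v tphi; rewrite ler_norml => /andP[]; lra.
Qed.

End birkhoff_theory.

(** Estimating [a] at a product of two indices in both ways shows that every lower average (a_j - K)
    / j is at most every upper average (a_i + K) / i. The supremum of the lower averages separates
    the two families. *)
Lemma quasi_additive_linear (R : realType) (a : nat -> R) (K : R) :
  (forall i j, `|a (i + j)%N - (a i + a j)| <= K) ->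
  exists P, forall j, `|a j - j%:R * P| <= K.
Proof.
move=> aK.
have mulK n j : `|a (n.+1 * j)%N - n.+1%:R * a j| <= n%:R * K.
  elim: n => [|n IH]; first by rewrite mul1n mul1r subrr normr0 mul0r.
  have := aK j (n.+1 * j)%N; rewrite mulSn -(natr1 n.+1) -(natr1 n); move: IH.
  by rewrite -(natr1 n) !ler_norml => /andP[? ?] /andP[? ?]; apply/andP; split; lra.
have K0 : 0 <= K by exact: le_trans (normr_ge0 _) (aK 0%N 0%N).
have cmp i j : (a j.+1 - K) / j.+1%:R <= (a i.+1 + K) / i.+1%:R.
  rewrite ler_pdivrMr ?ltr0n// mulrAC ler_pdivlMr ?ltr0n//.
  have := mulK i j.+1; have := mulK j i.+1; rewrite mulnC -(natr1 i) -(natr1 j).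
  by rewrite !ler_norml => /andP[? ?] /andP[? ?]; lra.
pose A := [set (a j.+1 - K) / j.+1%:R | j in [set: nat]].
have A0 : A !=set0 by exists ((a 1%N - K) / 1); exists 0%N.
have ubA i : ubound A ((a i.+1 + K) / i.+1%:R) by move=> _ [j _ <-].
exists (sup A) => -[|j].
  by rewrite mul0r subr0; have := aK 0%N 0%N; rewrite opprD addrA subrr sub0r normrN.
have h1 : (a j.+1 - K) / j.+1%:R <= sup A.
  by apply: ub_le_sup; [exists ((a 1%N + K) / 1); exact: ubA|exists j].
have h2 : sup A <= (a j.+1 + K) / j.+1%:R by apply: ge_sup => //; exact: ubA.
move: h1 h2; rewrite ler_pdivrMr ?ltr0n// ler_pdivlMr ?ltr0n// => h1 h2.
by rewrite ler_norml; apply/andP; split; lra.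
Qed.

Section pressure.
Variables (R : realType) (m : nat).
Implicit Type phi : 'rV[R]_m -> R.

Lemma pressure phi K : tame phi K ->
  exists P, forall j, `|ln (partition_sum phi j) - j%:R * P| <= K.
Proof.
move=> tphi; apply: quasi_additive_linear => i j.
have p0 k := partition_sum_gt0 phi k.
have /andP[h1 h2] := partition_sum_cat i j tphi.
have pp : 0 < partition_sum phi i * partition_sum phi j by rewrite mulr_gt0.
rewrite -ler_ln ?posrE ?mulr_gt0 ?expR_gt0// in h1.
rewrite -ler_ln ?posrE ?mulr_gt0 ?expR_gt0// in h2.
move: h1 h2; rewrite !lnM ?posrE ?expR_gt0// !expRK => h1 h2.
by rewrite ler_norml; apply/andP; split; lra.
Qed.

End pressure.

Lemma lsubmx_corner (R : realType) d d' j (k : 'rV['I_(2 ^ j)]_(d + d')) :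
  lsubmx (corner R k) = corner R (lsubmx k).
Proof. by apply/rowP => i; rewrite !mxE. Qed.

Lemma rsubmx_corner (R : realType) d d' j (k : 'rV['I_(2 ^ j)]_(d + d')) :
  rsubmx (corner R k) = corner R (rsubmx k).
Proof. by apply/rowP => i; rewrite !mxE. Qed.

Lemma birkhoff_prod (R : realType) (d d' : nat) (phi : 'rV[R]_d -> R)
    (phi' : 'rV[R]_d' -> R) j (x : 'rV[R]_(d + d')) :
  birkhoff_sum (fun x => phi (lsubmx x) + phi' (rsubmx x)) j x =
  birkhoff_sum phi j (lsubmx x) + birkhoff_sum phi' j (rsubmx x).
Proof.
rewrite /birkhoff_sum big_split/=; congr (_ + _).
  by apply: eq_bigr => k _; congr phi; apply/rowP => i; rewrite !mxE.
by apply: eq_bigr => k _; congr phi'; apply/rowP => i; rewrite !mxE.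
Qed.

Lemma tame_prod (R : realType) (d d' : nat) (phi : 'rV[R]_d -> R)
    (phi' : 'rV[R]_d' -> R) K K' : tame phi K -> tame phi' K' ->
  tame (fun x : 'rV[R]_(d + d') => phi (lsubmx x) + phi' (rsubmx x)) (K + K').
Proof.
move=> [per dis] [per' dis']; split => [z x|j x y xy].
  rewrite !raddfD/=; congr (_ + _).
    by rewrite -map_lsubmx per.
  by rewrite -map_rsubmx per'.
rewrite !birkhoff_prod opprD addrACA (le_trans (ler_normD _ _))// lerD//.
  by apply: dis; rewrite -raddfB; apply: le_trans xy; exact: norm_lsubmx.
by apply: dis'; rewrite -raddfB; apply: le_trans xy; exact: norm_rsubmx.
Qed.

Lemma partition_sum_prod (R : realType) (d d' : nat) (phi : 'rV[R]_d -> R)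
    (phi' : 'rV[R]_d' -> R) j :
  partition_sum (fun x : 'rV[R]_(d + d') => phi (lsubmx x) + phi' (rsubmx x)) j =
  partition_sum phi j * partition_sum phi' j.
Proof.
pose f (p : 'rV['I_(2 ^ j)]_d * 'rV['I_(2 ^ j)]_d') : 'rV['I_(2 ^ j)]_(d + d') :=
  row_mx p.1 p.2.
have bf : bijective f.
  exists (fun k => (lsubmx k, rsubmx k)) => [[u v]|k]; rewrite /f/=.
    by rewrite row_mxKl row_mxKr.
  exact: hsubmxK.
rewrite /partition_sum (reindex _ (onW_bij _ bf))/= big_distrlr/= pair_bigA/=.
apply: eq_bigr => -[u v] _; rewrite -expRD; congr expR.
have cl : lsubmx (@corner R _ j (f (u, v))) = corner R u.
  by rewrite lsubmx_corner /f row_mxKl.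
have cr : rsubmx (@corner R _ j (f (u, v))) = corner R v.
  by rewrite rsubmx_corner /f row_mxKr.
by rewrite birkhoff_prod cl cr.
Qed.

(** * Test functions and dyadic cells *)

Section measurability_rV.
Variable R : realType.

Lemma hoelder_is_continuous m (phi : 'rV[R]_m -> R) :
  hoelder_continuous phi -> continuous phi.
Proof.
move=> [al [C [al0 _ hC]]] x.
have C0 y : `|phi x - phi y| <= (`|C| + 1) * `|x - y| `^ al.
  rewrite (le_trans (hC _ _))// ler_wpM2r ?powR_ge0//.
  by rewrite (le_trans (ler_norm _))// lerDl.
have C1 : 0 < `|C| + 1 by rewrite ltr_wpDl.
move=> A /nbhs_ballP[e /= e0 eA].
pose d := (e / 2 / (`|C| + 1)) `^ al^-1.
have d0 : 0 < d by rewrite powR_gt0// !divr_gt0.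
apply/nbhs_ballP; exists d => //= y /(rV_ballP _ _ d0) xy; apply: eA.
have {}xy : `|x - y| <= d.
  by apply/rV_norm_leP => [|i]; [exact: ltW|have := xy i; rewrite !mxE => /ltW].
apply: le_lt_trans (C0 y) _; apply: (@le_lt_trans _ _ (e / 2)); last by lra.
rewrite mulrC -ler_pdivlMr//.
have -> : e / 2 / (`|C| + 1) = d `^ al.
  by rewrite /d -powRrM mulVf ?gt_eqF// powRr1// !divr_ge0// ltW.
by apply: ge0_ler_powR; rewrite ?nnegrE//; exact: ltW.
Qed.

Lemma lipschitz_continuous m (f : 'rV[R]_m -> R) (L : R) :
  (forall x y, `|f x - f y| <= L * `|x - y|) -> continuous f.
Proof.
move=> fL; apply: hoelder_is_continuous; exists 1, L; split => // x y.
by rewrite powRr1.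
Qed.

Lemma birkhoff_continuous m (phi : 'rV[R]_m -> R) n :
  continuous phi -> continuous (birkhoff_sum phi n).
Proof.
move=> cphi; elim: n => [|n IH] x.
  rewrite (_ : birkhoff_sum phi 0 = cst 0); first exact: cst_continuous.
  by apply/funext => y; rewrite /birkhoff_sum big_ord0.
rewrite (_ : birkhoff_sum phi n.+1 =
  (fun x => birkhoff_sum phi n x + phi (2 ^+ n *: x))).
  apply: continuousD; first exact: IH.
  apply: continuous_comp; last exact: cphi.
  by apply: continuousZl_tmp; exact: cvg_id.
by apply/funext => y; rewrite birkhoff_sumS.
Unshelve. all: by end_near. Qed.

(* At least 1 on the ball of radius [1 / c] and zero outside the ball of radius [2 / c]. *)
Definition bump m (z : 'rV[R]_m) (c : R) (x : 'rV[R]_m) : R :=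
  Num.max 0 (2 - c * `|x - z|).

Lemma bump_continuous m (z : 'rV[R]_m) c : continuous (bump z c).
Proof.
apply: (@lipschitz_continuous _ _ `|c|) => x y; rewrite /bump.
have h : `|(2 - c * `|x - z|) - (2 - c * `|y - z|)| <= `|c| * `|x - y|.
  rewrite (_ : _ - _ = c * (`|y - z| - `|x - z|)); last by ring.
  rewrite normrM ler_wpM2l// (le_trans (ler_dist_dist _ _))//.
  by rewrite opprB addrA subrK distrC.
apply: le_trans h; set a := 2 - _; set b := 2 - _.
by rewrite /Num.max; case: ltP => ?; case: ltP => ?; rewrite ?subrr ?normr0//
  ?sub0r ?subr0 ?normrN; rewrite !ler_normr ?ler_norml; lra.
Qed.

Lemma bump_ge0 m (z : 'rV[R]_m) c x : 0 <= bump z c x.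
Proof. by rewrite le_max lexx. Qed.

Lemma bump_le2 m (z : 'rV[R]_m) c x : 0 <= c -> bump z c x <= 2.
Proof.
by move=> c0; rewrite ge_max ler0n/= lerBlDr lerDl mulr_ge0.
Qed.

Lemma bump_ge1 m (z : 'rV[R]_m) c x : c * `|x - z| <= 1 -> 1 <= bump z c x.
Proof. by move=> h; rewrite le_max; apply/orP; right; lra. Qed.

Lemma bump_eq0 m (z : 'rV[R]_m) c x : 2 <= c * `|x - z| -> bump z c x = 0.
Proof. by move=> h; apply/max_idPl; lra. Qed.

Lemma compact_rV_closed_ball m (z : 'rV[R]_m) r : compact [set x | `|x - z| <= r].
Proof.
apply: bounded_closed_compact.
  exists (`|z| + r); split => [|M zM x /= xr]; first exact: num_real.
  rewrite -[x](subrK z) (le_trans (ler_normD _ _))//.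
  by rewrite (le_trans _ (ltW zM))// addrC lerD2l.
rewrite (_ : mkset _ = (fun x => `|x - z|) @^-1` [set y | y <= r])//.
apply: closed_comp => [x _|]; last exact: closed_le.
apply: (@lipschitz_continuous _ (fun x => `|x - z|) 1) => {}x y.
by rewrite mul1r (le_trans (ler_dist_dist _ _))// opprB addrA subrK.
Qed.

Lemma measurable_norm_ball m (z : 'rV[R]_m) r :
  (measurable : set (set (borel_rV R m))) [set x | `|x - z| <= r].
Proof.
have : continuous (fun x : 'rV[R]_m => `|x - z|).
  apply: (@lipschitz_continuous _ _ 1) => x y.
  by rewrite mul1r (le_trans (ler_dist_dist _ _))// opprB addrA subrK.
move/continuous_measurable_real => /(_ measurableT `]-oo, r]%classic).
rewrite setTI => /(_ (measurable_itv _)).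
by congr measurable; apply/seteqP; split => x /=; rewrite in_itv.
Qed.

End measurability_rV.

Section scaled_sets.
Variables (R : realType) (m : nat).
Implicit Types (B : set 'rV[R]_m) (k : 'rV[int]_m).

(** The shape [B] is a parameter because packing wants half-open cells and covering the whole cube
    wants closed ones. Each estimate below uses the same shape in its numerator and in its
    normalization, so the masses of the two kinds are never compared and cell boundaries cause no
    trouble. *)
Definition scaled B j k : set 'rV[R]_m := [set x | B (2 ^+ j *: x - map_mx intr k)].

Definition node j k : 'rV[R]_m := (2 ^+ j)^-1 *: map_mx intr k.

Definition ho_cube : set 'rV[R]_m := [set x | forall i, 0 <= x ord0 i < 1].

Lemma ho_cube_sub : ho_cube `<=` @cube R m.
Proof. by move=> x h i; have /andP[-> /ltW] := h i. Qed.

Lemma measurable_ho_cube : (measurable : set (set (borel_rV R m))) ho_cube.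
Proof.
have -> : ho_cube = \bigcap_(i in [set: 'I_m])
    ((fun x : 'rV[R]_m => x ord0 i) @^-1` `[0, 1[%classic).
  apply/seteqP; split => [x xQ i _|x xQ i]; first by rewrite /= in_itv/=; exact: xQ.
  by have := xQ i I; rewrite /= in_itv.
apply: fin_bigcap_measurable => // i _.
by rewrite -[X in measurable X]setTI; exact: measurable_coord.
Qed.

Lemma measurable_scaled B j k :
  (measurable : set (set (borel_rV R m))) B ->
  (measurable : set (set (borel_rV R m))) (scaled B j k).
Proof.
move=> mB; rewrite -[X in measurable X]setTI.
apply: (@continuous_measurable_rV R m m (fun x => 2 ^+ j *: x - map_mx intr k)) => // x.
apply: continuousB; last exact: cst_continuous.
by apply: continuousZl_tmp; exact: cvg_id.
Qed.

Lemma scaled_near B j k x : B `<=` @cube R m -> scaled B j k x ->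
  `|x - node j k| <= 1 / 2 ^+ j.
Proof.
move=> BQ /BQ xQ; apply/rV_norm_leP => [|i]; first by rewrite divr_ge0// exprn_ge0.
have := xQ i; rewrite !mxE => /andP[h0 h1].
rewrite ler_pdivlMr ?exprn_gt0// -[X in _ * X]ger0_norm ?exprn_ge0// -normrM.
rewrite mulrBl mulrAC mulVf ?expf_neq0// mul1r mulrC ger0_norm//.
Qed.

Lemma ho_scaled_disjoint j k k' x :
  scaled ho_cube j k x -> scaled ho_cube j k' x -> k = k'.
Proof.
move=> h h'; apply/rowP => i; have := h i; have := h' i; rewrite !mxE.
move=> /andP[a b] /andP[c d].
have fl (z : int) : 0 <= 2 ^+ j * x ord0 i - z%:~R -> 2 ^+ j * x ord0 i - z%:~R < 1 ->
    z = Num.floor (2 ^+ j * x ord0 i).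
  move=> u v; apply/esym/eqP; rewrite floor_eq; rewrite intrD1; apply/andP; split; lra.
by rewrite (fl _ a b) (fl _ c d).
Qed.

Definition wordZ j (k : 'rV['I_(2 ^ j)]_m) : 'rV[int]_m := \row_i (k ord0 i)%:Z.

Lemma wordZ_inj j : injective (@wordZ j).
Proof.
move=> k k' /rowP kk; apply/rowP => i; apply: val_inj.
by have := kk i; rewrite !mxE => -[].
Qed.

Lemma node_wordZ j (k : 'rV['I_(2 ^ j)]_m) : node j (wordZ k) = corner R k.
Proof. by apply/rowP => i; rewrite !mxE mulrC. Qed.

Lemma dyadic_cubeE j (k : 'rV['I_(2 ^ j)]_m) :
  @dyadic_cube R m j k = scaled ho_cube j (wordZ k).
Proof.
apply/seteqP; split => x h i; have := h i; rewrite !mxE;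
  have p2 : 0 < 2 ^+ j :> R by rewrite exprn_gt0//.
- rewrite ler_pdivrMr// ltr_pdivlMr// -(natr1 (k ord0 i)) => /andP[? ?].
  by rewrite pmulrn; apply/andP; split; lra.
- rewrite ler_pdivrMr// ltr_pdivlMr// -(natr1 (k ord0 i)) pmulrn => /andP[? ?].
  by apply/andP; split; lra.
Qed.

Lemma dyadic_cube_sub j (k : 'rV['I_(2 ^ j)]_m) :
  scaled ho_cube j (wordZ k) `<=` @cube R m.
Proof.
move=> x; rewrite -dyadic_cubeE => h i; have /andP[h1 h2] := h i.
rewrite (le_trans _ h1) ?divr_ge0// (le_trans (ltW h2))// ler_pdivrMr ?exprn_gt0//.
by rewrite mul1r -natrX ler_nat.
Qed.

Lemma cube_cover j x : cube x -> exists k : 'rV['I_(2 ^ j)]_m,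
  scaled (@cube R m) j (wordZ k) x.
Proof.
move=> xQ.
have p2 : 0 < 2 ^+ j :> R by rewrite exprn_gt0.
have H i : {a : 'I_(2 ^ j) | 0 <= 2 ^+ j * x ord0 i - a%:R <= 1}.
  apply: cid; have /andP[x0 x1] := xQ i.
  have h0 : 0 <= 2 ^+ j * x ord0 i by rewrite mulr_ge0// ltW.
  (* A coordinate equal to 1 would truncate to 2^j, one past the last index; the last closed cell
     contains it. *)
  have [xe|xn1] := eqVneq (x ord0 i) 1.
    have lt : ((2 ^ j).-1 < 2 ^ j)%N by rewrite ltn_predL expn_gt0.
    exists (Ordinal lt) => /=; rewrite xe mulr1.
    rewrite -[X in X - _]natrX -natrB ?leq_pred//.
    by rewrite ler0n/= -subn1 subKn ?expn_gt0.
  have lt : (Num.truncn (2 ^+ j * x ord0 i) < 2 ^ j)%N.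
    rewrite -(ltr_nat R) natrX.
    have /andP[h _] := truncn_itv h0; apply: le_lt_trans h _.
    by rewrite gtr_pMr// lt_neqAle xn1.
  exists (Ordinal lt) => /=.
  by have := truncn_itv h0; rewrite -natr1 => /andP[? ?]; apply/andP; split; lra.
exists (\row_i sval (H i)) => i; rewrite !mxE.
exact: svalP (H i).
Qed.

End scaled_sets.

(** * Integral estimates *)

Section integral_tools.
Local Open Scope ereal_scope.
Context d (T : measurableType d) (R : realType).
Variable mu : {measure set T -> \bar R}.
Implicit Types (f g : T -> R) (A D : set T).

Let mEFin D f : measurable_fun setT f -> measurable_fun D (fun x => (f x)%:E).
Proof. by move=> mf; apply/measurable_EFinP; exact: measurable_funS mf. Qed.

Lemma ge0_integral_cover (I : finType) (F : I -> set T) A f :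
  measurable A -> (forall i, measurable (F i)) -> measurable_fun setT f ->
  (forall x, (0 <= f x)%R) -> (forall x, A x -> exists i, F i x) ->
  \int[mu]_(x in A) (f x)%:E <= \sum_i \int[mu]_(x in F i) (f x)%:E.
Proof.
move=> mA mF mf f0 AF.
apply: (@le_trans _ _ (\int[mu]_(x in \big[setU/set0]_i F i) (f x)%:E)).
  apply: ge0_subset_integral => //.
  - exact: bigsetU_measurable.
  - exact: mEFin.
  - by move=> x _; rewrite lee_fin.
  - by rewrite -bigcup_seq => x /AF[i Fix]; exists i => //=; exact: mem_index_enum.
elim: (index_enum I) => [|i s IH]; first by rewrite !big_nil integral_set0.
rewrite !big_cons; set U := \big[setU/set0]_(j <- s) F j in IH *.
have mU : measurable U by exact: bigsetU_measurable.
rewrite -(setDUK (@subsetUl _ (F i) U)) ge0_integral_setU//.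
- rewrite leeD2l// (le_trans _ IH)//; apply: ge0_subset_integral => //.
  + by apply: measurableD => //; exact: measurableU.
  + exact: mEFin.
  + by move=> x _; rewrite lee_fin.
  + by move=> x [[]].
- by apply: measurableD => //; exact: measurableU.
- exact: mEFin.
- by move=> x _; rewrite lee_fin.
- by apply/disj_setPS => x [Fx []].
Qed.

Lemma ge0_integral_pack (I : finType) (F : I -> set T) A f :
  measurable A -> (forall i, measurable (F i)) -> measurable_fun setT f ->
  (forall x, (0 <= f x)%R) -> (forall i, F i `<=` A) ->
  (forall i j x, F i x -> F j x -> i = j) ->
  \sum_i \int[mu]_(x in F i) (f x)%:E <= \int[mu]_(x in A) (f x)%:E.
Proof.
move=> mA mF mf f0 FA dF.
rewrite -ge0_integral_bigsetU//; last 4 first.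
- exact: index_enum_uniq.
- by move=> i j _ _ [x [Fi Fj]]; exact: dF Fi Fj.
- exact: mEFin.
- by move=> x _; rewrite lee_fin.
apply: ge0_subset_integral => //.
- exact: bigsetU_measurable.
- exact: mEFin.
- by move=> x _; rewrite lee_fin.
- by rewrite -bigcup_seq => x [i _]; exact: FA.
Qed.

Lemma ge0_integral_invariant (t : T -> T) (mt : measurable_fun setT t) D f :
  (forall A, measurable A -> mu (t @^-1` A) = mu A) ->
  measurable D -> measurable_fun setT f -> (forall x, (0 <= f x)%R) ->
  \int[mu]_(x in t @^-1` D) (f (t x))%:E = \int[mu]_(x in D) (f x)%:E.
Proof.
move=> inv mD mf f0; transitivity (\int[pushforward mu t]_(x in D) (f x)%:E).
  rewrite ge0_integral_pushforward//.
    by apply/measurable_EFinP; exact: measurable_funS mf.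
  by move=> x _; rewrite lee_fin.
by apply: eq_measure_integral => A mA _; exact: inv.
Qed.

Lemma integral_unit_bounds D f (a b : R) : measurable D -> mu D = 1 ->
  measurable_fun setT f -> (0 <= a)%R -> (forall x, (a <= f x <= b)%R) ->
  a%:E <= \int[mu]_(x in D) (f x)%:E <= b%:E.
Proof.
move=> mD muD mf a0 ab.
have cstE (r : R) : \int[mu]_(x in D) (cst r%:E) x = r%:E.
  by rewrite integral_cst// muD mule1.
rewrite -{1}(cstE a) -(cstE b); apply/andP; split; apply: ge0_le_integral => //.
- exact: mEFin.
- by move=> x _; rewrite lee_fin; have /andP[] := ab x.
- by move=> x _; rewrite lee_fin; have /andP[ax _] := ab x; rewrite (le_trans a0).
- exact: mEFin.
- by move=> x _; rewrite lee_fin; have /andP[] := ab x.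
Qed.

Lemma integral_scale_bounds D f g (a b : R) : measurable D ->
  measurable_fun setT f -> measurable_fun setT g -> (forall x, (0 <= g x)%R) ->
  (0 <= a)%R -> (0 <= b)%R ->
  (forall x, D x -> (a * g x <= f x <= b * g x)%R) ->
  a%:E * \int[mu]_(x in D) (g x)%:E <= \int[mu]_(x in D) (f x)%:E <=
  b%:E * \int[mu]_(x in D) (g x)%:E.
Proof.
move=> mD mf mg g0 a0 b0 ab.
rewrite -!ge0_integralZl_EFin//; try exact: mEFin; try by move=> x _; rewrite lee_fin.
apply/andP; split; apply: ge0_le_integral => //.
- by move=> x _; rewrite -EFinM lee_fin mulr_ge0.
- by apply: measurable_funeM; exact: mEFin.
- exact: mEFin.
- by move=> x /ab; rewrite -EFinM lee_fin => /andP[].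
- by move=> x /ab/andP[h _]; rewrite lee_fin (le_trans _ h)// mulr_ge0.
- exact: mEFin.
- by apply: measurable_funeM; exact: mEFin.
- by move=> x /ab; rewrite -EFinM lee_fin => /andP[].
Qed.

Lemma integral_test_upper D f g (c : R) : measurable D ->
  measurable_fun setT f -> measurable_fun setT g -> (forall x, (0 <= g x)%R) ->
  (0 <= c)%R -> (forall x, D x -> (0 <= f x <= c)%R) -> (forall x, ~ D x -> f x = 0%R) ->
  \int[mu]_x (f x * g x)%:E <= c%:E * \int[mu]_(x in D) (g x)%:E.
Proof.
move=> mD mf mg g0 c0 fD f0.
have -> : \int[mu]_x (f x * g x)%:E = \int[mu]_(x in D) (f x * g x)%:E.
  rewrite [RHS]integral_mkcond; apply: eq_integral => x _; rewrite patchE.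
  by case: ifPn => // /negP xD; rewrite f0 ?mul0r// => Dx; apply: xD; rewrite inE.
have mfg : measurable_fun setT (fun x => f x * g x)%R by exact: measurable_funM.
suff /andP[_] : 0%:E * \int[mu]_(x in D) (g x)%:E <=
    \int[mu]_(x in D) (f x * g x)%:E <= c%:E * \int[mu]_(x in D) (g x)%:E by [].
apply: integral_scale_bounds => // x /fD/andP[fx0 fxc].
by rewrite mul0r mulr_ge0//= ler_wpM2r.
Qed.

Lemma integral_test_lower D f g : measurable D ->
  measurable_fun setT f -> measurable_fun setT g -> (forall x, (0 <= g x)%R) ->
  (forall x, (0 <= f x)%R) -> (forall x, D x -> (1 <= f x)%R) ->
  \int[mu]_(x in D) (g x)%:E <= \int[mu]_x (f x * g x)%:E.
Proof.
move=> mD mf mg g0 f0 fD.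
have mfg : measurable_fun setT (fun x => f x * g x)%R by exact: measurable_funM.
apply: (@le_trans _ _ (\int[mu]_(x in D) (f x * g x)%:E)).
  apply: ge0_le_integral => //; try exact: mEFin.
    by move=> x _; rewrite lee_fin.
  by move=> x /fD f1; rewrite lee_fin ler_peMl.
apply: ge0_subset_integral => //; first exact: mEFin.
by move=> x _; rewrite lee_fin mulr_ge0.
Qed.

Lemma measure_le_test D f : measurable D -> measurable_fun setT f ->
  (forall x, (0 <= f x)%R) -> (forall x, D x -> (1 <= f x)%R) ->
  mu D <= \int[mu]_x (f x)%:E.
Proof.
move=> mD mf f0 fD.
rewrite -[mu D]mul1e -integral_cst//.
under [leRHS]eq_integral do rewrite -[f _]mulr1.
exact: (@integral_test_lower D f (cst 1%R)).
Qed.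

Lemma test_le_measure D f (c : R) : measurable D -> measurable_fun setT f ->
  (0 <= c)%R -> (forall x, D x -> (0 <= f x <= c)%R) -> (forall x, ~ D x -> f x = 0%R) ->
  \int[mu]_x (f x)%:E <= c%:E * mu D.
Proof.
move=> mD mf c0 fD f0.
rewrite -[mu D]mul1e -(integral_cst mu mD).
under [leLHS]eq_integral do rewrite -[f _]mulr1.
exact: (@integral_test_upper D f (cst 1%R)).
Qed.

End integral_tools.

(** * The Gibbs property of weak limits *)

Section gibbs_estimates.
Variables (R : realType) (m : nat) (phi : 'rV[R]_m -> R) (K M : R).
Hypotheses (tphi : tame phi K) (cphi : continuous phi).
Hypothesis phiM : forall x, `|phi x| <= M.

Local Notation leb := (lebesgue_rV R m).
Local Notation mset A := ((measurable : set (set (borel_rV R m))) A).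

Definition exp_birkhoff n (x : borel_rV R m) : R := expR (birkhoff_sum phi n x).
Definition exp_mass n (A : set (borel_rV R m)) : \bar R :=
  (\int[leb]_(x in A) (exp_birkhoff n x)%:E)%E.

Lemma exp_birkhoff_ge0 n x : 0 <= exp_birkhoff n x.
Proof. exact: expR_ge0. Qed.

Lemma measurable_exp_birkhoff n : measurable_fun setT (exp_birkhoff n).
Proof.
apply: (measurableT_comp (@measurable_expR R)).
exact (@continuous_measurable_real R m _ (@birkhoff_continuous R m phi n cphi)).
Qed.

Definition scale_rV j (x : borel_rV R m) : borel_rV R m := 2 ^+ j *: (x : 'rV[R]_m).

Lemma measurable_scale_rV j : measurable_fun setT (scale_rV j).
Proof.
apply: (@continuous_measurable_rV R m m (fun x => 2 ^+ j *: x)) => x.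
by apply: continuousZl_tmp; exact: cvg_id.
Qed.

Definition cell_mass j n (B : set 'rV[R]_m) : \bar R :=
  (\int[leb]_(x in scaled B j 0) (exp_birkhoff n (scale_rV j x))%:E)%E.

Lemma cell_mass_ge0 j n B : (0 <= cell_mass j n B)%E.
Proof. by apply: integral_ge0 => x _; rewrite lee_fin exp_birkhoff_ge0. Qed.

(* Every cell of level j is a translate of the cell of index 0 by a vector that
   [x |-> 2 ^ j x] sends to a period. *)
Lemma integral_scaled_shift j n B (k : 'rV[int]_m) : mset B ->
  (\int[leb]_(x in scaled B j k) (exp_birkhoff n (scale_rV j x))%:E)%E =
  cell_mass j n B.
Proof.
move=> mB; have [per _] := tphi.
pose t (x : borel_rV R m) : borel_rV R m := (x : 'rV[R]_m) + node R j k.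
have jk x : scale_rV j (t x) = (scale_rV j x : 'rV[R]_m) + map_mx intr k.
  by rewrite /scale_rV /t scalerDr /node scalerA mulfV ?expf_neq0// scale1r.
rewrite -(@ge0_integral_invariant _ _ _ leb t (measurable_shift _) (scaled B j k)
  (fun x => exp_birkhoff n (scale_rV j x))).
- rewrite /cell_mass.
  have -> : t @^-1` scaled B j k = scaled B j 0.
    have e x : scale_rV j (t x) - map_mx intr k = scale_rV j x - map_mx intr 0.
      rewrite jk addrK (_ : map_mx intr 0 = 0) ?subr0//.
      by apply/rowP => i; rewrite !mxE.
    by apply/seteqP; split => x; [rewrite -[_ x]/(B (scale_rV j (t x) - map_mx intr k)) e|
      rewrite -[(_ @^-1` _) x]/(B (scale_rV j (t x) - map_mx intr k)) e].
  by apply: eq_integral => x _; rewrite jk /exp_birkhoff (birkhoff_periodic n per).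
- by move=> A mA; exact: lebesgue_rV_shift.
- exact: measurable_scaled.
- exact: measurableT_comp (measurable_exp_birkhoff n) (measurable_scale_rV j).
- by move=> x; exact: exp_birkhoff_ge0.
Qed.

(** Split [S_n phi] at time j. The first part varies by at most [K] on the cell, and the integral of
    the exponential of the second does not depend on [k]. *)
Lemma exp_mass_scaled j n B (k : 'rV[int]_m) :
  (j <= n)%N -> mset B -> B `<=` @cube R m ->
  ((expR (birkhoff_sum phi j (node R j k) - K))%:E * cell_mass j (n - j) B
     <= exp_mass n (scaled B j k) <=
   (expR (birkhoff_sum phi j (node R j k) + K))%:E * cell_mass j (n - j) B)%E.
Proof.
move=> jn mB BQ; have [per dis] := tphi.
rewrite -(integral_scaled_shift j (n - j) k mB).
apply: integral_scale_bounds; rewrite ?expR_ge0//.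
- exact: measurable_scaled.
- exact: measurable_exp_birkhoff.
- exact: measurableT_comp (measurable_exp_birkhoff _) (measurable_scale_rV j).
- by move=> x; exact: exp_birkhoff_ge0.
move=> x xS.
have near : `|birkhoff_sum phi j x - birkhoff_sum phi j (node R j k)| <= K.
  apply: dis; apply: le_trans (scaled_near BQ xS) _.
  by rewrite ler_pM2r ?invr_gt0 ?exprn_gt0// ler1n.
have -> : exp_birkhoff n x =
    expR (birkhoff_sum phi j x) * exp_birkhoff (n - j) (scale_rV j x).
  by rewrite -expRD /scale_rV -birkhoff_sumD subnKC.
rewrite !ler_wpM2r ?exp_birkhoff_ge0// ?ler_expR;
  by move: near; rewrite ler_distl => /andP[].
Qed.

Definition total_mass n : R := \int[leb]_(t in @cube R m) expR (birkhoff_sum phi n t).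

(** The normalizing integral is made real by [fine], which would return 0 at infinity. Boundedness
    of [phi] and the unit volume of the cube exclude this. *)
Lemma total_massE n : exp_mass n (@cube R m) = (total_mass n)%:E /\ 0 < total_mass n.
Proof.
have /andP[h2 h1] : ((expR (- (n%:R * M)))%:E <= exp_mass n (@cube R m) <=
    (expR (n%:R * M))%:E)%E.
  apply: integral_unit_bounds; rewrite ?expR_ge0//.
  - exact: measurable_cube.
  - exact: lebesgue_rV_cube.
  - exact: measurable_exp_birkhoff.
  - by move=> x; rewrite !ler_expR -ler_norml; exact: birkhoff_bounded.
have fin : exp_mass n (@cube R m) \is a fin_num.
  rewrite fin_numE; apply/andP; split.
    by rewrite gt_eqF// (lt_le_trans _ h2)// ltNyr.
  by rewrite lt_eqF// (le_lt_trans h1)// ltry.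
have we : exp_mass n (@cube R m) = (total_mass n)%:E by rewrite -(fineK fin).
by split => //; rewrite -lte_fin -we; apply: lt_le_trans h2; rewrite lte_fin expR_gt0.
Qed.

Let Hscaled j (k : 'rV[int]_m) := scaled (@ho_cube R m) j k.
Let mHscaled j k : mset (Hscaled j k).
Proof. by apply: measurable_scaled; exact: measurable_ho_cube. Qed.

Lemma total_mass_lower j n : (j <= n)%N ->
  ((expR (- K) * partition_sum phi j)%:E * cell_mass j (n - j) (@ho_cube R m)
     <= (total_mass n)%:E)%E.
Proof.
move=> jn; have [<- _] := total_massE n.
apply: (@le_trans _ _ (\sum_(k : 'rV['I_(2 ^ j)]_m) exp_mass n (Hscaled j (wordZ k)))%E).
  rewrite /partition_sum mulr_sumr -sumEFin ge0_sume_distrl; last first.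
    by move=> k _; rewrite lee_fin mulr_ge0 ?expR_ge0.
  apply: lee_sum => k _.
  have /andP[h _] := exp_mass_scaled (wordZ k) jn (@measurable_ho_cube R m) (@ho_cube_sub R m).
  by apply: le_trans h; rewrite node_wordZ addrC expRD.
apply: (@ge0_integral_pack _ _ _ leb _ (fun k : 'rV['I_(2 ^ j)]_m => Hscaled j (wordZ k))).
- exact: measurable_cube.
- by move=> k; exact: mHscaled.
- exact: measurable_exp_birkhoff.
- by move=> x; exact: exp_birkhoff_ge0.
- by move=> k; exact: dyadic_cube_sub.
- by move=> k k' x h h'; apply: wordZ_inj; exact: ho_scaled_disjoint h h'.
Qed.

Lemma total_mass_upper j n : (j <= n)%N ->
  ((total_mass n)%:E <=
   (expR K * partition_sum phi j)%:E * cell_mass j (n - j) (@cube R m))%E.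
Proof.
move=> jn; have [<- _] := total_massE n.
have mQ := @measurable_cube R m.
apply: (@le_trans _ _ (\sum_(k : 'rV['I_(2 ^ j)]_m) exp_mass n (scaled (@cube R m) j (wordZ k)))%E).
  apply: ge0_integral_cover => //.
  - by move=> k; exact: measurable_scaled.
  - exact: measurable_exp_birkhoff.
  - by move=> x; exact: exp_birkhoff_ge0.
  - by move=> x; exact: cube_cover.
rewrite /partition_sum mulr_sumr -sumEFin ge0_sume_distrl; last first.
  by move=> k _; rewrite lee_fin mulr_ge0 ?expR_ge0.
apply: lee_sum => k _.
have /andP[_ h] := exp_mass_scaled (wordZ k) jn mQ (@subset_refl _ _).
by apply: le_trans h _; rewrite node_wordZ addrC expRD.
Qed.

(** In each coordinate the integer parts of 2^j x and 2^j z differ by at most 3, whence the seven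
    offsets [u - 3]. *)
Lemma ball_cover j (x z : 'rV[R]_m) : `|x - z| <= 2 / 2 ^+ j ->
  exists u : 'rV['I_7]_m, Hscaled j (\row_i (Num.floor (2 ^+ j * z ord0 i) +
    ((u ord0 i)%:Z - 3))) x.
Proof.
move=> xz; have p2 : 0 < 2 ^+ j :> R by rewrite exprn_gt0.
have H i : {a : 'I_7 | 0 <= 2 ^+ j * x ord0 i - (Num.floor (2 ^+ j * z ord0 i) + (a%:Z - 3))%:~R < 1}.
  apply: cid.
  have : `|(x - z) ord0 i| <= 2 / 2 ^+ j by apply: le_trans xz; exact: coord_le_norm.
  rewrite !mxE ler_pdivlMr// -[X in _ * X](gtr0_norm p2) -normrM mulrBl.
  rewrite ler_norml => /andP[h1 h2].
  set fz := Num.floor (2 ^+ j * z ord0 i); pose fx := Num.floor (2 ^+ j * x ord0 i).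
  have z1 : fz%:~R <= 2 ^+ j * z ord0 i :> R by exact: floor_le.
  have z2 : 2 ^+ j * z ord0 i < fz%:~R + 1 by rewrite -intrD1; exact: floorD1_gt.
  have x1 : fx%:~R <= 2 ^+ j * x ord0 i :> R by exact: floor_le.
  have x2 : 2 ^+ j * x ord0 i < fx%:~R + 1 by rewrite -intrD1; exact: floorD1_gt.
  have fxz1 : 0 <= fx - fz + 3.
    suff : -1 < fx - fz + 3 by lia.
    rewrite -(ltr_int R) !rmorphD !rmorphN/=; lra.
  have fxz2 : fx - fz + 3 < 7.
    by rewrite -(ltr_int R) !rmorphD rmorphN/=; lra.
  have [a aE] : exists a : nat, fx - fz + 3 = a%:Z.
    by case: (fx - fz + 3) fxz1 => // a _; exists a.
  have lt : (a < 7)%N by rewrite aE in fxz2.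
  exists (Ordinal lt); rewrite (_ : fz + _ = fx); last by rewrite /= -aE; lia.
  by apply/andP; split; lra.
exists (\row_i sval (H i)) => i.
by have := svalP (H i); rewrite !mxE.
Qed.

Lemma near_nodes j (z : 'rV[R]_m) (u : 'rV['I_7]_m) :
  `|node R j (\row_i (Num.floor (2 ^+ j * z ord0 i) + ((u ord0 i)%:Z - 3))) - z|
    <= 8 / 2 ^+ j.
Proof.
have p2 : 0 < 2 ^+ j :> R by rewrite exprn_gt0.
apply/rV_norm_leP => [|i]; first by rewrite divr_ge0 ?ltW.
rewrite !mxE ler_pdivlMr// -[X in _ * X](gtr0_norm p2) -normrM mulrBl.
rewrite mulrAC mulVf ?gt_eqF// mul1r (mulrC (z _ _)).
set fz := Num.floor (2 ^+ j * z ord0 i).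
have z1 : fz%:~R <= 2 ^+ j * z ord0 i :> R by exact: floor_le.
have z2 : 2 ^+ j * z ord0 i < fz%:~R + 1 by rewrite -intrD1; exact: floorD1_gt.
have u1 : 0 <= (u ord0 i)%:R :> R by [].
have u2 : (u ord0 i)%:R <= 6 :> R by rewrite ler_nat -ltnS.
rewrite !rmorphD rmorphN/= -[((u ord0 i)%:Z)%:~R]/((u ord0 i)%:R).
by rewrite ltW// ltr_norml; apply/andP; split; lra.
Qed.

(** The three [K] come from the distortion inside a cell, from replacing the node of a cell by [z],
    and from the lower bound of the total mass. *)
Lemma exp_mass_ball j n (z : 'rV[R]_m) : (j <= n)%N ->
  (exp_mass n [set x : 'rV[R]_m | (`|x - z| <= 2 / 2 ^+ j)%R] <=
   (#|{: 'rV['I_7]_m}|%:R * (expR (3 * K + birkhoff_sum phi j z) / partition_sum phi j *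
      total_mass n))%:E)%E.
Proof.
move=> jn; have [_ m0] := total_massE n; have [per dis] := tphi.
have T0 := partition_sum_gt0 phi j.
have cle : (cell_mass j (n - j) (@ho_cube R m) <=
    (expR K / partition_sum phi j * total_mass n)%:E)%E.
  have := total_mass_lower jn; rewrite -lee_pdivlMl ?mulr_gt0 ?expR_gt0//.
  by rewrite invfM -expRN opprK -EFinM.
pose k u : 'rV[int]_m := \row_i (Num.floor (2 ^+ j * z ord0 i) +
    (((u : 'rV['I_7]_m) ord0 i)%:Z - 3)).
apply: (@le_trans _ _ (\sum_u exp_mass n (Hscaled j (k u)))%E).
  apply: ge0_integral_cover => //.
  - exact: measurable_norm_ball.
  - exact: measurable_exp_birkhoff.
  - by move=> x; exact: exp_birkhoff_ge0.
  - by move=> x; exact: ball_cover.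
rewrite (_ : (_ * _)%:E = (\sum_(u : 'rV['I_7]_m)
    (expR (3 * K + birkhoff_sum phi j z) / partition_sum phi j * total_mass n)%:E)%E).
  apply: lee_sum => u _.
  have /andP[_ h] := exp_mass_scaled (k u) jn (@measurable_ho_cube R m) (@ho_cube_sub R m).
  apply: le_trans h _; apply: (@le_trans _ _ ((expR (2 * K + birkhoff_sum phi j z))%:E *
     (expR K / partition_sum phi j * total_mass n)%:E)%E).
    apply: lee_pmul => //; rewrite ?lee_fin ?expR_ge0 ?cell_mass_ge0//.
    rewrite ler_expR; have := dis j _ _ (near_nodes j z u).
    by rewrite ler_distl => /andP[]; rewrite -/(k u); lra.
  rewrite -EFinM lee_fin !mulrA ler_pM2r// ler_pM2r ?invr_gt0//.
  by rewrite -expRD ler_expR; lra.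
by rewrite sumEFin big_const iter_addr_0 mulr_natl.
Qed.

Lemma density_upper j n (z : 'rV[R]_m) : (j <= n)%N ->
  (\int[leb]_x (bump z (2 ^+ j) x * gibbs_density phi n x)%:E <=
   (2 * #|{: 'rV['I_7]_m}|%:R * (expR (3 * K + birkhoff_sum phi j z) / partition_sum phi j))%:E)%E.
Proof.
move=> jn; have [_ m0] := total_massE n.
have p2 : 0 < 2 ^+ j :> R by rewrite exprn_gt0.
have -> : (\int[leb]_x (bump z (2 ^+ j) x * gibbs_density phi n x)%:E)%E =
   (\int[leb]_x (((bump z (2 ^+ j) x) / total_mass n) * exp_birkhoff n x)%:E)%E.
  by apply: eq_integral => x _; rewrite /gibbs_density mulrA mulrAC.
apply: le_trans (integral_test_upper leb (measurable_norm_ball z (2 / 2 ^+ j))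
   (f := fun x : borel_rV R m => bump z (2 ^+ j) x / total_mass n)
   _ (measurable_exp_birkhoff n) (exp_birkhoff_ge0 n) (c := 2 / total_mass n) _ _ _) _.
- apply: measurable_funM => //.
  exact (@continuous_measurable_real R m _ (@bump_continuous R m z _)).
- by rewrite divr_ge0// ltW.
- move=> x _; rewrite divr_ge0 ?bump_ge0 ?(ltW m0)//= ler_pM2r ?invr_gt0//.
  by rewrite bump_le2// ltW.
- move=> x /negP; rewrite /= -ltNge => h; rewrite bump_eq0 ?mul0r//.
  by rewrite mulrC -ler_pdivrMr// ltW.
apply: le_trans (lee_pmul _ _ (lexx _) (exp_mass_ball z jn)) _.
- by rewrite lee_fin divr_ge0// ltW.
- by apply: integral_ge0 => x _; rewrite lee_fin exp_birkhoff_ge0.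
rewrite -EFinM lee_fin le_eqVlt; apply/orP; left; apply/eqP.
by field; rewrite !gt_eqF// partition_sum_gt0.
Qed.

(* An interior subcell two levels below the cell [k]: a bump which is at least 1 on it still
   vanishes outside the half-open cell [k]. *)
Definition mid_index (k : 'rV[int]_m) : 'rV[int]_m := \row_i (4 * k ord0 i + 2).

Definition mid_point j (k : 'rV[int]_m) : 'rV[R]_m := node R j.+2 (mid_index k).

(** One [K] is the distortion inside the subcell, the other comes from the upper bound of the total
    mass. *)
Lemma density_lower j n (k : 'rV[int]_m) : (j.+2 <= n)%N ->
  ((expR (birkhoff_sum phi j.+2 (mid_point j k) - 2 * K) / partition_sum phi j.+2)%:E <=
   \int[leb]_x (bump (mid_point j k) (2 ^+ j.+2) x * gibbs_density phi n x)%:E)%E.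
Proof.
move=> jn; have [_ m0] := total_massE n.
have T0 := partition_sum_gt0 phi j.+2.
have p2 : 0 < 2 ^+ j.+2 :> R by rewrite exprn_gt0.
have mQ := @measurable_cube R m.
have -> : (\int[leb]_x (bump (mid_point j k) (2 ^+ j.+2) x * gibbs_density phi n x)%:E)%E =
   (\int[leb]_x (bump (mid_point j k) (2 ^+ j.+2) x * (exp_birkhoff n x / total_mass n))%:E)%E.
  by [].
apply: le_trans (integral_test_lower leb
   (measurable_scaled j.+2 (mid_index k) mQ)
   (f := bump (mid_point j k) (2 ^+ j.+2)) _ _ _ _ _); last 5 first.
- exact (@continuous_measurable_real R m _ (@bump_continuous R m _ _)).
- by apply: measurable_funM => //; exact: measurable_exp_birkhoff.
- by move=> x; rewrite divr_ge0 ?exp_birkhoff_ge0// ltW.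
- by move=> x; exact: bump_ge0.
- move=> x /(scaled_near (@subset_refl _ _)) h; apply: bump_ge1.
  by rewrite mulrC -ler_pdivlMr.
have -> : (\int[leb]_(x in scaled (@cube R m) j.+2 (mid_index k))
    (exp_birkhoff n x / total_mass n)%:E)%E =
    ((total_mass n)^-1%:E * exp_mass n (scaled (@cube R m) j.+2 (mid_index k)))%E.
  rewrite /exp_mass -ge0_integralZl_EFin//.
  - by apply: eq_integral => x _; rewrite mulrC.
  - exact: measurable_scaled.
  - by move=> x _; rewrite lee_fin exp_birkhoff_ge0.
  - by apply/measurable_EFinP; apply: measurable_funS (measurable_exp_birkhoff n).
  - by rewrite invr_ge0 ltW.
rewrite -lee_pdivrMl ?invr_gt0// invrK -EFinM.
have /andP[h _] := exp_mass_scaled (mid_index k) jn mQ (@subset_refl _ _).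
apply: le_trans h.
have := total_mass_upper jn; rewrite -lee_pdivrMl ?mulr_gt0 ?expR_gt0// => h.
apply: le_trans (lee_pmul _ _ (lexx _) h).
- rewrite -!EFinM lee_fin le_eqVlt; apply/orP; left; apply/eqP.
  rewrite /mid_point.
  rewrite (_ : _ - 2 * K = (birkhoff_sum phi j.+2 (node R j.+2 (mid_index k)) - K) - K);
    last by lra.
  rewrite [expR (_ - K - K)]expRD expRN; field.
  by rewrite !gt_eqF ?expR_gt0.
- by rewrite lee_fin expR_ge0.
- by rewrite -EFinM lee_fin mulr_ge0 ?invr_ge0 ?mulr_ge0 ?expR_ge0// ltW.
Qed.

Section limit_measure.
Variable eta : {measure set (borel_rV R m) -> \bar R}.
Hypothesis weak : forall f : 'rV[R]_m -> R, continuous f ->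
  (exists2 A : set 'rV[R]_m, compact A & forall x, ~ A x -> f x = 0) ->
  (\int[leb]_x (f x * gibbs_density phi n x)%:E)%E @[n --> \oo]
    --> (\int[eta]_x (f x)%:E)%E.

Let weak_bump z c : 0 < c ->
  (\int[leb]_x (bump z c x * gibbs_density phi n x)%:E)%E @[n --> \oo]
    --> (\int[eta]_x (bump z c x)%:E)%E.
Proof.
move=> c0; apply: weak; first exact: bump_continuous.
exists [set x : 'rV[R]_m | `|x - z| <= 2 / c]; first exact: compact_rV_closed_ball.
move=> x /negP; rewrite /= -ltNge => h; apply: bump_eq0.
by rewrite mulrC -ler_pdivrMr// ltW.
Qed.

Lemma gibbs_upper j (z : 'rV[R]_m) :
  (eta [set x : 'rV[R]_m | (`|x - z| <= 1 / 2 ^+ j)%R] <=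
   (2 * #|{: 'rV['I_7]_m}|%:R *
     (expR (3 * K + birkhoff_sum phi j z) / partition_sum phi j))%:E)%E.
Proof.
have p2 : 0 < 2 ^+ j :> R by rewrite exprn_gt0.
apply: (@le_trans _ _ (\int[eta]_x (bump z (2 ^+ j) x)%:E)%E).
  apply: measure_le_test.
  - exact: measurable_norm_ball.
  - exact (@continuous_measurable_real R m _ (@bump_continuous R m _ _)).
  - by move=> x; exact: bump_ge0.
  - by move=> x /= h; apply: bump_ge1; rewrite mulrC -ler_pdivlMr.
apply: (cvge_le _ (weak_bump (z := z) p2)).
by exists j => // n /= jn; exact: density_upper.
Qed.

Lemma gibbs_lower j (k : 'rV[int]_m) :
  ((expR (birkhoff_sum phi j.+2 (mid_point j k) - 2 * K) / (2 * partition_sum phi j.+2))%:E <=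
   eta (Hscaled j k))%E.
Proof.
have p2 : 0 < 2 ^+ j.+2 :> R by rewrite exprn_gt0.
have : ((expR (birkhoff_sum phi j.+2 (mid_point j k) - 2 * K) / partition_sum phi j.+2)%:E
    <= \int[eta]_x (bump (mid_point j k) (2 ^+ j.+2) x)%:E)%E.
  apply: (cvge_ge _ (weak_bump (z := mid_point j k) p2)).
  by exists j.+2 => // n /= jn; exact: density_lower.
move=> h; rewrite invfM mulrCA EFinM lee_pdivrMl//; apply: le_trans h _.
apply: test_le_measure => //.
- exact (@continuous_measurable_real R m _ (@bump_continuous R m _ _)).
- by move=> x _; rewrite bump_ge0 bump_le2// ltW.
(* [mid_point j k] is the centre of the cell [k], and the bump vanishes at distance 2 / 2^(j+2),
   half the side of that cell. *)
move=> x nx; apply: bump_eq0; rewrite leNgt; apply/negP => h; apply: nx => i.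
have : `|(x - mid_point j k) ord0 i| < 2 / 2 ^+ j.+2.
  apply: le_lt_trans (coord_le_norm _ _) _; rewrite ltr_pdivlMr//.
  by rewrite mulrC.
rewrite !mxE ltr_pdivlMr// -[X in _ * X](gtr0_norm p2) -normrM mulrBl.
rewrite mulrAC mulVf ?gt_eqF// mul1r rmorphD rmorphM/=.
rewrite !exprS; set a := x ord0 i; set b := 2 ^+ j; set c := (k _ _)%:~R.
by rewrite ltr_norml => /andP[h1 h2]; apply/andP; split; lra.
Qed.

End limit_measure.

End gibbs_estimates.

(** * Gibbs-like capacities *)

(** With the minus sign, local dimensions are limits of [S_j psi / (j ln 2)]. The constant is
    uniform over all radii between two consecutive powers of 1/2, so that every small ball is
    covered by some level j. *)
Definition gibbs_like (R : realType) m (kappa : set 'rV[R]_m -> R)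
    (psi : 'rV[R]_m -> R) (B : R) :=
  (forall j (k : 'rV['I_(2 ^ j)]_m),
    expR (- B - birkhoff_sum psi j (corner R k)) <= kappa (@dyadic_cube R m j k) <=
    expR (B - birkhoff_sum psi j (corner R k))) /\
  (forall x j rho, cube x -> (2 ^+ j.+1)^-1 <= rho <= (2 ^+ j)^-1 ->
    expR (- B - birkhoff_sum psi j x) <= ball_cap kappa x rho <=
    expR (B - birkhoff_sum psi j x)).

Section borel_sets.
Variables (R : realType) (m : nat).

Lemma borel_cube_dyadic j (k : 'rV['I_(2 ^ j)]_m) : borel_cube (@dyadic_cube R m j k).
Proof.
split; rewrite dyadic_cubeE; last exact: dyadic_cube_sub.
by apply: measurable_scaled; exact: measurable_ho_cube.
Qed.

Lemma borel_cube_ball (x : 'rV[R]_m) r : borel_cube (ball x r `&` @cube R m).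
Proof.
split; last by move=> y [].
apply: (@measurableI _ (borel_rV R m)); last exact: measurable_cube.
by apply: open_measurable_rV; exact: ball_open.
Qed.

Lemma measure_le (eta : {measure set (borel_rV R m) -> \bar R}) (A C : set 'rV[R]_m) :
  (measurable : set (set (borel_rV R m))) A ->
  (measurable : set (set (borel_rV R m))) C -> A `<=` C -> (eta A <= eta C)%E.
Proof. by move=> mA mC AC; apply: le_measure => //; rewrite inE. Qed.

End borel_sets.

Lemma powR_fine_bounds (R : realType) (y : \bar R) (s a b : R) : 0 < s ->
  ((expR a)%:E <= y <= (expR b)%:E)%E ->
  expR (s * a) <= fine y `^ s <= expR (s * b).
Proof.
move=> s0; case: y => [y| |] /=.
- rewrite !lee_fin => /andP[ay yb].
  have E c : expR (s * c) = expR c `^ s.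
    by rewrite /powR gt_eqF ?expR_gt0// expRK.
  have y0 : 0 <= y by exact: le_trans (expR_ge0 a) ay.
  by rewrite !E !ge0_ler_powR ?nnegrE ?expR_ge0 ?(ltW s0)//.
- by rewrite leye_eq/= andbF.
- by [].
Qed.

Lemma gibbs_capacity_like (R : realType) m (kappa : set 'rV[R]_m -> R) :
  gibbs_capacity kappa -> exists psi K B, tame psi K /\ gibbs_like kappa psi B.
Proof.
move=> [eta [s [[phi [per hol weak]] s0 kE]]].
have [K tphi] := hoelder_tame per hol.
have [M M0 phiM] := tame_bounded tphi.
have cphi := hoelder_is_continuous hol.
have K0 := tame_ge0 tphi.
have [P PK] := pressure tphi.
have [_ dis] := tphi.
pose N : R := 2 * #|{: 'rV['I_7]_m}|%:R.
have N0 : 0 < N.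
  by rewrite mulr_gt0// ltr0n; apply/card_gt0P; exists (const_mx ord0).
have TE j : partition_sum phi j = expR (ln (partition_sum phi j)).
  by rewrite lnK// posrE partition_sum_gt0.
have lnN : N = expR (ln N) by rewrite lnK.
(* [3 * K] comes from [gibbs_upper], the fourth [K] from replacing the partition sum by exp(j P). *)
pose B1 := ln N + 4 * K.
have up j z : (eta [set x : 'rV[R]_m | (`|x - z| <= 1 / 2 ^+ j)%R] <=
    (expR (B1 + (birkhoff_sum phi j z - j%:R * P)))%:E)%E.
  apply: le_trans (gibbs_upper tphi cphi phiM weak j z) _.
  rewrite -/N lee_fin [X in X * _]lnN TE -expRN -!expRD ler_expR /B1.
  by have := PK j; rewrite ler_norml => /andP[]; lra.
(* [2 * K] and [ln 2] come from [gibbs_lower], one [K] from the pressure and one from moving the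
   midpoint to the corner; the two extra levels cost [2 * M] in the Birkhoff sum and [2 * |P|] in
   the normalization. *)
pose B2 := 4 * K + 2 * M + ln 2 + 2 * `|P|.
have lo j (k : 'rV['I_(2 ^ j)]_m) :
    ((expR (- B2 + (birkhoff_sum phi j (corner R k) - j%:R * P)))%:E <=
     eta (@dyadic_cube R m j k))%E.
  rewrite dyadic_cubeE; apply: le_trans (gibbs_lower tphi cphi phiM weak j (wordZ k)).
  rewrite lee_fin TE -[X in X * expR (ln _)](@lnK _ 2) ?posrE//.
  rewrite -expRD -expRN -!expRD ler_expR.
  set z := mid_point R j (wordZ k).
  have h1 : `|birkhoff_sum phi j z - birkhoff_sum phi j (corner R k)| <= K.
    apply: dis; apply/rV_norm_leP => [|i]; first by rewrite divr_ge0.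
    rewrite !mxE ler_pdivlMr ?exprn_gt0// -[X in _ * X](@ger0_norm _ (2 ^+ j)) ?exprn_ge0//.
    rewrite -normrM rmorphD rmorphM/= -[((k ord0 i)%:Z)%:~R]/((k ord0 i)%:R) !exprS.
    rewrite -[4%:~R]/(4%:R : R) -[2%:~R]/(2%:R : R) [X in `|X|](_ : _ = 2^-1); last by field; rewrite expf_neq0.
    by rewrite ger0_norm//; lra.
  have h2 : birkhoff_sum phi j.+2 z >= birkhoff_sum phi j z - 2 * M.
    rewrite !birkhoff_sumS.
    have := phiM (2 ^+ j.+1 *: z); have := phiM (2 ^+ j *: z).
    by rewrite !ler_norml => /andP[? ?] /andP[? ?]; lra.
  move: (PK j.+2) h1; rewrite !ler_norml -(natr1 j.+1) -(natr1 j) => /andP[? ?] /andP[? ?].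
  have ? : P <= `|P| by exact: ler_norm.
  by rewrite /B2; lra.
(* The lower bound for a ball comes from a cube two levels below j, and the additional terms pay for
   these levels and for replacing its corner by the centre of the ball. *)
pose B3 := B2 + 2 * M + 2 * `|P| + K.
have B23 : B2 <= B3 by rewrite /B3; have := normr_ge0 P; lra.
pose B := s * (`|B1| + `|B3|).
(* This makes [exp (- S_j psi)] the power s of the Gibbs weight [exp (S_j phi - j P)]. *)
pose psi := fun x => - s * phi x + s * P.
have psiE j x : birkhoff_sum psi j x = - (s * (birkhoff_sum phi j x - j%:R * P)).
  by rewrite birkhoff_affine; ring.
have hB1 : B1 <= `|B1| + `|B3| by have := ler_norm B1; have := normr_ge0 B3; lra.
have hB3 : B3 <= `|B1| + `|B3| by have := ler_norm B3; have := normr_ge0 B1; lra.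
have mball j z : (measurable : set (set (borel_rV R m)))
    [set x : 'rV[R]_m | (`|x - z| <= 1 / 2 ^+ j)%R].
  exact: measurable_norm_ball.
have fin (E : set 'rV[R]_m) j z : borel_cube E ->
    E `<=` [set x : 'rV[R]_m | (`|x - z| <= 1 / 2 ^+ j)%R] ->
    ((expR (- B3 + (birkhoff_sum phi j z - j%:R * P)))%:E <= eta E)%E ->
    expR (- B - birkhoff_sum psi j z) <= kappa E <= expR (B - birkhoff_sum psi j z).
  move=> bE EV loE; rewrite kE//.
  have upE : (eta E <= (expR (B1 + (birkhoff_sum phi j z - j%:R * P)))%:E)%E.
    by apply: le_trans (up j z); apply: measure_le => //; case: bE.
  have /andP[h1 h2] := powR_fine_bounds s0 (introT andP (conj loE upE)).
  rewrite psiE opprK; apply/andP; split.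
    by apply: le_trans h1; rewrite ler_expR /B -mulrN -mulrDr ler_pM2l//; lra.
  by apply: le_trans h2 _; rewrite ler_expR /B -mulrDr ler_pM2l//; lra.
exists psi, (`|- s| * K), B; split; first exact: tame_affine.
split=> [j k|x j rho xQ /andP[r1 r2]].
  apply: fin.
  - exact: borel_cube_dyadic.
  - move=> x; rewrite dyadic_cubeE => /(scaled_near (@ho_cube_sub R m)).
    by rewrite node_wordZ.
  - by apply: le_trans (lo j k); rewrite lee_fin ler_expR; lra.
have p2 : 0 < 2 ^+ j :> R by rewrite exprn_gt0.
have r0 : 0 < rho by apply: lt_le_trans r1; rewrite invr_gt0 exprn_gt0.
apply: fin.
- exact: borel_cube_ball.
- move=> y [/(rV_ballP _ _ r0) xy _]; apply/rV_norm_leP => [|i].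
    by rewrite divr_ge0// ltW.
  rewrite mul1r (le_trans _ r2)//.
  by have := xy i; rewrite !mxE distrC => /ltW.
(* The radius is at least 2^-(j+1); a cell of half that side whose closure contains [x] lies in the
   open ball. *)
have [k kx] := cube_cover j.+2 xQ.
apply: (@le_trans _ _ (eta (@dyadic_cube R m j.+2 k))).
  apply: le_trans (lo j.+2 k); rewrite lee_fin ler_expR.
  have h1 : `|birkhoff_sum phi j x - birkhoff_sum phi j (corner R k)| <= K.
    apply: dis; have := scaled_near (@subset_refl _ _) kx; rewrite node_wordZ => h.
    apply: le_trans h _; rewrite !exprS ler_pdivlMr// !invfM.
    by rewrite -[leLHS]/(1 * (2^-1 * (2^-1 * (2 ^+ j)^-1)) * 2 ^+ j) -!mulrA mulVf ?gt_eqF//; lra.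
  have h2 : birkhoff_sum phi j.+2 (corner R k) >= birkhoff_sum phi j (corner R k) - 2 * M.
    rewrite !birkhoff_sumS; set z := corner R k.
    have := phiM (2 ^+ j.+1 *: z); have := phiM (2 ^+ j *: z).
    by rewrite !ler_norml => /andP[? ?] /andP[? ?]; lra.
  move: h1; rewrite ler_norml -(natr1 j.+1) -(natr1 j) => /andP[? ?].
  have ? : P <= `|P| by exact: ler_norm.
  by rewrite /B3; lra.
apply: measure_le.
- by have [] := borel_cube_dyadic R k.
- by have [] := borel_cube_ball x rho.
move=> y yk; split; last by have [_] := borel_cube_dyadic R k; apply.
apply/rV_ballP => // i; apply: lt_le_trans r1.
have := yk i; have := kx i; rewrite !mxE.
rewrite -[((k ord0 i)%:Z)%:~R]/((k ord0 i)%:R) -(natr1 (k ord0 i)).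
have p3 : 0 < 2 ^+ j.+2 :> R by rewrite exprn_gt0.
rewrite ler_pdivrMr// ltr_pdivlMr// => /andP[a1 a2] /andP[a3 a4].
rewrite -(ltr_pM2r p3) -[X in _ * X < _](gtr0_norm p3) -normrM.
rewrite (_ : (2 ^+ j.+1)^-1 * _ = 2); last first.
  by rewrite (exprS 2 j.+1) mulrCA mulVf ?expf_neq0// mulr1.
rewrite mulrBl.
by rewrite ltr_norml; apply/andP; split; lra.
Qed.

Lemma ball_setX (R : realType) d d' (x : 'rV[R]_(d + d')) r : 0 < r ->
  ball x r `&` @cube R (d + d') =
  setX_rV (ball (lsubmx x) r `&` @cube R d) (ball (rsubmx x) r `&` @cube R d').
Proof.
move=> r0; apply/seteqP; split => [y [/(rV_ballP _ _ r0) xy yQ]|y].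
  split; split; try by [apply/rV_ballP => // i; rewrite !mxE; exact: xy|
    move=> i; rewrite !mxE; exact: yQ].
move=> [[/(rV_ballP _ _ r0) h1 q1] [/(rV_ballP _ _ r0) h2 q2]]; split.
  apply/rV_ballP => // i; case: (split_ordP i) => l ->.
    by have := h1 l; rewrite !mxE.
  by have := h2 l; rewrite !mxE.
move=> i; case: (split_ordP i) => l ->.
  by have := q1 l; rewrite !mxE.
by have := q2 l; rewrite !mxE.
Qed.

Lemma dyadic_cube_setX (R : realType) d d' j (k : 'rV['I_(2 ^ j)]_(d + d')) :
  @dyadic_cube R (d + d') j k =
  setX_rV (@dyadic_cube R d j (lsubmx k)) (@dyadic_cube R d' j (rsubmx k)).
Proof.
apply/seteqP; split => [y h|y [h1 h2] i].
  by split => i; rewrite !mxE; exact: h.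
case: (split_ordP i) => l ->.
  by have := h1 l; rewrite !mxE.
by have := h2 l; rewrite !mxE.
Qed.

Lemma gibbs_like_prod (R : realType) d d' (mu : set 'rV[R]_d -> R)
    (nu : set 'rV[R]_d' -> R) (xi : set 'rV[R]_(d + d') -> R) psi psi' B B' :
  product_capacity mu nu xi -> gibbs_like mu psi B -> gibbs_like nu psi' B' ->
  gibbs_like xi (fun x => psi (lsubmx x) + psi' (rsubmx x)) (B + B').
Proof.
move=> [_ xiE] [mu1 mu2] [nu1 nu2].
have mul (a b c a' b' c' : R) : 0 <= a -> 0 <= a' -> a <= b <= c -> a' <= b' <= c' ->
    a * a' <= b * b' <= c * c'.
  move=> a0 a0' /andP[ab bc] /andP[ab' bc'].
  by rewrite !ler_pM ?(le_trans a0 ab) ?(le_trans a0' ab').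
split=> [j k|x j rho xQ r12].
  rewrite birkhoff_prod lsubmx_corner rsubmx_corner dyadic_cube_setX xiE; try exact: borel_cube_dyadic.
  have := mul _ _ _ _ _ _ (expR_ge0 _) (expR_ge0 _) (mu1 j (lsubmx k)) (nu1 j (rsubmx k)).
  by rewrite -!expRD; set a := birkhoff_sum psi _ _; set b := birkhoff_sum psi' _ _;
    rewrite (_ : - B - a + (- B' - b) = - (B + B') - (a + b)); [|ring];
    rewrite (_ : B - a + (B' - b) = B + B' - (a + b)); [|ring].
have r0 : 0 < rho.
  by case/andP: r12 => h _; apply: lt_le_trans h; rewrite invr_gt0 exprn_gt0.
have lQ : cube (lsubmx x) by move=> i; rewrite mxE; exact: xQ.
have rQ : cube (rsubmx x) by move=> i; rewrite mxE; exact: xQ.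
rewrite birkhoff_prod /ball_cap ball_setX// xiE; try exact: borel_cube_ball.
have := mul _ _ _ _ _ _ (expR_ge0 _) (expR_ge0 _) (mu2 _ j rho lQ r12) (nu2 _ j rho rQ r12).
by rewrite -!expRD; set a := birkhoff_sum psi _ _; set b := birkhoff_sum psi' _ _;
  rewrite (_ : - B - a + (- B' - b) = - (B + B') - (a + b)); [|ring];
  rewrite (_ : B - a + (B' - b) = B + B' - (a + b)); [|ring].
Qed.

(** * Local dimensions and the scaling function *)

Section limits_of_ratios.
Variable R : realType.

Lemma linear_cvg (a : nat -> R) (P C : R) :
  (forall j, `|a j - j%:R * P| <= C) -> (a j / j%:R) @[j --> \oo] --> P.
Proof.
move=> aP; apply/cvgrPdist_le => /= e e0.
have C0 : 0 <= C by exact: le_trans (normr_ge0 _) (aP 0%N).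
have [N CN] : exists N, C / e < N%:R.
  by exists (Num.truncn (C / e)).+1; rewrite truncnS_gt.
near=> j.
have j0 : (0 < j)%N by near: j; exists 1%N.
have Nj : (N <= j)%N by near: j; exists N.
have j1 : 0 < j%:R :> R by rewrite ltr0n.
rewrite distrC -[X in _ - X](mulfK (lt0r_neq0 j1)) -mulrBl normrM normfV.
rewrite (gtr0_norm j1) ler_pdivrMr// (mulrC P) (le_trans (aP j))//.
rewrite -ler_pdivrMl// mulrC (le_trans (ltW CN))// ler_nat//.
Unshelve. all: by end_near. Qed.

Lemma limf_einf_ge (T : choiceType) (X : filteredType T) (f : X -> \bar R)
    (F : set (set X)) (V : set X) a :
  F V -> (forall x, V x -> (a <= f x)%E) -> (a <= limf_einf f F)%E.
Proof.
move=> FV aV; rewrite limf_einfE; apply: (@le_trans _ _ (ereal_inf (f @` V))).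
  by apply: le_ereal_inf_tmp => _ [x Vx <-]; exact: aV.
by apply: ereal_sup_ubound; exists V.
Qed.

Lemma limf_esup_le (T : choiceType) (X : filteredType T) (f : X -> \bar R)
    (F : set (set X)) (V : set X) a :
  F V -> (forall x, V x -> (f x <= a)%E) -> (limf_esup f F <= a)%E.
Proof.
move=> FV aV; rewrite limf_esupE; apply: (@le_trans _ _ (ereal_sup (f @` V))).
  by apply: ereal_inf_lbound; exists V.
by apply: ge_ereal_sup => _ [x Vx <-]; exact: aV.
Qed.

Lemma limf_einf_le_esup (T : choiceType) (X : filteredType T) (f : X -> \bar R)
    (F : set (set X)) : ProperFilter F -> (limf_einf f F <= limf_esup f F)%E.
Proof.
move=> PF; rewrite limf_einfE limf_esupE.
apply: ge_ereal_sup => _ [V FV <-]; apply: le_ereal_inf_tmp => _ [W FW <-].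
have [x [Vx Wx]] := filter_ex (filterI FV FW).
apply: (@le_trans _ _ (f x)).
  by apply: ereal_inf_lbound; exists x.
by apply: ereal_sup_ubound; exists x.
Qed.

Lemma limf_einf_near (T : choiceType) (X : filteredType T) (f : X -> \bar R)
    (F : set (set X)) (l e : R) : ProperFilter F -> limf_einf f F = l%:E -> 0 < e ->
  F [set x | ((l - e)%:E <= f x)%E].
Proof.
move=> PF; rewrite limf_einfE => fl e0.
have : ((l - e)%:E < ereal_sup [set ereal_inf (f @` V) | V in F])%E.
  by rewrite fl lte_fin; lra.
move=> /ereal_sup_gt[_ [V FV <-]] h; apply: filterS FV => x Vx /=.
by apply: le_trans (ltW h) _; apply: ereal_inf_lbound; exists x.
Qed.

Lemma limf_einf_frequent (T : choiceType) (X : filteredType T) (f : X -> \bar R)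
    (F : set (set X)) (V : set X) (l e : R) : limf_einf f F = l%:E -> 0 < e -> F V ->
  exists2 x, V x & (f x < (l + e)%:E)%E.
Proof.
rewrite limf_einfE => fl e0 FV.
have : (ereal_inf (f @` V) < (l + e)%:E)%E.
  apply: (@le_lt_trans _ _ l%:E); last by rewrite lte_fin; lra.
  by rewrite -fl; apply: ereal_sup_ubound; exists V.
by move=> /ereal_inf_lt[_ [x Vx <-]] h; exists x.
Qed.

Lemma limf_near_fin (T : choiceType) (X : filteredType T) (f : X -> R)
    (F : set (set X)) (l : R) : ProperFilter F ->
  (forall e, 0 < e -> F [set x | `|f x - l| <= e]) ->
  limf_einf (fun x => (f x)%:E) F = l%:E /\ limf_esup (fun x => (f x)%:E) F = l%:E.
Proof.
move=> PF fl.
have lo : (l%:E <= limf_einf (fun x => (f x)%:E) F)%E.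
  apply/lee_subgt0Pr => e e0; apply: limf_einf_ge (fl e e0) _ => x /=.
  by rewrite -EFinB lee_fin ler_distl => /andP[].
have up : (limf_esup (fun x => (f x)%:E) F <= l%:E)%E.
  apply/lee_addgt0Pr => e e0; apply: limf_esup_le (fl e e0) _ => x /=.
  by rewrite -EFinD lee_fin ler_distl => /andP[].
have mid := limf_einf_le_esup (fun x => (f x)%:E) PF.
split; apply/eqP; rewrite eq_le; apply/andP; split => //.
  exact: le_trans mid up.
exact: le_trans lo mid.
Qed.

Lemma dyadic_scale (J : nat) (rho : R) : 0 < rho -> rho <= (2 ^+ J)^-1 ->
  exists2 j, (J <= j)%N & (2 ^+ j.+1)^-1 <= rho <= (2 ^+ j)^-1.
Proof.
move=> r0 rJ.
have p2 j : 0 < 2 ^+ j :> R by rewrite exprn_gt0.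
have exj : exists j, (J <= j)%N && ((2 ^+ j.+1)^-1 <= rho).
  exists (maxn J (Num.truncn rho^-1)); rewrite leq_maxl/= invf_ple ?posrE//.
  apply: (@le_trans _ _ (Num.truncn rho^-1).+1%:R); first by rewrite ltW// truncnS_gt.
  rewrite -natrX ler_nat (leq_trans _ (ltnW (ltn_expl _ _)))//.
  by rewrite ltnS leq_maxr.
have [j /andP[Jj jr] jmin] := ex_minnP exj.
exists j => //; rewrite jr/=.
have [jJ|Jltj] := eqVneq j J; first by rewrite jJ.
have J0 : (J < j)%N by rewrite ltn_neqAle eq_sym Jltj.
case: j => [//|j] in Jj jr jmin Jltj J0 *.
rewrite leNgt; apply/negP => lt.
by have := jmin j; rewrite -ltnS J0/= ltW// ltnn => /(_ isT).
Qed.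

End limits_of_ratios.

Lemma ln_bounds (R : realType) (u v a : R) : expR u <= a <= expR v -> u <= ln a <= v.
Proof.
move=> /andP[ua av]; have a0 : 0 < a by apply: lt_le_trans ua; rewrite expR_gt0.
by rewrite -(ler_expR u) -(ler_expR _ v) lnK// ua av.
Qed.

Section gibbs_like_theory.
Variables (R : realType) (m : nat) (kappa : set 'rV[R]_m -> R).
Variables (psi : 'rV[R]_m -> R) (K B : R).
Hypotheses (tpsi : tame psi K) (gl : gibbs_like kappa psi B).

Lemma tame_scale t : tame (fun x => - t * psi x) (`|t| * K).
Proof.
have := @tame_affine R m psi K (- t) 0 tpsi; rewrite normrN.
by congr (tame _ _); apply/funext => x; rewrite addr0.
Qed.

Lemma birkhoff_scale t j x :
  birkhoff_sum (fun x => - t * psi x) j x = - (t * birkhoff_sum psi j x).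
Proof. by rewrite /birkhoff_sum -mulr_sumr mulNr. Qed.

Lemma gibbs_like_B_ge0 : 0 <= B.
Proof.
have [h _] := gl; have lt0 : (0 < 2 ^ 0)%N by [].
have /andP[h1 h2] := h 0%N (const_mx (Ordinal lt0)).
by have := le_trans h1 h2; rewrite ler_expR; lra.
Qed.

Lemma moment_sum_bound t j :
  0 < \sum_(k : 'rV['I_(2 ^ j)]_m) powR00 (kappa (@dyadic_cube R m j k)) t /\
  `|ln (\sum_(k : 'rV['I_(2 ^ j)]_m) powR00 (kappa (@dyadic_cube R m j k)) t) -
    ln (partition_sum (fun x => - t * psi x) j)| <= `|t| * B.
Proof.
set s := \sum_k _; set p := partition_sum _ _.
have p0 : 0 < p by exact: partition_sum_gt0.
have [h _] := gl.
have term (k : 'rV['I_(2 ^ j)]_m) :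
    expR (- (`|t| * B)) * expR (birkhoff_sum (fun x => - t * psi x) j (corner R k)) <=
    powR00 (kappa (@dyadic_cube R m j k)) t <=
    expR (`|t| * B) * expR (birkhoff_sum (fun x => - t * psi x) j (corner R k)).
  have := h j k; set a := kappa _; set S := birkhoff_sum _ _ _ => /[dup] /ln_bounds hl /andP[h1 _].
  (* All dyadic cubes have positive mass, so the convention 0^t = 0 never takes effect. *)
  have a0 : 0 < a by apply: lt_le_trans h1; rewrite expR_gt0.
  rewrite /powR00 gt_eqF// /powR gt_eqF// -!expRD !ler_expR birkhoff_scale -/S.
  have : `|t * (ln a + S)| <= `|t| * B.
    rewrite normrM ler_wpM2l// ler_norml.
    by move: hl => /andP[? ?]; apply/andP; split; lra.
  by rewrite ler_norml => /andP[? ?]; apply/andP; split; lra.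
have lo : expR (- (`|t| * B)) * p <= s.
  by rewrite /p /partition_sum mulr_sumr ler_sum// => k _; have /andP[] := term k.
have up : s <= expR (`|t| * B) * p.
  by rewrite /p /partition_sum mulr_sumr ler_sum// => k _; have /andP[] := term k.
have s0 : 0 < s by apply: lt_le_trans lo; rewrite mulr_gt0 ?expR_gt0.
split => //.
rewrite -ler_ln ?posrE ?mulr_gt0 ?expR_gt0// lnM ?posrE ?expR_gt0// expRK in lo.
rewrite -ler_ln ?posrE ?mulr_gt0 ?expR_gt0// lnM ?posrE ?expR_gt0// expRK in up.
by rewrite ler_norml; apply/andP; split; lra.
Qed.

Lemma tau_gibbs_like t P :
  (forall j, `|ln (partition_sum (fun x => - t * psi x) j) - j%:R * P| <= `|t| * K) ->
  tau kappa t = (- P / ln 2)%:E.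
Proof.
move=> hP; rewrite /tau.
pose s j := \sum_(k : 'rV['I_(2 ^ j)]_m) powR00 (kappa (@dyadic_cube R m j k)) t.
have sP j : `|ln (s j) - j%:R * P| <= `|t| * B + `|t| * K.
  have [_ h] := moment_sum_bound t j.
  rewrite -[X in `|X|](subrKA (ln (partition_sum (fun x => - t * psi x) j))).
  by rewrite (le_trans (ler_normD _ _))// lerD.
(* This includes j = 0, where both sides vanish because the inverse of 0 is 0. *)
rewrite (_ : (fun j : nat => _) = (fun j => (- (ln 2)^-1 * (ln (s j) / j%:R))%:E)); last first.
  apply/funext => j; have [s0 _] := moment_sum_bound t j.
  rewrite -/(s j) in s0 *; rewrite lne_EFin// -EFinM; congr EFin.
  by rewrite invfM; ring.
have -> : - P / ln 2 = - (ln 2)^-1 * P by ring.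
apply: (cvg_limn_einf_sup _).1; apply: cvg_EFin; first by near=> j.
apply: cvgM; first exact: cvg_cst.
exact: linear_cvg sP.
Unshelve. all: by end_near. Qed.

(** [e] is the error in the Gibbs estimate and [d] the excess of the binary logarithm of 1 / rho
    over j. Both stay bounded, so the ratio behaves as [S_j psi (x) / (j ln 2)]. *)
Lemma ball_ratio_bound x j rho : cube x -> (2 ^+ j.+1)^-1 <= rho <= (2 ^+ j)^-1 ->
  (0 < j)%N -> exists e d : R, [/\ `|e| <= B, 0 <= d <= 1 &
    ln (ball_cap kappa x rho) / ln rho =
      (birkhoff_sum psi j x + e) / ((j%:R + d) * ln 2)].
Proof.
move=> xQ r12 j0; have [_ h] := gl; have := h x j rho xQ r12.
have /andP[r1 r2] := r12.
have p2 i : 0 < 2 ^+ i :> R by rewrite exprn_gt0.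
have r0 : 0 < rho by apply: lt_le_trans r1; rewrite invr_gt0.
set b := ball_cap _ _ _; set S := birkhoff_sum _ _ _ => /ln_bounds/andP[h1 h2].
have l2 : 0 < ln 2 :> R by rewrite ln_gt0// ltr1n.
have lnp i : ln (2 ^+ i)^-1 = - (i%:R * ln 2) :> R.
  by rewrite lnV ?posrE// lnXn// mulr_natl.
rewrite -ler_ln ?posrE ?invr_gt0// lnp in r1.
rewrite -ler_ln ?posrE ?invr_gt0// lnp in r2.
exists (- ln b - S), (- ln rho / ln 2 - j%:R); split.
- by rewrite ler_norml; apply/andP; split; lra.
- rewrite subr_ge0 lerBlDr ler_pdivlMr// ler_pdivrMr//.
  by rewrite -natr1 in r1; apply/andP; split; lra.
- rewrite addrC subrK addrC subrK mulrAC mulfK ?gt_eqF//.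
  by rewrite invrN mulrNN.
Qed.

Lemma ball_cap_supp x :
  (forall E F, borel_cube E -> borel_cube F -> E `<=` F -> kappa E <= kappa F) ->
  cube x -> cap_supp kappa x.
Proof.
move=> mono xQ; split => // rho r0.
pose r := Num.min rho 1.
have r1 : 0 < r by rewrite lt_min r0 ltr01.
have [|j _ r12] := @dyadic_scale _ 0%N r r1; first by rewrite expr0 invr1 ge_min lexx orbT.
have [_ h] := gl; have /andP[h1 _] := h x j r xQ r12.
apply: (@lt_le_trans _ _ (ball_cap kappa x r)).
  by apply: lt_le_trans h1; rewrite expR_gt0.
apply: mono; try exact: borel_cube_ball.
by apply: setSI; apply: le_ball; rewrite ge_min lexx.
Qed.

Lemma exists_scale (a b : R) : 0 < b -> exists J : nat, (0 < J)%N /\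
  forall j, (J <= j)%N -> a <= j%:R * b.
Proof.
move=> b0; exists (Num.truncn (a / b)).+1; split => // j Jj.
rewrite -ler_pdivrMr// (le_trans (ltW (truncnS_gt _)))// ler_nat//.
Qed.

Let near0 J : (0 : R)^'+ [set rho | 0 < rho /\ rho <= (2 ^+ J)^-1].
Proof.
have p2 : 0 < (2 ^+ J)^-1 :> R by rewrite invr_gt0 exprn_gt0.
near=> rho => /=; split; first by near: rho; exact: nbhs_right_gt.
by near: rho; exact: nbhs_right_le.
Unshelve. all: by end_near. Qed.

Let ln2_gt0 : 0 < ln 2 :> R. Proof. by rewrite ln_gt0// ltr1n. Qed.

(** A lower limit h means that the ratio is eventually above h - e1 and infinitely often below h +
    e1. The two-sided estimate at infinitely many levels lets one covering argument serve both signs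
    of t. *)
Lemma lower_dim_frequent x h e J : cube x -> lower_dim kappa x = h%:E -> 0 < e ->
  exists2 j, (J <= j)%N & `|birkhoff_sum psi j x - j%:R * (h * ln 2)| <= j%:R * e.
Proof.
move=> xQ lx e0; have B0 := gibbs_like_B_ge0.
have [J1 [J1_gt0 hJ1]] := exists_scale (B + `|h| * ln 2 + e / 2) (divr_gt0 e0 (ltr0Sn R 1)).
pose e1 := e / (2 * ln 2).
have e10 : 0 < e1 by rewrite divr_gt0 ?mulr_gt0.
have PF : ProperFilter (0 : R)^'+ by exact: at_right_proper_filter.
have FV : (0 : R)^'+ ([set rho | 0 < rho /\ rho <= (2 ^+ maxn J J1)^-1] `&`
    [set rho | ((h - e1)%:E <= (ln (ball_cap kappa x rho) / ln rho)%:E)%E]).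
  by apply: filterI; [exact: near0|exact: limf_einf_near lx e10].
have [rho [[r0 rJ] /= lo] up] := limf_einf_frequent lx e10 FV.
have [j Jj r12] := dyadic_scale r0 rJ.
have j0 : (0 < j)%N by rewrite (leq_trans J1_gt0)// (leq_trans _ Jj)// leq_maxr.
have [e2 [d [e2B /andP[d0 d1] fE]]] := ball_ratio_bound xQ r12 j0.
exists j; first by rewrite (leq_trans _ Jj)// leq_maxl.
have hj := hJ1 j (leq_trans (leq_maxr _ _) Jj).
move: lo up; rewrite lee_fin lte_fin fE => lo up.
have jp : 0 < j%:R :> R by rewrite ltr0n.
have den : 0 < (j%:R + d) * ln 2 by rewrite mulr_gt0// ltr_wpDr.
rewrite ler_pdivlMr// in lo; rewrite ltr_pdivrMr// in up.
have hd : `|h * d * ln 2| <= `|h| * ln 2.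
  rewrite !normrM (ger0_norm d0) (gtr0_norm ln2_gt0) ler_pM2r//.
  by rewrite ler_piMr.
have e1E : e1 * ((j%:R + d) * ln 2) = (j%:R + d) * e / 2.
  by rewrite /e1; field; rewrite gt_eqF.
have ed : d * e <= e by rewrite ler_piMl// ltW.
move: e2B hd; rewrite !ler_norml => /andP[? ?] /andP[? ?].
by apply/andP; split; lra.
Qed.

Lemma dim_of_cvg x h : cube x ->
  (forall e, 0 < e -> exists J, forall j, (J <= j)%N ->
     `|birkhoff_sum psi j x - j%:R * (h * ln 2)| <= j%:R * e) ->
  lower_dim kappa x = h%:E /\ upper_dim kappa x = h%:E.
Proof.
move=> xQ hx; have B0 := gibbs_like_B_ge0.
apply: limf_near_fin => e e0.
have e20 : 0 < e * ln 2 / 2 by rewrite divr_gt0// mulr_gt0.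
have [J0 hJ0] := hx _ e20.
have [J1 [J1_gt0 hJ1]] := exists_scale (B + `|h| * ln 2) e20.
apply: filterS (near0 (maxn J0 J1)) => rho /= [r0 rJ].
have [j Jj r12] := dyadic_scale r0 rJ.
have j0 : (0 < j)%N by rewrite (leq_trans J1_gt0)// (leq_trans _ Jj)// leq_maxr.
have [e2 [d [e2B /andP[d0 d1] fE]]] := ball_ratio_bound xQ r12 j0.
have hj := hJ1 j (leq_trans (leq_maxr _ _) Jj).
have hj0 := hJ0 j (leq_trans (leq_maxl _ _) Jj).
have jp : 0 < j%:R :> R by rewrite ltr0n.
have den : 0 < (j%:R + d) * ln 2 by rewrite mulr_gt0// ltr_wpDr.
rewrite fE -[X in _ - X](mulfK (lt0r_neq0 den)) -mulrBl normrM normfV (gtr0_norm den).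
rewrite ler_pdivrMr//.
have hd : `|h * d * ln 2| <= `|h| * ln 2.
  rewrite !normrM (ger0_norm d0) (gtr0_norm ln2_gt0) ler_pM2r//.
  by rewrite ler_piMr.
have dd : 0 <= d * (e * ln 2) by rewrite mulr_ge0// mulr_ge0 ?ltW.
move: e2B hd hj0; rewrite !ler_norml => /andP[? ?] /andP[? ?] /andP[? ?].
by apply/andP; split; lra.
Qed.

End gibbs_like_theory.

(** * Upper bound of the spectrum *)

Section hausdorff_cover.
Variables (R : realType) (V : normedModType R).
Local Open Scope ereal_scope.

Lemma nneseries_le (u : (\bar R)^nat) (S : \bar R) : (forall i, 0 <= u i) ->
  (forall n, \sum_(i < n) u i <= S) -> \sum_(i <oo) u i <= S.
Proof.
move=> u0 uS; apply: lime_le; first exact: is_cvg_nneseries.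
by near=> n; rewrite big_mkord.
Unshelve. all: by end_near. Qed.

Lemma diam_pow_ge0 s (U : set V) : 0 <= diam_pow s U.
Proof. by rewrite /diam_pow; case: ifP => // _; exact: poweR_ge0. Qed.

Lemma diam_pow0 s : diam_pow s (set0 : set V) = 0.
Proof. by rewrite /diam_pow eqxx. Qed.

Lemma hausdorff_premeasure_ge0 delta s (A : set V) : 0 <= hausdorff_premeasure delta s A.
Proof.
apply: le_ereal_inf_tmp => _ [U _ <-]; apply: nneseries_ge0 => i _ _.
exact: diam_pow_ge0.
Qed.

Lemma hausdorff_measure_ge0 s (A : set V) : 0 <= hausdorff_measure s A.
Proof.
apply: le_trans (hausdorff_premeasure_ge0 1 s A) _.
by apply: ereal_sup_ubound; exists 1%R => //=.
Qed.

Lemma premeasure_double_cover delta s (A : set V) (W : nat -> nat -> set V) :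
  A `<=` \bigcup_i \bigcup_j W i j -> (forall i j, diam (W i j) <= delta%:E) ->
  hausdorff_premeasure delta s A <= \sum_(i <oo) \sum_(j <oo) diam_pow s (W i j).
Proof.
move=> AW dW.
have /ppcard_eqP[f] : ([set: nat] #= [set: nat * nat])%card.
  by rewrite card_eq_sym; exact: card_nat2.
apply: (@le_trans _ _ (\sum_(i <oo) diam_pow s (W (f i).1 (f i).2))).
  apply: ereal_inf_lbound; exists (fun i => W (f i).1 (f i).2) => //; split => //.
  move=> x /AW[i _ [j _ Wx]]; exists (f^-1%FUN (i, j)) => //.
  by rewrite invK ?inE.
rewrite nneseries_esumT; last by move=> i; exact: diam_pow_ge0.
have <- : \esum_(p in [set: nat * nat]) diam_pow s (W p.1 p.2) =
    \esum_(i in [set: nat]) diam_pow s (W (f i).1 (f i).2).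
  by rewrite (reindex_esum [set: nat] _ f).
rewrite nneseries_esumT; last by move=> i; apply: nneseries_ge0 => j _ _; exact: diam_pow_ge0.
under [leRHS]eq_esum => i _.
  rewrite nneseries_esumT; last by move=> j; exact: diam_pow_ge0.
  over.
rewrite esum_esum; last by move=> i j _ _; exact: diam_pow_ge0.
by rewrite (_ : _ `*`` _ = setT)//; apply/seteqP; split => // -[].
Qed.

End hausdorff_cover.

Section hausdorff_null.
Variables (R : realType) (m : nat).

Lemma diam_scaled j (k : 'rV[int]_m) :
  (diam (scaled (@cube R m) j k) <= ((2 ^+ j)^-1)%:E)%E.
Proof.
have p2 : 0 < 2 ^+ j :> R by rewrite exprn_gt0.
apply: ge_ereal_sup => _ [[x y] [/= hx hy] <-]; rewrite lee_fin.
apply/rV_norm_leP => [|i]; first by rewrite invr_ge0 ltW.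
rewrite -[leRHS]mul1r ler_pdivlMr// -[X in _ * X](gtr0_norm p2) -normrM !mxE mulrBl.
have := hx i; have := hy i; rewrite !mxE => /andP[? ?] /andP[? ?].
by rewrite ler_norml; apply/andP; split; lra.
Qed.

Lemma diam_pow_scaled s j (k : 'rV[int]_m) : 0 <= s ->
  (diam_pow s (scaled (@cube R m) j k) <= ((2 ^+ j)^-1 `^ s)%:E)%E.
Proof.
move=> s0; rewrite /diam_pow; case: ifPn => [_|n0]; first by rewrite lee_fin powR_ge0.
rewrite -poweR_EFin; apply: gt0_ler_poweR => //.
- rewrite in_itv/= leey andbT; have /set0P[x hx] := n0.
  apply: le_ereal_sup_tmp; exists `|x - x|%:E; last by rewrite lee_fin.
  by exists (x, x).
- by rewrite in_itv/= lee_fin invr_ge0 exprn_ge0//= leey.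
- exact: diam_scaled.
Qed.

Fact exp2_gt0 j : (0 < 2 ^ j)%N. Proof. by rewrite expn_gt0. Qed.

Definition word0 j : 'rV['I_(2 ^ j)]_m := const_mx (Ordinal (exp2_gt0 j)).

Lemma sum_if_lt (c : R) N n : 0 <= c ->
  \sum_(i < n) (if (i < N)%N then c else 0) <= N%:R * c.
Proof.
move=> c0; suff -> : \sum_(i < n) (if (i < N)%N then c else 0) = (minn n N)%:R * c.
  by rewrite ler_wpM2r// ler_nat geq_minr.
elim: n => [|n IH]; first by rewrite big_ord0 min0n mul0r.
rewrite big_ord_recr/= IH; case: ltnP => nN.
  by rewrite (minn_idPl nN) -[in RHS]natr1 mulrDl mul1r.
by rewrite (minn_idPr (leqW nN)) addr0.
Qed.

Lemma geometric_tail (r : R) J n : 0 < r < 1 ->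
  \sum_(i < n) (if (J <= i)%N then r ^+ i else 0) <= r ^+ J / (1 - r).
Proof.
move=> /andP[r0 r1]; have r1' : 0 < 1 - r by rewrite subr_gt0.
rewrite ler_pdivlMr//.
suff -> : (\sum_(i < n) (if (J <= i)%N then r ^+ i else 0)) * (1 - r) =
    r ^+ J - r ^+ (maxn J n).
  by rewrite gerBl exprn_ge0// ltW.
elim: n => [|n IH]; first by rewrite big_ord0 mul0r maxn0 subrr.
rewrite big_ord_recr/= mulrDl {}IH; case: (leqP J n) => nJ.
  by rewrite (maxn_idPr (leqW nJ)) exprS; ring.
by rewrite (maxn_idPl nJ); ring.
Qed.

(** A Borel-Cantelli argument: the selected cells of all levels from [J] on cover [A], and their
    total weight is at most the tail of a geometric series. *)
Lemma hausdorff_null (A : set 'rV[R]_m) (G : forall j, pred 'rV['I_(2 ^ j)]_m)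
    (C r s : R) : 0 <= s -> 0 <= C -> 0 < r < 1 ->
  (forall j, #|G j|%:R * (2 ^+ j)^-1 `^ s <= C * r ^+ j) ->
  (forall x, A x -> forall J, exists j, exists k : 'rV['I_(2 ^ j)]_m,
    [/\ (J <= j)%N, G j k & scaled (@cube R m) j (wordZ k) x]) ->
  hausdorff_measure s A = 0%E.
Proof.
move=> s0 C0 r01 cG AG; have /andP[r0 r1] := r01.
apply/eqP; rewrite eq_le hausdorff_measure_ge0 andbT.
apply: ge_ereal_sup => _ [delta /= d0 <-].
apply/lee_addgt0Pr => e e0; rewrite add0e.
have rcvg : (fun n => r ^+ n) @ \oo --> (0 : R).
  by apply: cvg_expr; rewrite gtr0_norm.
have [J [Jd Je]] : exists J, (2 ^+ J)^-1 <= delta /\ C * (r ^+ J / (1 - r)) <= e.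
  have c2 : (fun n => (2^-1 : R) ^+ n) @ \oo --> (0 : R).
    by apply: cvg_expr; rewrite gtr0_norm ?invr_gt0// invf_lt1// ltr1n.
  have r1' : 0 < 1 - r by rewrite subr_gt0.
  have e' : 0 < e * (1 - r) / (C + 1).
    by rewrite divr_gt0 ?mulr_gt0// ltr_wpDl.
  have /cvgrPdist_le /(_ _ e') [J1 _ hJ1] := rcvg.
  have /cvgrPdist_le /(_ _ d0) [J2 _ hJ2] := c2.
  exists (maxn J1 J2); split.
    have := hJ2 (maxn J1 J2) (leq_maxr _ _).
    by rewrite sub0r normrN ger0_norm ?exprn_ge0 ?invr_ge0// exprVn.
  have := hJ1 (maxn J1 J2) (leq_maxl _ _).
  rewrite sub0r normrN ger0_norm ?exprn_ge0 ?(ltW r0)// => h.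
  rewrite mulrA ler_pdivrMr//.
  apply: (@le_trans _ _ ((C + 1) * r ^+ maxn J1 J2)).
    by rewrite ler_wpM2r ?exprn_ge0 ?(ltW r0)// lerDl.
  by rewrite mulrC -ler_pdivlMr// ltr_wpDl.
(* Row i lists the selected cells of level i and is padded with empty sets, whose weight is 0 even
   for s = 0. *)
pose W i j : set 'rV[R]_m := if (J <= i)%N && (j < #|G i|)%N then
  scaled (@cube R m) i (wordZ (nth (word0 i) (enum (G i)) j)) else set0.
have dW i j : (diam_pow s (W i j) <=
    (if (J <= i)%N then if (j < #|G i|)%N then (2 ^+ i)^-1 `^ s else 0 else 0)%:E)%E.
  rewrite /W; case: (leqP J i) => Ji; last by rewrite diam_pow0.
  case: ltnP => jG; last by rewrite diam_pow0.
  exact: diam_pow_scaled.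
have diamW i j : (diam (W i j) <= delta%:E)%E.
  rewrite /W; case: (leqP J i) => Ji /=.
    case: ltnP => jG; last first.
      by apply: ge_ereal_sup => _ [? [[]]].
    apply: le_trans (diam_scaled _ _) _; rewrite lee_fin (le_trans _ Jd)//.
    by rewrite lef_pV2 ?posrE ?exprn_gt0// ler_eXn2l// ltr1n.
  by apply: ge_ereal_sup => _ [? [[]]].
apply: le_trans (premeasure_double_cover (W := W) s _ diamW) _.
  move=> x /AG/(_ J)[i [k [Ji Gk xk]]]; exists i => //.
  have kG : k \in enum (G i) by rewrite mem_enum.
  exists (index k (enum (G i))) => //.
  by rewrite /W Ji cardE index_mem kG/= nth_index.
have row i : (\sum_(j <oo) diam_pow s (W i j) <=
    (if (J <= i)%N then C * r ^+ i else 0)%:E)%E.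
  apply: nneseries_le => [j|n]; first exact: diam_pow_ge0.
  apply: (@le_trans _ _ (\sum_(j < n) (if (J <= i)%N then
     if (j < #|G i|)%N then (2 ^+ i)^-1 `^ s else 0 else 0)%:E)%E).
    by apply: lee_sum => j _; exact: dW.
  rewrite sumEFin lee_fin; case: leqP => Ji; last by rewrite big1.
  by rewrite (le_trans (sum_if_lt _ _ _)) ?powR_ge0.
apply: nneseries_le => [i|n]; first by apply: nneseries_ge0 => j _ _; exact: diam_pow_ge0.
apply: (@le_trans _ _ (\sum_(i < n) (if (J <= i)%N then C * r ^+ i else 0)%:E)%E).
  by apply: lee_sum => i _; exact: row.
rewrite sumEFin lee_fin (le_trans _ Je)//.
rewrite (le_trans _ (ler_wpM2l C0 (geometric_tail J n r01)))// mulr_sumr.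
by apply: ler_sum => i _; case: ifP; rewrite ?mulr0.
Qed.

End hausdorff_null.

Lemma le_hausdorff_measure (R : realType) (V : normedModType R) s (A C : set V) :
  A `<=` C -> (hausdorff_measure s A <= hausdorff_measure s C)%E.
Proof.
move=> AC; apply: ge_ereal_sup => _ [delta /= d0 <-].
apply: (@le_trans _ _ (hausdorff_premeasure delta s C)).
  apply: ereal_inf_le_tmp => _ [U [CU dU] <-]; exists U => //; split => //.
  exact: subset_trans CU.
by apply: ereal_sup_ubound; exists delta.
Qed.

Lemma le_hausdorff_dim (R : realType) (V : normedModType R) (A C : set V) :
  A `<=` C -> (hausdorff_dim A <= hausdorff_dim C)%E.
Proof.
move=> AC; rewrite /hausdorff_dim; case: eqP => [_|A0]; first exact: leNye.
case: eqP => [C0|_]; first by exfalso; apply: A0; rewrite -subset0 -C0.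
apply: ereal_inf_le_tmp => _ [s [s0 Cs] <-]; exists s => //; split => //.
by apply/eqP; rewrite eq_le hausdorff_measure_ge0 andbT -Cs le_hausdorff_measure.
Qed.

Section spectrum_upper.
Variables (R : realType) (m : nat) (kappa : set 'rV[R]_m -> R).
Variables (psi : 'rV[R]_m -> R) (K B : R).
Hypotheses (tpsi : tame psi K) (gl : gibbs_like kappa psi B).
Variables (t P h : R).
Hypothesis hP : forall j,
  `|ln (partition_sum (fun x => - t * psi x) j) - j%:R * P| <= `|t| * K.

(** The summand [K] pays for evaluating at the corner of the cell instead of at the point
    covered. *)
Definition good_words e j (k : 'rV['I_(2 ^ j)]_m) :=
  `|birkhoff_sum psi j (corner R k) - j%:R * (h * ln 2)| <= j%:R * e + K.

(** Markov's inequality: every good word contributes at least [exp (- j (t H + |t| e) - |t| K)] to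
    the partition sum of [- t psi], with [H = h ln 2], and the pressure bounds that sum. *)
Lemma good_words_count e j : 0 <= e ->
  #|@good_words e j|%:R <= expR (j%:R * (P + t * (h * ln 2) + `|t| * e) + 2 * `|t| * K).
Proof.
move=> e0; set H := h * ln 2.
have p0 := partition_sum_gt0 (fun x => - t * psi x) j.
have pE : partition_sum (fun x => - t * psi x) j <= expR (j%:R * P + `|t| * K).
  rewrite -[leLHS]lnK// ler_expR.
  by have := hP j; rewrite ler_norml => /andP[]; lra.
suff : #|@good_words e j|%:R * expR (- (j%:R * (t * H + `|t| * e) + `|t| * K)) <=
    partition_sum (fun x => - t * psi x) j.
  rewrite -ler_pdivlMr ?expR_gt0// -expRN opprK => h1; apply: le_trans h1 _.
  rewrite (le_trans (ler_wpM2r (expR_ge0 _) pE))// -expRD ler_expR; lra.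
rewrite mulr_natl -sumr_const big_mkcond/=; apply: ler_sum => k _.
case: ifPn => [|_]; last exact: expR_ge0.
rewrite unfold_in => kG; rewrite ler_expR birkhoff_scale.
have : `|t * (birkhoff_sum psi j (corner R k) - j%:R * H)| <= `|t| * (j%:R * e + K).
  by rewrite normrM ler_wpM2l.
rewrite ler_norml => /andP[? ?]; lra.
Qed.

Lemma good_words_cover x e J : lower_level kappa h x -> 0 < e ->
  exists j, exists k : 'rV['I_(2 ^ j)]_m,
    [/\ (J <= j)%N, @good_words e j k & scaled (@cube R m) j (wordZ k) x].
Proof.
move=> [[xQ _] lx] e0.
have [j Jj hj] := lower_dim_frequent gl J xQ lx e0.
have [k kx] := cube_cover j xQ; exists j, k; split => //.
have [_ dis] := tpsi; rewrite /good_words.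
have : `|birkhoff_sum psi j x - birkhoff_sum psi j (corner R k)| <= K.
  apply: dis; have := scaled_near (@subset_refl _ _) kx; rewrite node_wordZ => h1.
  by apply: le_trans h1 _; rewrite ler_pM2r ?invr_gt0 ?exprn_gt0// ler1n.
move: hj; rewrite !ler_norml => /andP[? ?] /andP[? ?].
by apply/andP; split; lra.
Qed.

Let H := h * ln 2.

(** Otherwise fewer than one good word would remain at deep levels, although [x] lies in the cells
    of such words. Hence a negative bound means an empty level set, of dimension -oo, and otherwise
    the exponents tested below are nonnegative. *)
Lemma lower_level_pressure_ge0 x : lower_level kappa h x -> 0 <= P + t * H.
Proof.
move=> lx; rewrite leNgt; apply/negP => neg.
pose g := - (P + t * H); have g0 : 0 < g by rewrite oppr_gt0.
pose e := g / (2 * (`|t| + 1)).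
have t1 : 0 < `|t| + 1 by rewrite ltr_wpDl.
have e0 : 0 < e by rewrite divr_gt0// mulr_gt0.
have te : `|t| * e <= g / 2.
  by rewrite /e mulrA ler_pdivrMr ?mulr_gt0//; lra.
have g2 : 0 < g / 2 by rewrite divr_gt0.
have [J [_ hJ]] := exists_scale (2 * `|t| * K + 1) g2.
have [j [k [Jj kG _]]] := good_words_cover J lx e0.
have := good_words_count j (ltW e0); rewrite leNgt => /negP; apply.
apply: (@lt_le_trans _ _ 1); last first.
  by rewrite ler1n; apply/card_gt0P; exists k; rewrite unfold_in.
rewrite expR_lt1; have := hJ j Jj; rewrite -/H.
have jte : j%:R * (`|t| * e) <= j%:R * (g / 2) by rewrite ler_wpM2l.
have -> : P + t * H = - g by rewrite /g opprK.
lra.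
Qed.

Lemma spectrum_upper :
  (hausdorff_dim (lower_level kappa h) <= (h * t + P / ln 2)%:E)%E.
Proof.
have l2 : 0 < ln 2 :> R by rewrite ln_gt0// ltr1n.
rewrite /hausdorff_dim; case: ifPn => [_|/set0P[x lx]]; first exact: leNye.
have PH := lower_level_pressure_ge0 lx.
have v0 : 0 <= h * t + P / ln 2.
  rewrite (_ : _ + _ = (P + t * H) / ln 2); first by rewrite divr_ge0// ltW.
  by rewrite /H; field; rewrite gt_eqF.
apply/lee_addgt0Pr => d d0; rewrite -EFinD.
set s := _ + d; have s0 : 0 <= s by rewrite addr_ge0// ltW.
apply: ereal_inf_lbound; exists s => //; split => //.
(* The surplus [d] of the exponent yields a factor exp(-j g). The tolerance [e] uses up at most half
   of it, and the other half is the geometric ratio. *)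
pose g := d * ln 2; have g0 : 0 < g by rewrite mulr_gt0.
pose e := g / (2 * (`|t| + 1)).
have t1 : 0 < `|t| + 1 by rewrite ltr_wpDl.
have e0 : 0 < e by rewrite divr_gt0// mulr_gt0.
have te : `|t| * e <= g / 2.
  by rewrite /e mulrA ler_pdivrMr ?mulr_gt0//; lra.
apply: (@hausdorff_null _ _ _ (@good_words e) (expR (2 * `|t| * K)) (expR (- (g / 2)))) => //.
- by rewrite expR_gt0 expR_lt1 oppr_lt0 divr_gt0.
- move=> j; have -> : (2 ^+ j)^-1 `^ s = expR (- (j%:R * (s * ln 2))) :> R.
    rewrite /powR gt_eqF ?invr_gt0 ?exprn_gt0// lnV ?posrE ?exprn_gt0// lnXn//.
    by congr expR; ring.
  apply: le_trans (ler_wpM2r (expR_ge0 _) (good_words_count j (ltW e0))) _.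
  rewrite -expRM_natl -!expRD ler_expR.
  have -> : s * ln 2 = t * H + P + g.
    by rewrite /s /g /H; field; rewrite gt_eqF.
  have jte : j%:R * (`|t| * e) <= j%:R * (g / 2) by rewrite ler_wpM2l.
  by rewrite -/H; lra.
- by move=> y ly J; exact: good_words_cover.
Qed.

End spectrum_upper.

(** * Typical sequences *)

Section typical_sequences.
Variables (R : realType) (Omega : finType) (Z : Omega -> R).

(** From exp(-u) >= 1 - u one has exp(u) <= 1 / (1 - u), and (1 + u + 2 u^2)(1 - u) = 1 + u^2 (1 - 2
    u). *)
Lemma expR_le_quadratic (u : R) : u <= 1 / 2 -> expR u <= 1 + u + 2 * u ^+ 2.
Proof.
move=> u2; have h := expR_ge1Dx (- u).
have d0 : 0 < 1 - u by lra.
apply: (@le_trans _ _ (1 - u)^-1).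
  by rewrite -[expR u]invrK -expRN lef_pV2 ?posrE ?expR_gt0.
rewrite -[leLHS]mul1r ler_pdivrMr//.
have : 0 <= u ^+ 2 * (1 - 2 * u) by rewrite mulr_ge0 ?sqr_ge0//; lra.
rewrite !expr2; nra.
Qed.

Definition exp_sum t := \sum_(w : Omega) expR (t * Z w).

Lemma exp_sum_continuous : continuous exp_sum.
Proof.
rewrite /exp_sum; elim: (index_enum Omega) => [|w s IH] t.
  rewrite (_ : (fun t => _) = cst 0); first exact: cst_continuous.
  by apply/funext => u; rewrite big_nil.
rewrite (_ : (fun t => _) = (fun t => expR (t * Z w) + \sum_(v <- s) expR (t * Z v))).
  apply: (@continuousD R R R (fun t => expR (t * Z w))
    (fun t => \sum_(v <- s) expR (t * Z v)) t); last exact: IH.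
  apply: (@continuous_comp R R R (fun t => t * Z w) expR t).
    by apply: continuousM; [exact: cvg_id|exact: cst_continuous].
  exact: continuous_expR.
by apply/funext => u; rewrite big_cons.
Qed.

(** Coercivity: for |t| > T the lower bound A (1 + c |t|) already exceeds the value at 0, so the
    minimum over [-T, T] is global. *)
Lemma exp_sum_min A c : 0 < A -> 0 < c ->
  (forall t, A * expR (c * `|t|) <= exp_sum t) ->
  exists t0, forall t, exp_sum t0 <= exp_sum t.
Proof.
move=> A0 c0 coer.
pose T := exp_sum 0 / A / c.
have s0 : 0 <= exp_sum 0 by apply: sumr_ge0 => w _; exact: expR_ge0.
have T0 : 0 <= T by rewrite !divr_ge0// ltW.
have [|t0 t0T min] := @EVT_min R exp_sum (- T) T _ (continuous_subspaceT exp_sum_continuous).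
  by lra.
exists t0 => t; have [tT|Tt] := leP `|t| T.
  by apply: min; rewrite in_itv/= -ler_norml.
apply: (@le_trans _ _ (exp_sum 0)); first by apply: min; rewrite in_itv/=; lra.
apply: le_trans (coer t); rewrite mulrC -ler_pdivrMr//.
have : exp_sum 0 / A = c * T by rewrite /T; field; rewrite !gt_eqF.
move=> ->; have := expR_ge1Dx (c * `|t|).
have : c * T <= c * `|t| by rewrite ler_pM2l// ltW.
lra.
Qed.

(* If the linear coefficient [m1] of the expansion at the minimum were nonzero, a small step
   against its sign would decrease the sum. *)
Lemma exp_sum_near_min t0 : (forall t, exp_sum t0 <= exp_sum t) -> 0 < exp_sum t0 ->
  exists a b, [/\ 0 <= a, 0 < b & forall th, `|th| <= b ->
    exp_sum (t0 + th) <= exp_sum t0 * expR (a * th ^+ 2)].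
Proof.
move=> min P0; set Phi := exp_sum t0 in P0 *.
pose w x := expR (t0 * Z x).
pose m1 := \sum_x w x * Z x; pose m2 := \sum_x w x * (2 * Z x ^+ 2).
pose L := \sum_x `|Z x|.
have L0 : 0 <= L by apply: sumr_ge0.
have ZL x : `|Z x| <= L by rewrite /L (bigD1 x)//= lerDl sumr_ge0.
have m20 : 0 <= m2.
  by apply: sumr_ge0 => x _; rewrite mulr_ge0 ?expR_ge0// mulr_ge0 ?sqr_ge0.
(* Chosen so that [|th * Z x| <= 1 / 2], the range of the quadratic bound. *)
pose b := (2 * (L + 1))^-1.
have b0 : 0 < b by rewrite invr_gt0 mulr_gt0// ltr_wpDl.
have quad th : `|th| <= b -> exp_sum (t0 + th) <= Phi + th * m1 + th ^+ 2 * m2.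
  move=> thb.
  have -> : Phi + th * m1 + th ^+ 2 * m2 =
      \sum_x w x * (1 + th * Z x + 2 * (th * Z x) ^+ 2).
    rewrite /Phi /exp_sum /m1 /m2 !mulr_sumr -!big_split/=.
    by apply: eq_bigr => x _; rewrite -/(w x); ring.
  apply: ler_sum => x _; rewrite mulrDl expRD ler_pM2l ?expR_gt0//.
  apply: expR_le_quadratic; apply: le_trans (ler_norm _) _; rewrite normrM.
  apply: (@le_trans _ _ (b * L)); first by rewrite ler_pM.
  by rewrite /b mulrC ler_pdivrMr ?mulr_gt0 ?ltr_wpDl//; lra.
have m1_0 : m1 = 0.
  apply/eqP; apply/negPn/negP => m10.
  have m1n : 0 < `|m1| by rewrite normr_gt0.
  (* With this step the first-order gain [th * |m1|] exceeds the second-order loss [th ^+ 2 * m2] by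
     at least [th ^+ 2]. *)
  pose th := Num.min b (`|m1| / (m2 + 1)).
  have m21 : 0 < m2 + 1 by rewrite ltr_wpDl.
  have th0 : 0 < th by rewrite lt_min b0 divr_gt0.
  have thb : th <= b by rewrite ge_min lexx.
  have thm : th * (m2 + 1) <= `|m1|.
    by rewrite -ler_pdivlMr// ge_min lexx orbT.
  pose th' := - (Num.sg m1 * th).
  have th'b : `|th'| <= b.
    by rewrite normrN normrM normr_sg m10 mul1r (gtr0_norm th0).
  have := le_trans (min (t0 + th')) (quad th' th'b).
  have -> : th' * m1 = - (th * `|m1|).
    by rewrite normrEsg /th'; ring.
  have -> : th' ^+ 2 = th ^+ 2.
    by rewrite /th' sqrrN exprMn sqr_sg m10 mul1r.
  rewrite -/Phi -addrA lerDl expr2 -mulrA => h.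
  have : 0 <= th * (th * m2 - `|m1|) by lra.
  rewrite pmulr_rge0//; have : 0 < th by []; lra.
exists (m2 / Phi), b; split => //; first by rewrite divr_ge0// ltW.
move=> th /quad; rewrite m1_0 mulr0 addr0 => h; apply: le_trans h _.
have := expR_ge1Dx (m2 / Phi * th ^+ 2); rewrite -(ler_pM2l P0) => h; apply: le_trans h.
rewrite le_eqVlt; apply/orP; left; apply/eqP; field; rewrite gt_eqF//.
Qed.

Lemma prod_exp_sum n t :
  \sum_(f : {ffun 'I_n -> Omega}) expR (t * \sum_i Z (f i)) = exp_sum t ^+ n.
Proof.
rewrite /exp_sum -[n in RHS]card_ord -prodr_const bigA_distr_bigA/=.
apply: eq_bigr => f _.
by rewrite mulr_sumr expR_sum.
Qed.

(** Weigh a sequence by exp(t0 * sum Z), for a total of [Phi ^+ n]. Each one-sided deviation takes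
    at most a quarter of it, so typical sequences carry at least half; each weighs at most exp(n d /
    2), which bounds their number from below. Finally [A <= Phi]. *)
Lemma typical_sequences A c d : 0 < A -> 0 < c -> 0 < d ->
  (forall t, A * expR (c * `|t|) <= exp_sum t) ->
  exists N, forall n, (N <= n)%N ->
    A ^+ n * expR (- (n%:R * d)) <=
    #|[pred f : {ffun 'I_n -> Omega} | `|\sum_i Z (f i)| <= n%:R * d]|%:R.
Proof.
move=> A0 c0 d0 coer.
have [t0 min] := exp_sum_min A0 c0 coer.
have AP : A <= exp_sum t0.
  apply: le_trans (coer t0); rewrite ler_peMr ?(ltW A0)// -expR0 ler_expR.
  by rewrite mulr_ge0// ltW.
have P0 : 0 < exp_sum t0 by exact: lt_le_trans AP.
have [a [b [a0 b0 near]]] := exp_sum_near_min min P0.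
set Phi := exp_sum t0 in AP P0 near.
(* Small enough that the tilt by [t0] changes the weight of a typical sequence by a factor of at
   most exp(n d / 2). *)
pose d1 := d / (2 * (`|t0| + 1)).
have t1 : 0 < `|t0| + 1 by rewrite ltr_wpDl.
have d10 : 0 < d1 by rewrite divr_gt0 ?mulr_gt0.
have td1 : `|t0| * d1 <= d / 2.
  by rewrite /d1 mulrA ler_pdivrMr ?mulr_gt0//; have := normr_ge0 t0; nra.
have d1d : d1 <= d.
  rewrite /d1 ler_pdivrMr ?mulr_gt0//; have := normr_ge0 t0; nra.
(* The Chernoff exponent per letter, [- th * d1 + a * th ^+ 2], is then at most [- be]. *)
pose th := Num.min b (d1 / (2 * (a + 1))).
have a1 : 0 < a + 1 by rewrite ltr_wpDl.
have th0 : 0 < th by rewrite lt_min b0 divr_gt0// mulr_gt0.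
have thb : `|th| <= b by rewrite gtr0_norm// ge_min lexx.
have tha : a * th <= d1 / 2.
  have : th * (2 * (a + 1)) <= d1.
    by rewrite -ler_pdivlMr ?mulr_gt0// ge_min lexx orbT.
  lra.
pose be := th * d1 / 2.
have be0 : 0 < be by rewrite divr_gt0// mulr_gt0.
(* [N1] brings each tail below a quarter; [N2] absorbs the factor 1/2 of the weight kept. *)
have [N1 [_ hN1]] := exists_scale (ln 4) be0.
have [N2 [_ hN2]] := exists_scale (ln 2) (divr_gt0 d0 (ltr0Sn R 1)).
exists (maxn N1 N2) => n Nn.
have n1 := hN1 n (leq_trans (leq_maxl _ _) Nn).
have n2 := hN2 n (leq_trans (leq_maxr _ _) Nn).
pose Zn (f : {ffun 'I_n -> Omega}) := \sum_i Z (f i).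
have tail (sg : R) : `|sg| = 1 ->
    \sum_(f : {ffun 'I_n -> Omega} | n%:R * d1 < sg * Zn f) expR (t0 * Zn f) <= Phi ^+ n / 4.
  move=> sg1.
  apply: (@le_trans _ _ (expR (- (th * (n%:R * d1))) * exp_sum (t0 + sg * th) ^+ n)).
    rewrite -prod_exp_sum mulr_sumr big_mkcond/=; apply: ler_sum => f _.
    case: ifPn => [h|_]; last by rewrite mulr_ge0 ?expR_ge0.
    rewrite -expRD ler_expR -/(Zn f).
    have : th * (n%:R * d1) <= th * (sg * Zn f) by rewrite ler_pM2l// ltW.
    by lra.
  have thsg : `|sg * th| <= b by rewrite normrM sg1 mul1r.
  have sg2 : (sg * th) ^+ 2 = th ^+ 2.
    by rewrite exprMn -real_normK ?num_real// sg1 expr1n mul1r.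
  apply: (@le_trans _ _ (expR (- (th * (n%:R * d1))) * (Phi * expR (a * th ^+ 2)) ^+ n)).
    rewrite ler_wpM2l ?expR_ge0// lerXn2r ?nnegrE//.
    - by apply: sumr_ge0 => x _; exact: expR_ge0.
    - by rewrite mulr_ge0 ?expR_ge0// ltW.
    - by rewrite -sg2; exact: near.
  rewrite exprMn mulrCA ler_pM2l ?exprn_gt0// -expRM_natl -expRD.
  rewrite -[4^-1]lnK ?posrE// ler_expR lnV ?posrE//.
  have : n%:R * (th * (a * th)) <= n%:R * (th * (d1 / 2)).
    by rewrite ler_wpM2l// ler_pM2l.
  move: n1; rewrite /be expr2; lra.
pose good1 := [pred f : {ffun 'I_n -> Omega} | `|Zn f| <= n%:R * d1].
have split_sum : Phi ^+ n <= \sum_(f in good1) expR (t0 * Zn f) +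
     (Phi ^+ n / 4 + Phi ^+ n / 4).
  have h1 := tail 1 (normr1 _).
  have h2 := tail (-1) (normrN1 _).
  apply: le_trans _ (lerD (lexx _) (lerD h1 h2)).
  rewrite -prod_exp_sum [X in _ <= X + _]big_mkcond/= [X in _ <= _ + (X + _)]big_mkcond/=.
  rewrite [X in _ <= _ + (_ + X)]big_mkcond/= -!big_split/=.
  apply: ler_sum => f _; rewrite inE/= mul1r mulN1r -/(Zn f).
  have e0 := expR_ge0 (t0 * Zn f).
  case: ifPn => [_|]; first by rewrite lerDl addr_ge0//; case: ifP.
  rewrite -ltNge ltr_normr => /orP[|] ->; first by rewrite add0r lerDl; case: ifP.
  by rewrite add0r lerDr; case: ifP.
have good_sum : \sum_(f in good1) expR (t0 * Zn f) <=
    #|good1|%:R * expR (n%:R * (d / 2)).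
  rewrite mulr_natl -sumr_const; apply: ler_sum => f; rewrite inE => fg.
  rewrite ler_expR; apply: le_trans (ler_norm _) _; rewrite normrM.
  apply: (@le_trans _ _ (`|t0| * (n%:R * d1))); first by rewrite ler_wpM2l.
  by rewrite mulrCA ler_wpM2l.
pose good := [pred f : {ffun 'I_n -> Omega} | `|\sum_i Z (f i)| <= n%:R * d].
have sub : (#|good1| <= #|good|)%N.
  apply: subset_leq_card; apply/fintype.subsetP => f; rewrite !inE => h.
  by apply: le_trans h _; rewrite ler_wpM2l.
apply: (@le_trans _ _ #|good1|%:R); last by rewrite ler_nat.
have half : Phi ^+ n / 2 <= #|good1|%:R * expR (n%:R * (d / 2)).
  by apply: le_trans good_sum; lra.
rewrite -ler_pdivrMr ?expR_gt0// -expRN in half; apply: le_trans half.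
rewrite -mulrA ler_pM ?exprn_ge0 ?expR_ge0 ?(ltW A0)//.
  by rewrite lerXn2r ?nnegrE// ltW.
by rewrite -[X in _ <= X * _](@lnK _ 2^-1) ?posrE// -expRD ler_expR lnV ?posrE//; lra.
Qed.

End typical_sequences.

Section good_blocks.
Variables (R : realType) (m : nat) (psi : 'rV[R]_m -> R) (K H q : R).
Hypothesis tpsi : tame psi K.
Hypothesis hq : forall t j,
  expR (j%:R * (q - t * H) - `|t| * K) <= partition_sum (fun x => - t * psi x) j.

Definition good_block L e (u : 'rV['I_(2 ^ L)]_m) :=
  `|birkhoff_sum psi L (corner R u) - L%:R * H| <= L%:R * e.

Lemma cat_words n j : exists F : {ffun 'I_n -> 'rV['I_(2 ^ j)]_m} -> 'rV['I_(2 ^ (n * j))]_m,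
  injective F /\ forall f, `|birkhoff_sum psi (n * j) (corner R (F f)) -
    \sum_i birkhoff_sum psi j (corner R (f i))| <= n%:R * K.
Proof.
elim: n => [|n [F [Finj FK]]].
  exists (fun=> word0 m (0 * j)); split => [f f' _|f].
    by apply/ffunP => -[].
  by rewrite big_ord0 mul0r subr0 /birkhoff_sum big_ord0 normr0.
pose tl (f : {ffun 'I_n.+1 -> 'rV['I_(2 ^ j)]_m}) : {ffun 'I_n -> 'rV['I_(2 ^ j)]_m} :=
  [ffun i => f (lift ord0 i)].
(* [n.+1 * j] and [j + n * j] are convertible, so a type ascription suffices for the dependent
   length. *)
exists (fun f : {ffun 'I_n.+1 -> 'rV['I_(2 ^ j)]_m} => catw (f ord0) (F (tl f)) : 'rV['I_(2 ^ (n.+1 * j))]_m).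
split=> [f f' e|f].
  have := bij_inj (@catw_bij m j (n * j)) (x1 := (f ord0, F (tl f))) (x2 := (f' ord0, F (tl f'))) e.
  case=> e0 /Finj e1; apply/ffunP => i; case: (unliftP ord0 i) => [i'|] -> //.
  by have := congr1 (fun g : {ffun _ -> _} => g i') e1; rewrite !ffunE.
rewrite big_ord_recl -natr1.
have h1 := birkhoff_cat (f ord0) (F (tl f)) tpsi.
have h2 := FK (tl f).
have -> : \sum_(i < n) birkhoff_sum psi j (corner R (f (lift ord0 i))) =
    \sum_(i < n) birkhoff_sum psi j (corner R (tl f i)).
  by apply: eq_bigr => i _; rewrite ffunE.
have {}h1 : `|birkhoff_sum psi (n.+1 * j) (corner R (catw (f ord0) (F (tl f)))) -
    (birkhoff_sum psi j (corner R (f ord0)) + birkhoff_sum psi (n * j) (corner R (F (tl f))))|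
    <= K by exact: h1.
move: h1 h2; rewrite !ler_norml => /andP[? ?] /andP[? ?].
by apply/andP; split; lra.
Qed.

(** Typical sequences over the alphabet of words of length j, once concatenated, are good blocks.
    Hypothesis [hq] supplies the coercivity with A = exp(j q) and c = 1, since the offset K + 1
    outweighs the loss [|t| K] by [|t|]. *)
Lemma good_blocks e : 0 < e -> exists L, [/\ 1 <= L%:R * e &
  expR (L%:R * (q - e)) <= #|@good_block L e|%:R].
Proof.
move=> e0; have K0 := tame_ge0 tpsi.
have [j [j0 hj]] := exists_scale (3 + 2 * K) e0.
(* Per word, goodness costs [K] for concatenation, [K + 1] for the offset and 1 for typicality; the
   count loses 1 for typicality and ln 2 for the signs. Both fit into [3 + 2 * K <= j e]. *)
have {}hj := hj j (leqnn j).
pose Omega := ('rV['I_(2 ^ j)]_m * bool)%type.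
(* Both signs of the offset [K + 1] are allowed, which forces the exponential sum to grow at
   infinity even if [H] is an end point of the spectrum. *)
pose Z (w : Omega) := - (birkhoff_sum psi j (corner R w.1) - j%:R * H) +
  (if w.2 then K + 1 else - (K + 1)).
have coer t : expR (j%:R * q) * expR (1 * `|t|) <= exp_sum Z t.
  rewrite /exp_sum -(pair_bigA _ (fun u b => expR (t * Z (u, b))))/=.
  apply: (@le_trans _ _ (expR (t * (j%:R * H) + `|t| * (K + 1)) *
     partition_sum (fun x => - t * psi x) j)).
    apply: le_trans (ler_wpM2l (expR_ge0 _) (hq t j)).
    by rewrite -!expRD ler_expR; lra.
  rewrite /partition_sum mulr_sumr; apply: ler_sum => u _.
  rewrite -expRD birkhoff_scale big_bool/= /Z /=.
  set S := birkhoff_sum _ _ _.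
  have [t0|t0] := leP 0 t.
    apply: (@le_trans _ _ (expR (t * (- (S - j%:R * H) + (K + 1))))).
      by rewrite ler_expR ger0_norm//; lra.
    by rewrite lerDl expR_ge0.
  apply: (@le_trans _ _ (expR (t * (- (S - j%:R * H) - (K + 1))))).
    by rewrite ler_expR ltr0_norm//; lra.
  by rewrite lerDr expR_ge0.
have [N hN] := typical_sequences (expR_gt0 (j%:R * q)) (@ltr01 R) (@ltr01 R) coer.
pose n := maxn N 1.
have n1 : (0 < n)%N by rewrite leq_max orbT.
have {}hN := hN n (leq_maxl _ _).
have n1R : 1 <= n%:R :> R by rewrite ler1n.
have hn : n%:R * (3 + 2 * K) <= n%:R * (j%:R * e) by rewrite ler_wpM2l.
exists (n * j)%N; rewrite natrM -!mulrA; split.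
  have : n%:R * 1 <= n%:R * (3 + 2 * K) by rewrite ler_wpM2l//; lra.
  lra.
have [F [Finj FK]] := cat_words n j.
set good := [pred f : {ffun 'I_n -> Omega} | _] in hN.
pose w (f : {ffun 'I_n -> Omega}) : {ffun 'I_n -> 'rV['I_(2 ^ j)]_m} := [ffun i => (f i).1].
pose sg (f : {ffun 'I_n -> Omega}) : {ffun 'I_n -> bool} := [ffun i => (f i).2].
(* Keeping the signs makes the map injective; forgetting them divides the count by at most 2^n. *)
pose PH (f : {ffun 'I_n -> Omega}) := (F (w f), sg f).
have PHinj : injective PH.
  move=> f f' [/Finj e1 e2]; apply/ffunP => i.
  have := congr1 (fun g : {ffun _ -> _} => g i) e1.
  have := congr1 (fun g : {ffun _ -> _} => g i) e2.
  by rewrite !ffunE; case: (f i) => ? ?; case: (f' i) => ? ? /= -> ->.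
have PHgood f : good f -> good_block e (F (w f)).
  rewrite /good/= mulr1 => gf; rewrite /good_block natrM.
  have h1 := FK (w f).
  have h2 : `|\sum_i Z (f i) + (\sum_i birkhoff_sum psi j (corner R (w f i)) - n%:R * (j%:R * H))|
      <= n%:R * (K + 1).
    have -> : n%:R * (j%:R * H) = \sum_(i < n) j%:R * H :> R.
      by rewrite big_const_ord iter_addr_0 mulr_natl.
    have -> : n%:R * (K + 1) = \sum_(i < n) (K + 1) :> R.
      by rewrite big_const_ord iter_addr_0 mulr_natl.
    rewrite -sumrB -big_split/= (le_trans (ler_norm_sum _ _ _))//; apply: ler_sum => i _.
    rewrite /Z ffunE addrAC addNr add0r; case: ifP => _; rewrite ?normrN ger0_norm//; lra.
  move: gf h1 h2; rewrite !ler_norml => /andP[? ?] /andP[? ?] /andP[? ?].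
  by apply/andP; split; lra.
have cnt : (#|good| <= #|@good_block (n * j) e| * 2 ^ n)%N.
  rewrite -(card_in_image (f := PH) (A := good)); last by move=> ? ? _ _; exact: PHinj.
  have -> : (2 ^ n)%N = #|{: {ffun 'I_n -> bool}}| by rewrite card_ffun card_bool card_ord.
  rewrite -cardX; apply: subset_leq_card; apply/fintype.subsetP => p /fintype.imageP[f gf ->].
  by rewrite inE /= andbT; exact: PHgood.
have {}hN : expR (j%:R * q) ^+ n * expR (- n%:R) <= #|@good_block (n * j) e|%:R * 2 ^+ n.
  move: hN; rewrite mulr1 => hN; apply: le_trans hN _.
  by rewrite -natrX -natrM ler_nat.
rewrite -ler_pdivrMr ?exprn_gt0// in hN; apply: le_trans hN.
have l2 : ln 2 <= 1 :> R.
  rewrite -[leRHS]expRK ler_ln ?posrE ?expR_gt0//.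
  by have := @expR_ge1Dx R 1; lra.
rewrite -[X in _ / X ^+ n](@lnK _ 2) ?posrE// -!expRM_natl -expRN -!expRD ler_expR.
have : n%:R * ln 2 <= n%:R * 1 :> R by rewrite ler_wpM2l.
have : 0 <= n%:R * K by rewrite mulr_ge0.
lra.
Qed.

End good_blocks.

(** * The Moran set *)

Lemma rV_subE (R : realType) m (x y : 'rV[R]_m) c :
  (x - y) ord0 c = x ord0 c - y ord0 c.
Proof. by rewrite !mxE. Qed.

Lemma truncn_divn (R : realType) (z : R) N : 0 <= z -> (0 < N)%N ->
  (Num.truncn (z * N%:R) %/ N)%N = Num.truncn z.
Proof.
move=> z0 N0; have zN0 : 0 <= z * N%:R by rewrite mulr_ge0.
have NR : 0 < N%:R :> R by rewrite ltr0n.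
have /andP[a1 a2] := truncn_itv z0; have /andP[t1 t2] := truncn_itv zN0.
set a := Num.truncn z in a1 a2 *; set t := Num.truncn _ in t1 t2 *.
have h1 : (a * N <= t)%N.
  by rewrite -ltnS -(ltr_nat R) natrM (le_lt_trans _ t2)// ler_pM2r.
have h2 : (t < a.+1 * N)%N.
  by rewrite -(ltr_nat R) natrM (le_lt_trans t1)// ltr_pM2r.
apply/eqP; rewrite eqn_leq; apply/andP; split.
  by rewrite -ltnS ltn_divLR.
by rewrite leq_divRL.
Qed.

Section moran_set.
Variables (R : realType) (m : nat) (psi : 'rV[R]_m -> R) (K M H q : R).
Hypotheses (tpsi : tame psi K) (psiM : forall x, `|psi x| <= M).
Variables (L : nat -> nat) (eps : nat -> R).
(** By [L_ge], a bounded cost per block, such as that of the separating digit, is of the order of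
    the tolerance [L i * eps i]. By [L_le], a single block is negligible against those before it. *)
Hypotheses (eps_gt0 : forall i, 0 < eps i)
  (L_ge : forall i, 1 <= (L i)%:R * eps i)
  (good_card : forall i, expR ((L i)%:R * (q - eps i)) <=
    #|@good_block R m psi H (L i) (eps i)|%:R)
  (eps_cvg : forall e, 0 < e -> exists I, forall i, (I <= i)%N -> eps i <= e)
  (L_le : forall i, (L i)%:R <= eps i * (i%:R + (L i)%:R)).

Definition blocks i := enum (@good_block R m psi H (L i) (eps i)).
Definition nblocks i := size (blocks i).
(* A block of length [L k] is preceded by one zero digit, hence the successor: distinct blocks
   then lead to points separated by half a cell in sup norm. *)
Definition depth i := (\sum_(k < i) (L k).+1)%N.
(* The point of parameter [y] in [0, 1) follows the digits of [y] in the mixed radix system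
   whose radices are the numbers of available blocks. *)
Definition count_blocks i := (\prod_(k < i) nblocks k)%N.
Definition digit i (y : R) := (Num.truncn (y * (count_blocks i.+1)%:R) %% nblocks i)%N.
Definition block i (y : R) := nth (word0 m (L i)) (blocks i) (digit i y).

Fixpoint moran_index (y : R) i : 'rV[int]_m :=
  if i is i'.+1 then 2 ^+ (L i').+1 *: moran_index y i' + wordZ (block i' y) else 0.

Definition moran_node y i : 'rV[R]_m := node R (depth i) (moran_index y i).

(** The nodes increase in each coordinate, so this supremum is their limit. *)
Definition moran_point y : 'rV[R]_m :=
  \row_c sup [set moran_node y i ord0 c | i in [set: nat]].

Lemma depthS i : depth i.+1 = (depth i + (L i).+1)%N.
Proof. by rewrite /depth big_ord_recr. Qed.

Lemma nblocksE i : (nblocks i)%:R = #|@good_block R m psi H (L i) (eps i)|%:R :> R.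
Proof. by rewrite /nblocks /blocks -cardE. Qed.

Lemma nblocks_gt0 i : (0 < nblocks i)%N.
Proof. by rewrite -(ltr0n R) nblocksE; apply: lt_le_trans (good_card i); rewrite expR_gt0. Qed.

Lemma block_good i y : `|birkhoff_sum psi (L i) (corner R (block i y)) - (L i)%:R * H|
  <= (L i)%:R * eps i.
Proof.
have : block i y \in blocks i by rewrite mem_nth// ltn_mod nblocks_gt0.
by rewrite mem_enum.
Qed.

Lemma moran_nodeS y i c : moran_node y i.+1 ord0 c =
  moran_node y i ord0 c + (block i y ord0 c)%:R / 2 ^+ depth i.+1.
Proof.
rewrite /moran_node /= !mxE depthS rmorphD rmorphM rmorphXn/= exprD.
rewrite -[((block i y ord0 c)%:Z)%:~R]/((block i y ord0 c)%:R).
by field; rewrite !expf_neq0.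
Qed.

Let p2 j : 0 < 2 ^+ j :> R. Proof. by rewrite exprn_gt0. Qed.

(** The zero digit that precedes the next block keeps all later nodes in the lower half of the
    cell. *)
Let gap i : R := (2 ^+ depth i)^-1 / 2.

Lemma moran_step y i c : moran_node y i ord0 c <= moran_node y i.+1 ord0 c /\
  moran_node y i.+1 ord0 c + gap i.+1 <= moran_node y i ord0 c + gap i.
Proof.
rewrite moran_nodeS; split; first by rewrite lerDl divr_ge0// ltW.
rewrite -addrA lerD2l /gap depthS exprD (exprS 2 (L i)).
have -> : (2 ^+ depth i)^-1 / 2 = 2 ^+ L i / (2 ^+ depth i * (2 * 2 ^+ L i)) :> R.
  by field; rewrite !expf_neq0.
rewrite [X in _ + X <= _]mulrC -mulrDl ler_pM2r ?invr_gt0 ?mulr_gt0//.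
have : (block i y ord0 c).+1%:R <= 2 ^+ L i :> R by rewrite -natrX ler_nat.
by rewrite -natr1; lra.
Qed.

Lemma moran_node_mono y c i k : moran_node y i ord0 c <= moran_node y (i + k) ord0 c /\
  moran_node y (i + k) ord0 c + gap (i + k) <= moran_node y i ord0 c + gap i.
Proof.
elim: k => [|k [IH1 IH2]]; first by rewrite addn0.
rewrite addnS; have [h1 h2] := moran_step y (i + k) c.
by split; [exact: le_trans h1|exact: le_trans IH2].
Qed.

Lemma moran_node_le y c i k : moran_node y k ord0 c <= moran_node y i ord0 c + gap i.
Proof.
have g0 j : 0 <= gap j by rewrite /gap divr_ge0// invr_ge0 ltW.
have [ik|ki] := leqP i k.
  by rewrite -(subnKC ik); have [_] := moran_node_mono y c i (k - i); have := g0 (i + (k - i))%N; lra.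
by rewrite -(subnKC (ltnW ki)); have [h _] := moran_node_mono y c k (i - k);
  have := g0 (k + (i - k))%N; lra.
Qed.

Lemma moran_point_bounds y i c :
  moran_node y i ord0 c <= moran_point y ord0 c <= moran_node y i ord0 c + (2 ^+ depth i)^-1 / 2.
Proof.
have -> : moran_point y ord0 c = sup [set moran_node y i ord0 c | i in [set: nat]].
  by rewrite [LHS]mxE.
apply/andP; split.
  apply: ub_le_sup; last by exists i.
  by exists (moran_node y 0 ord0 c + gap 0) => _ [k _ <-]; exact: moran_node_le.
apply: ge_sup; first by exists (moran_node y 0 ord0 c); exists 0%N.
by move=> _ [k _ <-]; exact: moran_node_le.
Qed.

Lemma moran_point_cube y : cube (moran_point y).
Proof.
move=> c; have := moran_point_bounds y 0 c.
have -> : moran_node y 0 ord0 c = 0 by rewrite !mxE mulr0.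
by rewrite /depth big_ord0 expr0 invr1 => /andP[? ?]; apply/andP; split; lra.
Qed.

Lemma moran_near_node y i : `|moran_point y - moran_node y i| <= 8 / 2 ^+ depth i.
Proof.
apply/rV_norm_leP => [|c]; first by rewrite divr_ge0// ltW.
rewrite rV_subE.
have := moran_point_bounds y i c.
have : 0 < (2 ^+ depth i)^-1 :> R by rewrite invr_gt0.
by move=> ? /andP[? ?]; rewrite ger0_norm; lra.
Qed.

Let K0 : 0 <= K. Proof. exact: tame_ge0 tpsi. Qed.
Let M0 : 0 <= M. Proof. exact: le_trans (normr_ge0 _) (psiM 0). Qed.
Let D := K + M + `|H| + 1.

(** A new block costs [K] for moving the node, [M + |H|] for the zero digit and [L i * eps i] for
    the block itself; as [L i * eps i >= 1], the sum is at most [D] times that product. *)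
Lemma moran_node_birkhoff y i :
  `|birkhoff_sum psi (depth i) (moran_node y i) - (depth i)%:R * H| <=
  D * \sum_(k < i) (L k)%:R * eps k.
Proof.
have [per dis] := tpsi.
elim: i => [|i IH].
  by rewrite /depth !big_ord0 /birkhoff_sum big_ord0 mul0r subr0 normr0 mulr0.
rewrite big_ord_recr/= mulrDr.
(* Modulo periods the orbit arrives at half the corner of the block: the factor 1/2 is the zero
   digit. *)
have scaleE : 2 ^+ depth i *: moran_node y i.+1 =
    2^-1 *: corner R (block i y) + map_mx intr (moran_index y i).
  apply/rowP => c; rewrite mxE moran_nodeS !mxE depthS exprD (exprS 2 (L i)).
  by field; rewrite !expf_neq0.
have half : 2 ^+ 1 *: (2^-1 *: corner R (block i y)) = corner R (block i y).
  by rewrite scalerA expr1 mulfV// scale1r.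
have nodeE : birkhoff_sum psi (depth i.+1) (moran_node y i.+1) =
    birkhoff_sum psi (depth i) (moran_node y i.+1) +
    (psi (2^-1 *: corner R (block i y)) + birkhoff_sum psi (L i) (corner R (block i y))).
  rewrite depthS birkhoff_sumD scaleE (birkhoff_periodic _ per) -add1n.
  by rewrite (birkhoff_sumD _ 1) half {2}/birkhoff_sum big_ord1 expr0 scale1r.
have near : `|birkhoff_sum psi (depth i) (moran_node y i.+1) -
    birkhoff_sum psi (depth i) (moran_node y i)| <= K.
  apply: dis; apply/rV_norm_leP => [|c]; first by rewrite divr_ge0// ltW.
  rewrite rV_subE.
  have [h1 h2] := moran_step y i c.
  have : 0 < (2 ^+ depth i)^-1 :> R by rewrite invr_gt0.
  have : 0 <= gap i.+1 by rewrite /gap divr_ge0// invr_ge0 ltW.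
  by move: h2; rewrite /gap => ? ? ?; rewrite ger0_norm; lra.
have gb := block_good i y.
have pm := psiM (2^-1 *: corner R (block i y)).
have hD : K + M + `|H| + (L i)%:R * eps i <= D * ((L i)%:R * eps i).
  rewrite /D mulrDl mul1r lerD2r ler_peMr//.
  by rewrite addr_ge0// addr_ge0.
rewrite nodeE depthS natrD -natr1.
have hH := lexx `|H|; rewrite ler_norml in hH.
move: IH near gb pm hH; rewrite !ler_norml.
by move=> /andP[? ?] /andP[? ?] /andP[? ?] /andP[? ?] /andP[? ?]; apply/andP; split; lra.
Qed.

Let Lam n : R := \sum_(k < n) (L k)%:R.

Lemma L_gt0 i : (0 < L i)%N.
Proof.
rewrite lt0n; apply/negP => /eqP Li; have := L_ge i.
by rewrite Li mul0r; lra.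
Qed.

(** A weighted Cesaro mean: the finitely many large tolerances go into [c]. *)
Lemma sum_eps_small e : 0 < e -> exists c, 0 <= c /\ forall n,
  \sum_(k < n) (L k)%:R * eps k <= e * Lam n + c.
Proof.
move=> e0; have [I hI] := eps_cvg e0.
exists (\sum_(k < I) (L k)%:R * eps k).
have t0 k : 0 <= (L k)%:R * eps k by rewrite mulr_ge0// ltW.
split; first by apply: sumr_ge0.
elim=> [|n IH]; first by rewrite /Lam !big_ord0 mulr0 add0r sumr_ge0.
have [In|nI] := leqP I n.
  rewrite /Lam !big_ord_recr/= mulrDr -/(Lam n).
  have : (L n)%:R * eps n <= (L n)%:R * e by rewrite ler_wpM2l// hI.
  by lra.
rewrite -(subnKC nI) big_split_ord/=.
have h1 : 0 <= \sum_(i < I - n.+1) (L (n.+1 + i)%N)%:R * eps (n.+1 + i)%N.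
  by apply: sumr_ge0.
have : 0 <= e * Lam n.+1 by rewrite mulr_ge0 ?(ltW e0)// sumr_ge0.
by lra.
Qed.

Lemma le_Lam n : n%:R <= Lam n.
Proof.
elim: n => [|n IH]; first by rewrite /Lam big_ord0.
rewrite /Lam big_ord_recr/= -natr1 lerD// ler1n; exact: L_gt0.
Qed.

Lemma L_small e : 0 < e -> exists c, 0 <= c /\ forall n, (L n)%:R <= e * Lam n + c.
Proof.
move=> e0; have e1 : 0 < 1 + e by lra.
(* Since [n <= Lam n], [L_le] bounds [L n] by x / (1 - x) times [Lam n] for x = [eps n], and x = e /
   (1 + e) gives the factor e. *)
have [I hI] := eps_cvg (divr_gt0 e0 e1).
exists (\sum_(k < I) (L k)%:R); split; first by apply: sumr_ge0.
move=> n; have [In|nI] := leqP I n.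
  have := hI n In; rewrite ler_pdivlMr// => hn.
  have h1 := L_le n; have h2 := le_Lam n.
  have hL : 0 <= (L n)%:R :> R by [].
  have h3 : (L n)%:R * (eps n * (1 + e)) <= (L n)%:R * e by rewrite ler_wpM2l.
  have h4 : n%:R * (eps n * (1 + e)) <= n%:R * e by rewrite ler_wpM2l.
  have h5 : (L n)%:R * (1 + e) <= eps n * (n%:R + (L n)%:R) * (1 + e) by rewrite ler_pM2r.
  have h6 : e * n%:R <= e * Lam n by rewrite ler_pM2l.
  have : 0 <= \sum_(k < I) (L k)%:R :> R by apply: sumr_ge0.
  by lra.
rewrite (bigD1 (Ordinal nI))//=.
have : 0 <= \sum_(i < I | i != Ordinal nI) (L i)%:R :> R by apply: sumr_ge0.
have : 0 <= e * Lam n by rewrite mulr_ge0 ?(ltW e0)// sumr_ge0.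
by lra.
Qed.

Lemma depth_Lam n : (depth n)%:R = Lam n + n%:R :> R.
Proof.
rewrite /depth /Lam; elim: n => [|n IH]; first by rewrite !big_ord0 addr0.
by rewrite !big_ord_recr/= natrD IH -!natr1; ring.
Qed.

Lemma depth_find j : exists i, (depth i <= j < depth i.+1)%N.
Proof.
have ex : exists i, (depth i <= j)%N by exists 0%N; rewrite /depth big_ord0.
have ub i : (depth i <= j)%N -> (i <= j)%N.
  apply: leq_trans; rewrite -(ler_nat R) depth_Lam lerDr; exact: sumr_ge0.
have [i ij imax] := ex_maxnP ex ub.
exists i; rewrite ij/= ltnNge; apply/negP => /imax; by rewrite ltnn.
Qed.

(** Compare with the last node before j. The complete blocks and the unfinished one, of at most
    [L i + 1] digits costing [M + |H|] each, get a share e / 4 each; the constants get e / 2. *)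
Lemma moran_birkhoff y e : 0 < e -> exists J, forall j, (J <= j)%N ->
  `|birkhoff_sum psi j (moran_point y) - j%:R * H| <= j%:R * e.
Proof.
move=> e0; have [per dis] := tpsi.
have D0 : 0 < D by have := K0; have := M0; have := normr_ge0 H; rewrite /D; lra.
have MH : 0 <= M + `|H| by rewrite addr_ge0.
have [c1 [c10 h1]] := sum_eps_small (divr_gt0 e0 (mulr_gt0 (ltr0Sn R 3) D0)).
have e2 : 0 < e / (4 * (M + `|H| + 1)) by rewrite divr_gt0// mulr_gt0// ltr_wpDl.
have [c2 [c20 h2]] := L_small e2.
have e4 : 0 < e / 2 by rewrite divr_gt0.
have [J [_ hJ]] := exists_scale (D * c1 + K + (M + `|H|) * (c2 + 1)) e4.
exists J => j Jj; have {}hJ := hJ j Jj.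
have [i /andP[ij ji]] := depth_find j.
have S1 := moran_node_birkhoff y i.
have S2 : `|birkhoff_sum psi (depth i) (moran_point y) - birkhoff_sum psi (depth i) (moran_node y i)| <= K.
  by apply: dis; exact: moran_near_node.
pose k := (j - depth i)%N.
have jE : j = (depth i + k)%N by rewrite subnKC.
have kL : k%:R <= (L i)%:R + 1 :> R.
  by rewrite natr1 ler_nat leq_subLR -depthS ltnW.
have S3 := birkhoff_bounded k (2 ^+ depth i *: moran_point y) psiM.
have LamJ : Lam i <= j%:R.
  by apply: (@le_trans _ _ (depth i)%:R); [rewrite depth_Lam lerDl|rewrite ler_nat].
have Lam0 : 0 <= Lam i by apply: sumr_ge0.
have B1 : D * \sum_(n < i) (L n)%:R * eps n <= e / 4 * j%:R + D * c1.
  apply: (@le_trans _ _ (D * (e / (4 * D) * Lam i + c1))); first by rewrite ler_pM2l.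
  rewrite mulrDr lerD2r mulrA (_ : D * _ = e / 4); last by field; rewrite gt_eqF.
  by rewrite ler_wpM2l// divr_ge0// ltW.
have B2 : (M + `|H|) * k%:R <= e / 4 * j%:R + (M + `|H|) * (c2 + 1).
  apply: (@le_trans _ _ ((M + `|H|) * (e / (4 * (M + `|H| + 1)) * Lam i + (c2 + 1)))).
    by rewrite ler_wpM2l// (le_trans kL)// addrA lerD2r.
  rewrite mulrDr lerD2r mulrA; apply: ler_pM => //.
    by rewrite mulr_ge0// ltW.
  rewrite mulrA ler_pdivrMr ?mulr_gt0 ?ltr_wpDl//.
  by lra.
have kH : `|k%:R * H| <= k%:R * `|H| by rewrite normrM ger0_norm.
rewrite {1}jE birkhoff_sumD jE natrD.
rewrite {1 2 3}jE natrD in hJ B1 B2.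
move: S1 S2 S3 kH; rewrite !ler_norml => /andP[? ?] /andP[? ?] /andP[? ?] /andP[? ?].
by apply/andP; split; lra.
Qed.

Lemma count_blocksS n : count_blocks n.+1 = (count_blocks n * nblocks n)%N.
Proof. by rewrite /count_blocks big_ord_recr. Qed.

Lemma count_blocks_gt0 n : (0 < count_blocks n)%N.
Proof. by apply: prodn_gt0 => k; exact: nblocks_gt0. Qed.

(** The first n digits determine the integer part of [y * count_blocks n]; [truncn_divn] drops the
    last digit in the induction. *)
Lemma digits_close y y' n : 0 <= y < 1 -> 0 <= y' < 1 ->
  (forall i, (i < n)%N -> digit i y = digit i y') ->
  `|y - y'| * (count_blocks n)%:R <= 1.
Proof.
move=> /andP[y0 y1] /andP[y'0 y'1] dig.
have tr : Num.truncn (y * (count_blocks n)%:R) = Num.truncn (y' * (count_blocks n)%:R).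
  elim: n dig => [|n IH] dig.
    have tr0 (z : R) : 0 <= z -> z < 1 -> Num.truncn z = 0%N.
      move=> z0 z1; have /andP[h _] := truncn_itv z0.
      by apply/eqP; rewrite -leqn0 -ltnS -(ltr_nat R) (le_lt_trans h).
    by rewrite /count_blocks big_ord0 !mulr1 !tr0.
  rewrite (divn_eq (Num.truncn (y * _)) (nblocks n)) [RHS](divn_eq _ (nblocks n)).
  rewrite -!/(digit n _) dig//; congr (_ * _ + _)%N.
  rewrite count_blocksS natrM !mulrA !truncn_divn ?nblocks_gt0 ?mulr_ge0//.
  by apply: IH => i ni; apply: dig; rewrite ltnS ltnW.
have c0 : 0 <= y * (count_blocks n)%:R by rewrite mulr_ge0.
have c0' : 0 <= y' * (count_blocks n)%:R by rewrite mulr_ge0.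
have /andP[a1 a2] := truncn_itv c0; have /andP[b1 b2] := truncn_itv c0'.
rewrite -tr -natr1 in b1 b2; rewrite -natr1 in a2.
rewrite -[X in _ * X]ger0_norm// -normrM mulrBl ler_norml.
by apply/andP; split; lra.
Qed.

Lemma moran_index_eq y y' n :
  (forall i, (i < n)%N -> digit i y = digit i y') -> moran_index y n = moran_index y' n.
Proof.
elim: n => //= n IH dig; rewrite IH; last by move=> i ni; apply: dig; rewrite ltnS ltnW.
by rewrite /block dig.
Qed.

(** In a coordinate where the blocks differ, the two points lie in the lower halves of distinct
    cells of side 2^-depth(n+1), hence at least half a side apart. *)
Lemma moran_separated y y' n :
  (forall i, (i < n)%N -> digit i y = digit i y') -> digit n y != digit n y' ->
  (2 ^+ depth n.+1)^-1 / 2 <= `|moran_point y - moran_point y'|.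
Proof.
move=> dig dn.
have bn : block n y != block n y'.
  by rewrite /block nth_uniq ?enum_uniq// ltn_mod nblocks_gt0.
have [c bc] : exists c, block n y ord0 c != block n y' ord0 c.
  apply/existsP; apply: contraNT bn; rewrite negb_exists => /forallP h.
  by apply/eqP/rowP => c; apply/eqP; have := h c; rewrite negbK.
apply: le_trans (coord_le_norm _ c); rewrite rV_subE.
have := moran_point_bounds y n.+1 c; have := moran_point_bounds y' n.+1 c.
rewrite !moran_nodeS.
have -> : moran_node y' n = moran_node y n by rewrite /moran_node (moran_index_eq dig).
set a := (2 ^+ depth n.+1)^-1; have a0 : 0 < a by rewrite invr_gt0.
set u := block n y ord0 c in bc *; set v := block n y' ord0 c in bc *.
move=> /andP[h1 h2] /andP[h3 h4].
have : (u < v)%N || (v < u)%N by rewrite -neq_ltn.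
move=> /orP[uv|vu].
  have : (u%:R + 1) * a <= v%:R * a by rewrite ler_pM2r// natr1 ler_nat.
  by move=> uva; rewrite ler0_norm; lra.
have : (v%:R + 1) * a <= u%:R * a by rewrite ler_pM2r// natr1 ler_nat.
by move=> uva; rewrite ger0_norm; lra.
Qed.

Lemma count_blocks_lower n :
  expR (\sum_(k < n) (L k)%:R * (q - eps k)) <= (count_blocks n)%:R.
Proof.
elim: n => [|n IH]; first by rewrite big_ord0 expR0 /count_blocks big_ord0.
rewrite big_ord_recr/= expRD count_blocksS natrM ler_pM ?expR_ge0// nblocksE.
exact: good_card.
Qed.

(** Let n be the first differing digit. Closeness of the parameters uses the first n blocks, whereas
    separation of the points is only known at depth n + 1; [key] bridges the gap, as block n and the
    zero digits are negligible. The room between [s ln 2] and [q] pays for this. *)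
Lemma moran_point_expands s : 0 <= s -> s * ln 2 < q -> exists2 C, 0 < C &
  forall y y', 0 <= y < 1 -> 0 <= y' < 1 ->
    `|y - y'| <= C * `|moran_point y - moran_point y'| `^ s.
Proof.
move=> s0 sq; have l2 : 0 < ln 2 :> R by rewrite ln_gt0// ltr1n.
have sl : 0 <= s * ln 2 by rewrite mulr_ge0// ltW.
pose be := (q + s * ln 2) / 2.
have be0 : 0 < be by rewrite /be; lra.
have beq : be < q by rewrite /be; lra.
have sbe : s * ln 2 <= be by rewrite /be; lra.
have b1 : 0 < 2 * be + 1 by lra.
(* The rate [et] is spent three times: with weight [be] on the zero digits and on the last block,
   and with weight 1 on the loss in the block counts. *)
pose et := (q - be) / (2 * be + 1).
have et0 : 0 < et by rewrite divr_gt0// subr_gt0.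
have etE : et * (2 * be + 1) = q - be by rewrite /et divfK// gt_eqF.
have [c1 [c10 h1]] := sum_eps_small et0.
have [c2 [c20 h2]] := L_small et0.
pose c := c1 + be * (c1 + c2 + 1).
have key n : be * (depth n.+1)%:R <= \sum_(k < n) (L k)%:R * (q - eps k) + c.
  have -> : \sum_(k < n) (L k)%:R * (q - eps k) = q * Lam n - \sum_(k < n) (L k)%:R * eps k.
    by rewrite /Lam mulr_sumr -sumrB; apply: eq_bigr => k _; ring.
  have nle : n%:R <= \sum_(k < n) (L k)%:R * eps k.
    elim: n => [|n IH]; first by rewrite big_ord0.
    by rewrite big_ord_recr/= -natr1 lerD.
  have Lam0 : 0 <= Lam n by apply: sumr_ge0.
  rewrite depthS natrD depth_Lam -natr1.
  have : be * (Lam n + n%:R + ((L n)%:R + 1)) <=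
      be * (Lam n + (et * Lam n + c1) + (et * Lam n + c2 + 1)).
    by rewrite ler_pM2l//; have := h1 n; have := h2 n; lra.
  have E : et * (2 * be + 1) * Lam n = (q - be) * Lam n by rewrite etE.
  by have := h1 n; rewrite /c; lra.
have close y y' n : 0 <= y < 1 -> 0 <= y' < 1 ->
    (forall i, (i < n)%N -> digit i y = digit i y') ->
    `|y - y'| <= expR (c - be * (depth n.+1)%:R).
  move=> y01 y'01 /(digits_close y01 y'01) h.
  have cn : 0 < (count_blocks n)%:R :> R by rewrite ltr0n count_blocks_gt0.
  rewrite -ler_pdivlMr// mul1r in h; apply: le_trans h _.
  rewrite -[leRHS]invrK -expRN lef_pV2 ?posrE ?expR_gt0//.
  apply: le_trans (count_blocks_lower n); rewrite ler_expR.
  by have := key n; lra.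
exists (expR (c + s * ln 2)); first exact: expR_gt0.
move=> y y' y01 y'01; have [->|yy'] := eqVneq y y'.
  by rewrite subrr normr0 mulr_ge0 ?expR_ge0 ?powR_ge0.
have d0 : 0 < `|y - y'| by rewrite normr_gt0 subr_eq0.
have ex : exists n, digit n y != digit n y'.
  apply: contrapT => /forallNP nex.
  have [n [_ hn]] := exists_scale (c - ln `|y - y'| + 1) be0.
  have {}hn := hn n (leqnn n).
  have : `|y - y'| <= expR (c - be * (depth n.+1)%:R).
    by apply: close => // i _; apply/eqP; have /negP := nex i; rewrite negbK.
  rewrite -[leLHS]lnK ?posrE// ler_expR.
  have : n%:R <= (depth n.+1)%:R :> R.
    rewrite depth_Lam -natr1; have : 0 <= Lam n.+1 by apply: sumr_ge0.
    lra.
  rewrite -(ler_pM2l be0); lra.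
have [n dn nmin] := ex_minnP ex.
have dig i : (i < n)%N -> digit i y = digit i y'.
  by move=> ni; apply/eqP; apply: contraLR ni => /nmin; rewrite -leqNgt.
apply: le_trans (close y y' n y01 y'01 dig) _.
have sep := moran_separated dig dn.
set d := depth n.+1 in sep *.
have sepE : (2 ^+ d)^-1 / 2 = expR (- ((d%:R + 1) * ln 2)) :> R.
  rewrite mulrDl mul1r opprD expRD expRN expRM_natl lnK ?posrE//.
  by rewrite expRN lnK ?posrE.
apply: (@le_trans _ _ (expR (c + s * ln 2) * ((2 ^+ d)^-1 / 2) `^ s)).
  rewrite sepE /powR gt_eqF ?expR_gt0// expRK -expRD ler_expR.
  have : s * ln 2 * d%:R <= be * d%:R by rewrite ler_wpM2r.
  lra.
by rewrite ler_wpM2l ?expR_ge0//; apply: ge0_ler_powR => //; rewrite nnegrE.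
Qed.

End moran_set.

(** * The formalism *)

(** A cover of the image pulls back to a cover of [0, 1) by intervals of length at most 2 C diam^s,
    so the sum of diam^s is at least 1 / (2 C). *)
Lemma mass_distribution (R : realType) (V : normedModType R) (g : R -> V) (C s : R) :
  0 < C -> 0 <= s ->
  (forall y y', 0 <= y < 1 -> 0 <= y' < 1 -> `|y - y'| <= C * `|g y - g y'| `^ s) ->
  hausdorff_measure s [set g y | y in [set y | 0 <= y < 1]] <> 0%E.
Proof.
move=> C0 s0 gC h0.
set A := [set g y | y in _] in h0.
have : (((2 * C)^-1)%:E <= hausdorff_measure s A)%E; last first.
  by rewrite h0 lee_fin leNgt invr_gt0 mulr_gt0.
(* Any positive scale works; its role is to keep the diameters finite. *)
apply: (@le_trans _ _ (hausdorff_premeasure 1 s A)); last first.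
  by apply: ereal_sup_ubound; exists 1 => //=.
apply: le_ereal_inf_tmp => _ [U [AU dU] <-].
have C2 : 0 < 2 * C by rewrite mulr_gt0.
pose leb : {measure set (measurableTypeR R) -> \bar R} := @lebesgue_measure R.
(* An interval around one parameter stands in for the preimage of [U i], which might fail to be
   measurable. *)
have cover i : exists I : set (measurableTypeR R), [/\ measurable I,
    (leb I <= (2 * C)%:E * diam_pow s (U i))%E &
    forall y, 0 <= y < 1 -> U i (g y) -> I y].
  have [[y0 [y01 Uy0]]|no] := pselect (exists y0, 0 <= y0 < 1 /\ U i (g y0)); last first.
    exists set0; split => //.
      by rewrite measure0 mule_ge0// ?diam_pow_ge0// lee_fin ltW.
    by move=> y y01 Uy; exfalso; apply: no; exists y.
  have Un0 : U i != set0 by apply/set0P; exists (g y0).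
  have dist y : U i (g y) -> (`|g y - g y0|%:E <= diam (U i))%E.
    by move=> Uy; apply: ereal_sup_ubound; exists (g y, g y0).
  have dge0 : (0%:E <= diam (U i))%E by have := dist _ Uy0; rewrite subrr normr0.
  have [r rE] : exists r, diam (U i) = r%:E.
    exists (fine (diam (U i))); rewrite fineK// ge0_fin_numE//.
    exact: le_lt_trans (dU i) (ltry _).
  rewrite rE in dist dge0; rewrite lee_fin in dge0.
  have lebJ : (lebesgue_measure [set` `[(y0 - C * r `^ s)%R, (y0 + C * r `^ s)%R] : interval R]
      <= (2 * C * r `^ s)%:E)%E.
    rewrite lebesgue_measure_itv/= lte_fin; case: ifP => _.
      by rewrite -EFinD lee_fin; lra.
    by rewrite lee_fin mulr_ge0 ?powR_ge0// ltW.
  exists `[y0 - C * r `^ s, y0 + C * r `^ s]%classic; split.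
  - exact: measurable_itv.
  - rewrite /diam_pow (negbTE Un0) rE poweR_EFin -EFinM.
    exact: lebJ.
  - move=> y yI Uy; rewrite /= in_itv/= -ler_distlC.
    apply: le_trans (gC _ _ y01 yI) _.
    rewrite ler_pM2l//; apply: ge0_ler_powR; rewrite ?nnegrE//.
    by rewrite distrC; have := dist y Uy; rewrite lee_fin.
have [I IP] := choice cover.
have leb1 : (1%:E <= lebesgue_measure [set` `[0%R, 1%R[ : interval R])%E.
  by rewrite lebesgue_measure_itv/= lte_fin ltr01 -EFinD subr0.
have sub : (leb `[0%R, 1%R[%classic <= \sum_(i <oo) leb (I i))%E.
  apply: measure_sigma_subadditive.
  - by move=> i; have [] := IP i.
  - exact: measurable_itv.
  - move=> y; rewrite /= in_itv/= => y01.
    have [i _ Ui] := AU (g y) (ex_intro2 _ _ y y01 erefl).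
    by exists i => //; have [_ _] := IP i; exact.
have le2 : (\sum_(i <oo) leb (I i) <= (2 * C)%:E * \sum_(i <oo) diam_pow s (U i))%E.
  rewrite -nneseriesZl; last by move=> i _; exact: diam_pow_ge0.
  by apply: lee_nneseries => i _; [move=> _; exact: measure_ge0|have [] := IP i].
have := le_trans (le_trans leb1 sub) le2; rewrite -lee_pdivrMl// mule1.
by [].
Qed.

(* Repeating each block length [Lb b] long enough makes a single block negligible
   compared with the blocks before it. *)
Lemma block_sequence (Lb : nat -> nat) : exists b : nat -> nat,
  (forall i, (b i * Lb (b i) <= i)%N) /\ (forall B, exists I, forall i, (I <= i)%N -> (B <= b i)%N).
Proof.
have H i : exists b, (b * Lb b <= i)%N /\
    forall c, (c <= i)%N -> (c * Lb c <= i)%N -> (c <= b)%N.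
  have ex : exists b, (b <= i)%N && (b * Lb b <= i)%N by exists 0%N.
  have ub b : (b <= i)%N && (b * Lb b <= i)%N -> (b <= i)%N by move=> /andP[].
  have [b /andP[_ bP] bmax] := ex_maxnP ex ub.
  by exists b; split => // c ci cL; apply: bmax; rewrite ci.
have [b bP] := choice H; exists b; split => [i|B]; first by have [] := bP i.
exists (maxn B (B * Lb B)) => i; rewrite geq_max => /andP[Bi BLi].
by have [_] := bP i; exact.
Qed.

Section gibbs_like_formalism.
Variables (R : realType) (m : nat) (kappa : set 'rV[R]_m -> R).
Variables (psi : 'rV[R]_m -> R) (K B : R).
Hypotheses (tpsi : tame psi K) (gl : gibbs_like kappa psi B).
Hypothesis kappa_mono :
  forall E F, borel_cube E -> borel_cube F -> E `<=` F -> kappa E <= kappa F.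

Let ln2_gt0 : 0 < ln 2 :> R. Proof. by rewrite ln_gt0// ltr1n. Qed.

Lemma level_moran h s : (forall t j,
    expR (j%:R * (s * ln 2 - t * (h * ln 2)) - `|t| * K) <=
    partition_sum (fun x => - t * psi x) j) ->
  exists g : R -> 'rV[R]_m, (forall y, level kappa h (g y)) /\
    forall s', 0 <= s' -> s' < s -> exists2 C, 0 < C &
      forall y y', 0 <= y < 1 -> 0 <= y' < 1 -> `|y - y'| <= C * `|g y - g y'| `^ s'.
Proof.
move=> hq.
have blk (b : nat) : exists L, [/\ 1 <= L%:R * (b.+1%:R^-1 : R) &
    expR (L%:R * (s * ln 2 - b.+1%:R^-1)) <=
      #|@good_block R m psi (h * ln 2) L b.+1%:R^-1|%:R].
  by apply: (good_blocks tpsi hq); rewrite invr_gt0.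
have [Lb LbP] := choice blk.
have [b [bL bcvg]] := block_sequence Lb.
have [M M0 psiM] := tame_bounded tpsi.
pose L i := Lb (b i); pose eps i : R := (b i).+1%:R^-1.
have eps_gt0 i : 0 < eps i by rewrite invr_gt0.
have L_ge i : 1 <= (L i)%:R * eps i by have [] := LbP (b i).
have card i : expR ((L i)%:R * (s * ln 2 - eps i)) <=
    #|@good_block R m psi (h * ln 2) (L i) (eps i)|%:R by have [] := LbP (b i).
have eps_cvg e : 0 < e -> exists I, forall i, (I <= i)%N -> eps i <= e.
  move=> e0; have [N [N0 hN]] := exists_scale 1 e0.
  have [I hI] := bcvg N; exists I => i /hI Nb.
  rewrite /eps -[leLHS]mul1r ler_pdivrMr ?ltr0n// mulrC.
  by apply: hN; rewrite (leq_trans Nb).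
(* Multiplied by [b i + 1], this is [b i * L i <= i], the defining property of the sequence [b]. *)
have L_le i : (L i)%:R <= eps i * (i%:R + (L i)%:R).
  rewrite /eps mulrC ler_pdivlMr ?ltr0n// -natr1 mulrDr mulr1 lerD2r.
  by rewrite -natrM ler_nat mulnC; exact: bL.
exists (moran_point psi (h * ln 2) L eps); split => [y|s' s'0 s's].
  have yQ := moran_point_cube psi (h * ln 2) L eps y.
  have [lo up] := dim_of_cvg gl yQ (moran_birkhoff tpsi psiM eps_gt0 L_ge card eps_cvg L_le y).
  split=> //.
  exact (ball_cap_supp gl kappa_mono yQ).
apply: (moran_point_expands eps_gt0 L_ge card eps_cvg L_le s'0).
by rewrite ltr_pM2r.
Qed.

Lemma gibbs_like_SMF : SMF kappa.
Proof.
have prs t : exists P, forall j,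
    `|ln (partition_sum (fun x => - t * psi x) j) - j%:R * P| <= `|t| * K.
  exact: pressure (tame_scale tpsi t).
have [P hP] := choice prs.
have tauE t : tau kappa t = (- P t / ln 2)%:E by apply: (tau_gibbs_like gl); exact: hP.
move=> h _; set T := legendre _ h.
have TE t : (T <= (h * t + P t / ln 2)%:E)%E.
  apply: ereal_inf_lbound; exists t => //.
  by rewrite tauE -EFinN -EFinD; congr EFin; rewrite mulNr opprK.
have up : (spectrum kappa h <= T)%E.
  apply: le_ereal_inf_tmp => _ [t _ <-]; rewrite tauE -EFinN -EFinD mulNr opprK.
  by apply: (spectrum_upper tpsi gl); exact: hP.
have sub : (hausdorff_dim (level kappa h) <= spectrum kappa h)%E.
  by apply: le_hausdorff_dim => x [].
have lo : (T <= hausdorff_dim (level kappa h))%E.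
  (* The value +oo contradicts the bound at t = 0, and -oo is trivial. A finite value [s] gives the
     lower bound [hq] on all partition sums. *)
  case TE0 : T => [s| |]; last exact: leNye; last first.
    by have := TE 0; rewrite TE0 leye_eq.
  have hq t j : expR (j%:R * (s * ln 2 - t * (h * ln 2)) - `|t| * K) <=
      partition_sum (fun x => - t * psi x) j.
    rewrite -[leRHS]lnK ?posrE ?partition_sum_gt0// ler_expR.
    have := TE t; rewrite TE0 lee_fin -(ler_pM2r ln2_gt0) mulrDl divfK ?gt_eqF// => hs.
    have : j%:R * (s * ln 2 - t * (h * ln 2)) <= j%:R * P t by rewrite ler_wpM2l//; lra.
    by have := hP t j; rewrite ler_norml => /andP[]; lra.
  have [g [gl' gC]] := level_moran hq.
  rewrite /hausdorff_dim; case: eqP => [E0|_].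
    by have := gl' 0; rewrite E0.
  (* An exponent [s'] below [s] with zero measure would contradict the mass distribution on the
     Moran set inside the level set. *)
  apply: le_ereal_inf_tmp => _ [s' [s'0 Hs'] <-]; rewrite lee_fin leNgt.
  apply/negP => s's; have [C C0 hC] := gC s' s'0 s's.
  apply: (mass_distribution C0 s'0 hC).
  apply/eqP; rewrite eq_le hausdorff_measure_ge0 andbT -Hs'.
  by apply: le_hausdorff_measure => _ [y _ <-]; exact: gl'.
split; apply/eqP; rewrite eq_le; apply/andP; split => //.
- exact: le_trans lo sub.
- exact: le_trans sub up.
Qed.

End gibbs_like_formalism.

Theorem proposition1p10 (R : realType) (d d' : nat)
    (mu : set 'rV[R]_d -> R) (nu : set 'rV[R]_d' -> R)
    (xi : set 'rV[R]_(d + d') -> R) :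
  (0 < d)%N -> (0 < d')%N ->
  gibbs_capacity mu -> gibbs_capacity nu -> product_capacity mu nu xi ->
  SMF xi /\ (forall t : R, tau xi t = (tau mu t + tau nu t)%E).
Proof.
move=> _ _ /gibbs_capacity_like[psi [K [B [tpsi gmu]]]].
move=> /gibbs_capacity_like[psi' [K' [B' [tpsi' gnu]]]] xiP.
have gxi := gibbs_like_prod xiP gmu gnu.
have txi := tame_prod tpsi tpsi'.
split; first by apply: gibbs_like_SMF txi gxi _; exact: xiP.1.
move=> t.
have [P hP] := pressure (tame_scale tpsi t).
have [P' hP'] := pressure (tame_scale tpsi' t).
rewrite (tau_gibbs_like gmu hP) (tau_gibbs_like gnu hP').
rewrite (tau_gibbs_like (K := K + K') (P := P + P') gxi).
  by rewrite -EFinD; congr EFin; ring.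
move=> j; rewrite (_ : (fun x => _) = (fun x : 'rV[R]_(d + d') =>
    (fun u => - t * psi u) (lsubmx x) + (fun v => - t * psi' v) (rsubmx x))); last first.
  by apply/funext => x; rewrite mulrDr.
rewrite (partition_sum_prod (fun u => - t * psi u) (fun v => - t * psi' v)) lnM ?posrE ?partition_sum_gt0//.
rewrite !mulrDr opprD addrACA (le_trans (ler_normD _ _))// lerD//.
Qed.
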